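(* Let $p,q \in (0,\infty]$, $\alpha,\beta \in [0,1]$, let $\mathcal{Q} = (Q_i)_{i\in I}$ and $\mathcal{P} = (P_j)_{j\in J}$ be two $(\alpha,\beta)$-coverings of $\mathbb{R}^2$, and let $w = (w_i)_{i\in I}$ and $v = (v_j)_{j\in J}$ be $\mathcal{Q}$-moderate and $\mathcal{P}$-moderate weights, respectively. Assume that $w_i \asymp v_j$ for any $i\in I$ and $j \in J$ satisfying $Q_i \cap P_j \ne \emptyset$. Then the following holds: (1) If $p \in [1,\infty]$ and if $\mathcal{Q},\mathcal{P}$ are $L^p$-decomposition coverings, then $\mathcal{D}(\mathcal{Q},L^p,\ell_w^q) = \mathcal{D}(\mathcal{P},L^p,\ell_v^q)$ with equivalent quasi-norms. (2) If $p \in (0,1)$, if $\beta \le \alpha$, and if $\mathcal{Q},\mathcal{P}$ are semi-structured $L^p$-decomposition coverings, then $\mathcal{D}(\mathcal{Q},L^p,\ell_w^q) = \mathcal{D}(\mathcal{P},L^p,\ell_v^q)$ with equivalent quasi-norms.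
   Context: Conventions: $\mathbb R^2$ is identified with $\mathbb C$; $\lambda$ is Lebesgue measure; $A\lesssim B$ means $A\le CB$ with $C$ independent of the indices and points involved, $A\asymp B$ means $A\lesssim B\lesssim A$. Fourier transform: $\widehat f(\xi)=\int f(x)e^{-2\pi i\langle x,\xi\rangle}dx$. A family $\mathcal Q=(Q_i)_{i\in I}$ of subsets covering $\mathbb R^2$ is an admissible covering if the sets $i^\ast:=\{\ell\in I:Q_\ell\cap Q_i\ne\emptyset\}$ have uniformly bounded cardinality. A weight $w=(w_i)_{i\in I}$, $w_i\in(0,\infty)$, is $\mathcal Q$-moderate if there is $C>0$ with $w_i\le Cw_\ell$ whenever $Q_i\cap Q_\ell\ne\emptyset$. $(\alpha,\beta)$-covering ($\alpha,\beta\in[0,1]$): a family $\mathcal Q=(Q_i)_{i\in I}$ of open bounded subsets of $\mathbb R^2$ such that (1) $\mathcal Q$ is an admissible covering of $\mathbb R^2$; (2) $\lambda(Q_i)\asymp(1+|\xi|)^{\alpha+\beta}$ for all $i\in I$, $\xi\in Q_i$; (3) for each $i$ there is an interval $L_i\subset[0,\infty)$ with $\lambda(L_i)\lesssim(1+|\xi|)^\alpha$ and $|\xi|\in L_i$ for all $\xi\in Q_i$; (4) for each $i$ there is $\phi_i\in\mathbb R$ such that every $\xi\in Q_i$ can be written $\xi=|\xi|e^{i\phi}$ with some $\phi\in\mathbb R$ satisfying $\min_{\omega\in\{0,\pi\}}|\phi-(\phi_i+\omega)|\lesssim(1+|\xi|)^{\beta-1}$. All implied constants are independent of $i\in I$ and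 $\xi\in Q_i$. Semi-structured covering: an admissible covering $\mathcal Q=(Q_i)_{i\in I}$ with an associated family $(T_i\cdot+b_i)_{i\in I}$ of invertible affine-linear maps such that there are non-empty open uniformly bounded sets $Q_i'$ with $Q_i=T_iQ_i'+b_i$, and there is $C>0$ with $\|T_i^{-1}T_\ell\|\le C$ whenever $Q_i\cap Q_\ell\ne\emptyset$. $L^p$-BAPU: for $p\in[1,\infty]$, a family $(\varphi_i)_{i\in I}$ in $C_c^\infty(\mathbb R^2)$ with $\varphi_i=0$ on $\mathbb R^2\setminus Q_i$, $\sum_i\varphi_i\equiv1$, and $\sup_i\|\mathcal F^{-1}\varphi_i\|_{L^1}<\infty$. For $p\in(0,1)$ and $\mathcal Q$ semi-structured, one requires in addition $\sup_i|\det T_i|^{p^{-1}-1}\|\mathcal F^{-1}\varphi_i\|_{L^p}<\infty$. $\mathcal Q$ is an $L^p$-decomposition covering if it admits an $L^p$-BAPU. Decomposition space: let $Z:=\mathcal F(C_c^\infty(\mathbb R^2))$ with the topology making $\mathcal F:C_c^\infty(\mathbb R^2)\to Z$ a homeomorphism, $Z'$ its topological dual, $\widehat g:=g\circ\mathcal F\in\mathcal D'(\mathbb R^2)$ for $g\in Z'$. For an $L^p$-decomposition covering $\mathcal Q$ with $L^p$-BAPU $(\varphi_i)_{i\in I}$ and a $\mathcal Q$-moderate weight $w$, $\mathcal D(\mathcal Q,L^p,\ell_w^q):=\{g\in Z':\|(w_i\|\mathcal F^{-1}(\varphi_i\widehat g)\|_{L^p})_{i\in I}\|_{\ell^q}<\infty\}$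 with this expression as quasi-norm (different $L^p$-BAPUs give equivalent quasi-norms). *)

(* Defs.v *)
From mathcomp Require Import all_boot all_order all_algebra.
From mathcomp Require Import all_classical all_reals all_analysis.
From mathcomp Require Export complex.

Set Implicit Arguments.
Unset Strict Implicit.
Unset Printing Implicit Defensive.

Import Order.TTheory GRing.Theory Num.Theory.
Import numFieldNormedType.Exports.

Local Open Scope classical_set_scope.
Local Open Scope ring_scope.
Local Open Scope complex_scope.

(* The norm of the product normed module R * R is the max norm; the Euclidean
   norm is introduced separately. *)
Notation plane R := (R * R)%type.

Section Plane.
Context {R : realType}.
Implicit Types x y : plane R.

Definition inner x y : R := x.1 * y.1 + x.2 * y.2.

Definition enorm x : R := Num.sqrt (inner x x).

Definition plane_measure :
    {measure set (measurableTypeR R * measurableTypeR R) -> \bar R} :=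
  (@lebesgue_measure R \x @lebesgue_measure R)%E.

Definition expi (t : R) : R[i] := cos t +i* sin t.

Definition cmod (z : R[i]) : R := ComplexField.Normc.normc z.

Definition wave x : plane R -> R[i] := fun xi => expi (2 * pi * inner x xi).

Definition cintegral (f : plane R -> R[i]) : R[i] :=
  (\int[plane_measure]_x complex.Re (f x)) +i*
  (\int[plane_measure]_x complex.Im (f x)).

Definition fourier (f : plane R -> R[i]) : plane R -> R[i] :=
  fun xi => cintegral (fun x => f x * expi (- (2 * pi * inner x xi))).

Definition fourier_inv (f : plane R -> R[i]) : plane R -> R[i] :=
  fun x => cintegral (fun xi => f xi * expi (2 * pi * inner x xi)).

Definition Lp_norm (p : \bar R) (f : plane R -> R[i]) : \bar R :=
  Lnorm plane_measure p (fun x => (cmod (f x))%:E).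

Definition lq_norm (I : choiceType) (q : \bar R) (a : I -> \bar R) : \bar R :=
  match q with
  | r%:E => ((\esum_(i in [set: I]) (a i `^ r)) `^ r^-1)%E
  | +oo%E => ereal_sup (range a)
  | -oo%E => 0%E
  end.

End Plane.

Section TestFunctions.
Context {R : realType}.

Definition coord_dir (k : bool) : plane R := if k then (0, 1) else (1, 0).

(* A word s of booleans encodes a mixed partial derivative of order size s. *)
Fixpoint iter_partial (s : seq bool) (u : plane R -> R) : plane R -> R :=
  if s is k :: s' then (fun x => 'D_(coord_dir k) (iter_partial s' u) x) else u.

Definition smooth (u : plane R -> R) : Prop :=
  forall s : seq bool, continuous (iter_partial s u) /\
    forall (k : bool) (x : plane R),
      derivable (iter_partial s u) x (coord_dir k).

Definition supp (f : plane R -> R[i]) : set (plane R) :=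
  closure [set x | f x != 0].

Definition test_function (f : plane R -> R[i]) : Prop :=
  [/\ smooth (@complex.Re R \o f), smooth (@complex.Im R \o f) & compact (supp f)].

Definition cpartial (s : seq bool) (f : plane R -> R[i]) : plane R -> R[i] :=
  fun x => iter_partial s (@complex.Re R \o f) x +i*
           iter_partial s (@complex.Im R \o f) x.

Definition absolutely_convex (V : set (plane R -> R[i])) : Prop :=
  forall (f g : plane R -> R[i]) (a b : R[i]), V f -> V g ->
    cmod a + cmod b <= 1 -> V (fun x => a * f x + b * g x).

(* The usual (LF) topology of C_c^oo: the absolutely convex sets of test
   functions whose trace on each space C_K^oo (K compact) is a neighbourhood of
   0 form a basis of neighbourhoods of 0. *)
Definition test_nbhs0 : set_system (plane R -> R[i]) :=
  fun U => exists V : set (plane R -> R[i]),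
    [/\ V `<=` test_function `&` U,
        absolutely_convex V &
        forall K : set (plane R), compact K ->
          exists (N : nat) (e : R), 0 < e /\
            forall f : plane R -> R[i], test_function f -> supp f `<=` K ->
              (forall (s : seq bool) (x : plane R),
                 (size s <= N)%N -> cmod (cpartial s f x) <= e) ->
              V f].

Definition test_nbhs (f : plane R -> R[i]) : set_system (plane R -> R[i]) :=
  [set U | test_nbhs0 [set h | U (fun x => f x + h x)]].

End TestFunctions.

Section Reservoir.
Context {R : realType}.

Definition Zspace : set (plane R -> R[i]) := [set fourier f | f in test_function].

(* The topology transported from C_c^oo by the Fourier transform. *)
Definition Z_nbhs (h : plane R -> R[i]) : set_system (plane R -> R[i]) :=
  [set A | exists2 f : plane R -> R[i],
     test_function f /\ fourier f = h & test_nbhs f (fourier @^-1` A)].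

(* A functional on Zspace is represented by its extension by 0 to all
   functions, so that equality of elements of Z' is equality of functionals
   on Zspace. *)
Definition Zdual : set ((plane R -> R[i]) -> R[i]) :=
  [set g |
    [/\ forall h, ~ Zspace h -> g h = 0,
        forall (a : R[i]) h1 h2, Zspace h1 -> Zspace h2 ->
          g (fun x => a * h1 x + h2 x) = a * g h1 + g h2 &
        forall h, Zspace h -> forall e : R, 0 < e ->
          Z_nbhs h [set h' | cmod (g h' - g h) < e]]].

Definition hat (g : (plane R -> R[i]) -> R[i]) : (plane R -> R[i]) -> R[i] :=
  fun f => g (fourier f).

(* The product of a test function phi and a distribution u; since phi has
   compact support, it acts on all smooth functions. *)
Definition distr_mul (phi : plane R -> R[i]) (u : (plane R -> R[i]) -> R[i]) :
    (plane R -> R[i]) -> R[i] :=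
  fun f => u (fun x => phi x * f x).

(* The inverse Fourier transform of a compactly supported distribution u is the
   smooth function x |-> u(exp(2 pi i <x, .>)). *)
Definition distr_fourier_inv (u : (plane R -> R[i]) -> R[i]) :
    plane R -> R[i] :=
  fun x => u (wave x).

End Reservoir.

Section Coverings.
Context {R : realType} {I : choiceType}.
Implicit Types (Q : I -> set (plane R)) (w : I -> R) (phi : I -> plane R -> R[i]).

Definition neighbors Q (i : I) : set I := [set l | Q l `&` Q i !=set0].

Definition admissible_covering Q : Prop :=
  \bigcup_i Q i = setT /\ exists N : nat, forall i, (neighbors Q i #<= `I_N)%card.

Definition moderate_weight Q w : Prop :=
  (forall i, 0 < w i) /\
  exists2 C : R, 0 < C &
    forall i l, Q i `&` Q l !=set0 -> w i <= C * w l.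

Definition alpha_beta_covering (alpha beta : R) Q : Prop :=
  [/\ forall i, open (Q i) /\ bounded_set (Q i),
      admissible_covering Q,
      exists2 C : R, 0 < C & forall i xi, Q i xi ->
        (plane_measure (Q i) <= (C * (1 + enorm xi) `^ (alpha + beta))%:E)%E /\
        (((1 + enorm xi) `^ (alpha + beta))%:E <= C%:E * plane_measure (Q i))%E,
      exists2 C : R, 0 < C & forall i, exists L : set R,
        [/\ is_interval L, L `<=` `[0, +oo[ &
            forall xi, Q i xi -> L (enorm xi) /\
              (lebesgue_measure L <= (C * (1 + enorm xi) `^ alpha)%:E)%E] &
      exists2 C : R, 0 < C & forall i, exists phi_i : R, forall xi, Q i xi ->
        exists2 t : R, xi = (enorm xi * cos t, enorm xi * sin t) &
          Num.min `|t - phi_i| `|t - (phi_i + pi)|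
            <= C * (1 + enorm xi) `^ (beta - 1)].

Definition mx_act (A : 'M[R]_2) (x : plane R) : plane R :=
  (A 0 0 * x.1 + A 0 1 * x.2, A 1 0 * x.1 + A 1 1 * x.2).

Definition op_norm (A : 'M[R]_2) : R :=
  sup [set enorm (mx_act A x) | x in [set x | enorm x <= 1]].

Definition semi_structured Q (T : I -> 'M[R]_2) (b : I -> plane R) : Prop :=
  [/\ admissible_covering Q,
      forall i, T i \in unitmx,
      exists Q' : I -> set (plane R),
        [/\ forall i, Q' i !=set0 /\ open (Q' i),
            exists r : R, forall i x, Q' i x -> enorm x <= r &
            forall i, Q i = [set mx_act (T i) x + b i | x in Q' i]] &
      exists2 C : R, 0 < C & forall i l, Q i `&` Q l !=set0 ->
        op_norm (invmx (T i) *m T l) <= C].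

Definition bapu Q phi : Prop :=
  [/\ forall i, test_function (phi i),
      forall i x, ~ Q i x -> phi i x = 0,
      forall x, \sum_(i \in [set: I]) phi i x = 1 &
      (ereal_sup (range (fun i => Lp_norm 1 (fourier_inv (phi i)))) < +oo)%E].

Definition quasi_bapu (p : \bar R) Q (T : I -> 'M[R]_2) phi : Prop :=
  bapu Q phi /\
  (ereal_sup (range (fun i =>
     (`|\det (T i)| `^ ((fine p)^-1 - 1))%:E * Lp_norm p (fourier_inv (phi i))))
   < +oo)%E.

Definition decomp_norm (p q : \bar R) phi w
    (g : (plane R -> R[i]) -> R[i]) : \bar R :=
  lq_norm q (fun i =>
    ((w i)%:E * Lp_norm p (distr_fourier_inv (distr_mul (phi i) (hat g))))%E).

Definition decomp_space (p q : \bar R) phi w : set ((plane R -> R[i]) -> R[i]) :=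
  [set g | Zdual g /\ (decomp_norm p q phi w g < +oo)%E].

End Coverings.

Definition equal_with_equivalent_norms (R : realType) (X : Type)
    (D1 D2 : set X) (n1 n2 : X -> \bar R) : Prop :=
  D1 = D2 /\
  exists2 C : R, 0 < C & forall g, D1 g ->
    (n1 g <= C%:E * n2 g)%E /\ (n2 g <= C%:E * n1 g)%E.

(* Main.v *)
(** The core is a Fourier multiplier estimate, which replaces the inequalities
    of Young and Nikolskii. Let [phi], [psi] be test functions vanishing off
    [A], [B], and let [M Z^2] be a lattice none of whose nonzero translations
    maps a point of [A] into [B]. On [A], [psi] equals its periodization along
    [M Z^2], so the band [F^-1 (phi psi g^)] is a superposition of translates
    of [F^-1 (phi g^)] with coefficients [F^-1 psi] sampled on a shift of the
    dual lattice and divided by [|det M|]. Averaging over the shift bounds the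
    sum of their powers [t = min(p, 1)] by [|det M|^(1-t) ||F^-1 psi||_t^t].

    If [p >= 1], any sparse enough lattice will do. If [p < 1] and
    [beta <= alpha], then [Q_i] and the sets [P_j] meeting it lie in two opposite
    rectangles of sides [r^alpha] and [r^beta], where [r = 1 + |xi|]; these are
    separated by a lattice of covolume about [r^(alpha+beta)], hence at most
    a constant times [|det S_j|]. Comparison of areas shows that boundedly
    many [P_j] meet [Q_i], and symmetrically, and the norms are compared through
    [psi_j = sum_i phi_i psi_j]. *)

From HB Require Import structures.
Require Import Defs.
From mathcomp Require Import all_boot all_order all_algebra.
From mathcomp Require Import all_classical all_reals all_analysis.
From mathcomp Require Import measurable_realfun ess_sup_inf ring lra zify.

Set Implicit Arguments.
Unset Strict Implicit.
Unset Printing Implicit Defensive.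

Import Order.TTheory GRing.Theory Num.Theory.
Import numFieldNormedType.Exports.

Local Open Scope classical_set_scope.
Local Open Scope ring_scope.
Local Open Scope complex_scope.

(** An element of [Zdual] is only a continuous linear functional, so convolutions and infinite
    superpositions of translates have no immediate meaning. The periodization is therefore
    approached by finite trigonometric sums, weighted by the coefficients of
    [(4 cos^2)^n / C(2n, n)]. Multiplied by [phi], they converge to [phi psi] with all derivatives,
    so the functional may be applied to them; the weights, lying in [[0, 1]], drop out of all
    estimates, and Fatou's lemma passes to the limit in the norms. For [p < 1] the factor
    [|det M|^(1-t)] has to be compensated by the power [|det S_j|^(t-1)] contained in the BAPU
    condition, so the lattice must separate the supports and yet have small covolume. The obstacle
    is that directions are controlled modulo [pi] only: a translation may carry one rectangle onto
    the opposite one, at distance [2 |xi|], and the lattice has to avoid this distance as well. The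
    condition [beta <= alpha] makes [|x|] and [|<x, f>|] agree up to [O(r^alpha)], so that sectors
    fit into rectangles. *)

Notation mplane R := (measurableTypeR R * measurableTypeR R)%type.
Notation leb := (@lebesgue_measure _).
Notation pleb := (@plane_measure _).

Local Notation Re := (@complex.Re _).
Local Notation Im := (@complex.Im _).

(** * Measure on the plane *)

Section PlaneMeasurability.
Context {R : realType}.

(** This links the topology of [plane R] to the product sigma-algebra of [mplane R]: an open set is
    the union of the rational squares contained in it, which are countably many. *)
Lemma open_plane_measurable (O : set (plane R)) :
  open O -> measurable (O : set (mplane R)).
Proof.
move=> oO.
pose box (t : rat * rat * rat) : set (plane R) :=
  [set x | `|x.1 - ratr t.1.1| < ratr t.2 /\ `|x.2 - ratr t.1.2| < ratr t.2].
pose D : set (rat * rat * rat) := [set t | box t `<=` O].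
have -> : O = \bigcup_(t in D) box t.
  apply/seteqP; split => [x Ox|x [t Dt] tx]; last exact: Dt tx.
  have /nbhs_ballP[e /= e0 xeO] := oO x Ox.
  have [r /andP[r0 re]] : exists r : rat, 0 < (ratr r : R) < e / 2.
    have /rat_in_itvoo[r] : 0 < e / 2 by rewrite divr_gt0.
    by rewrite in_itv/=; exists r.
  have [a] : exists a : rat, `|x.1 - ratr a| < ratr r.
    have /rat_in_itvoo[a] : x.1 - ratr r < x.1 + ratr r by lra.
    rewrite in_itv /= => /andP[h1 h2]; exists a.
    by rewrite ltr_norml; apply/andP; split; lra.
  have [b] : exists b : rat, `|x.2 - ratr b| < ratr r.
    have /rat_in_itvoo[b] : x.2 - ratr r < x.2 + ratr r by lra.
    rewrite in_itv /= => /andP[h1 h2]; exists b.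
    by rewrite ltr_norml; apply/andP; split; lra.
  move=> hb ha; exists (a, b, r) => //= y [/= h1 h2].
  apply: xeO; split => /=; rewrite /ball /=.
    rewrite (_ : x.1 - y.1 = (x.1 - ratr a) - (y.1 - ratr a)); last by ring.
    by apply: le_lt_trans (ler_normB _ _) _; lra.
  rewrite (_ : x.2 - y.2 = (x.2 - ratr b) - (y.2 - ratr b)); last by ring.
  by apply: le_lt_trans (ler_normB _ _) _; lra.
rewrite bigcup_mkcond; apply: countable_bigcupT_measurable => [|t]; first exact: countableP.
case: ifPn => // _.
rewrite (_ : box t = ball (ratr t.1.1 : R) (ratr t.2) `*` ball (ratr t.1.2 : R) (ratr t.2)).
  by rewrite !ball_itv; apply: measurableX; exact: measurable_itv.
by apply/seteqP; split => x /=; rewrite /box /ball /= ![`|ratr _ - _|]distrC.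
Qed.

Lemma closed_plane_measurable (C : set (plane R)) :
  closed C -> measurable (C : set (mplane R)).
Proof.
by move=> cC; rewrite -(setCK C); apply: measurableC; apply: open_plane_measurable; exact: closed_openC.
Qed.

Lemma continuous_plane_measurable (f : plane R -> R) :
  continuous f -> measurable_fun [set: mplane R] (f : mplane R -> measurableTypeR R).
Proof.
move=> /continuousP cf; apply: (measurability _ (RGenOpens.measurableE R)).
move=> _ [_ [a [b ->]] <-]; rewrite setTI; apply: open_plane_measurable.
exact/cf/interval_open.
Qed.

Lemma continuous_plane_emeasurable (f : plane R -> R) :
  continuous f -> measurable_fun [set: mplane R] (fun x => (f x)%:E).
Proof. by move=> cf; apply/measurable_EFinP; exact: continuous_plane_measurable. Qed.

End PlaneMeasurability.

(** * Affine changes of variables in the plane *)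

Section ChangeOfVariables.
Local Open Scope ereal_scope.
Context {R : realType}.

Lemma lebesgue_measure_affine (a c : R) : a != 0%R ->
  forall A : set (measurableTypeR R), measurable A ->
  (`|a|%:E * leb ((fun x : R => a * x + c)%R @^-1` A) = leb A)%E.
Proof.
move=> a0 A mA.
have mg : measurable_fun [set: measurableTypeR R]
    ((fun x : R => a * x + c)%R : _ -> measurableTypeR R).
  by apply: measurable_funD => //; exact: measurable_funM.
pose g : measurableTypeR R -> measurableTypeR R := (fun x : R => a * x + c)%R.
rewrite -/g in mg.
have aN : (0 <= `|a|)%R by [].
pose mu : {measure set (measurableTypeR R) -> \bar R} :=
  mscale (NngNum aN) (pushforward leb g).
apply/esym.
rewrite -[RHS]/(mu mg A); apply: lebesgue_measure_unique => //= _ [[u v]] _ <-.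
rewrite /mu /mscale /= /pushforward /=.
have [uv|vu] := ltP u v; last first.
  by rewrite set_itv_ge ?preimage_set0 ?measure0 ?mule0 ?bnd_simp // -leNgt.
have [a_gt0|a_lt0|/eqP] := ltgtP 0%R a; last by rewrite eq_sym (negbTE a0).
- rewrite (_ : _ @^-1` _ = `]((u - c) / a)%R, ((v - c) / a)%R]%classic); last first.
    apply/funext => x /=.
    by rewrite !in_itv /= ltr_pdivrMr// ler_pdivlMr// ltrBlDr lerBrDr (mulrC x).
  rewrite !lebesgue_measure_itv/= !lte_fin uv ltr_pM2r ?invr_gt0// ltrD2r uv.
  rewrite -!EFinB -EFinM gtr0_norm//; congr (_%:E).
  by field; rewrite gt_eqF.
- rewrite (_ : _ @^-1` _ = `[((v - c) / a)%R, ((u - c) / a)%R[%classic); last first.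
    apply/funext => x /=.
    by rewrite !in_itv /= ler_ndivrMr// ltr_ndivlMr// lerBrDr ltrBlDr (mulrC x) andbC.
  rewrite !lebesgue_measure_itv/= !lte_fin uv ltr_nM2r ?invr_lt0// ltrD2r uv.
  rewrite -!EFinB -EFinM ltr0_norm//; congr (_%:E).
  by field; rewrite lt_eqF.
Qed.

Lemma ge0_integral_affine (a c : R) (f : measurableTypeR R -> \bar R) : a != 0%R ->
  measurable_fun setT f -> (forall x, 0 <= f x) ->
  `|a|%:E * \int[leb]_x f (a * x + c)%R = \int[leb]_x f x.
Proof.
move=> a0 mf f0.
have mg : measurable_fun [set: measurableTypeR R]
    ((fun x : R => a * x + c)%R : _ -> measurableTypeR R).
  by apply: measurable_funD => //; exact: measurable_funM.
pose g : measurableTypeR R -> measurableTypeR R := (fun x : R => a * x + c)%R.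
rewrite -/g in mg.
have aN : (0 <= `|a|)%R by [].
pose mu : {measure set (measurableTypeR R) -> \bar R} :=
  mscale (NngNum aN) (pushforward leb g).
have -> : \int[leb]_x f x = \int[mu mg]_x f x.
  by apply: eq_measure_integral => A mA _; apply/esym/lebesgue_measure_affine.
rewrite ge0_integral_mscale// ge0_integral_pushforward//; exact: mg.
Qed.

(* [d] is the absolute value of the Jacobian determinant of [g]. *)
Definition change_of_variable (g : mplane R -> mplane R) (d : R) :=
  measurable_fun setT g /\
  forall f : mplane R -> \bar R, measurable_fun setT f -> (forall x, 0 <= f x) ->
    d%:E * \int[pleb]_x f (g x) = \int[pleb]_x f x.

Lemma change_of_variable_comp g h d e : (0 <= d)%R ->
  change_of_variable g d -> change_of_variable h e ->
  change_of_variable (g \o h) (d * e).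
Proof.
move=> d0 [mg Hg] [mh Hh]; split; first exact: measurableT_comp.
move=> f mf f0; rewrite EFinM -muleA -(Hg f)//; congr *%E.
by apply: (Hh (f \o g)) => [|x]; [exact: measurableT_comp|exact: f0].
Qed.

Lemma change_of_variable_swap : change_of_variable (fun x => (x.2, x.1)) 1.
Proof.
split; first exact: measurable_swap.
move=> f mf f0; rewrite mul1e /plane_measure.
rewrite fubini_tonelli1; last 2 first.
- by apply: measurableT_comp => //; exact: measurable_swap.
- by [].
by rewrite [RHS]fubini_tonelli2.
Qed.

(** By Tonelli, the inner integral in the second coordinate is an affine substitution on the line
    for each fixed [x.1], and the outer one is another. *)
Lemma change_of_variable_lower (a b t : R) (c : plane R) : a != 0%R -> b != 0%R ->
  change_of_variable (fun x => (a * x.1 + c.1, t * x.1 + b * x.2 + c.2)%R) (`|a| * `|b|).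
Proof.
move=> a0 b0.
have mg : measurable_fun setT
    ((fun x => (a * x.1 + c.1, t * x.1 + b * x.2 + c.2)%R) : mplane R -> mplane R).
  apply: measurable_fun_pair.
    by apply: measurable_funD => //; apply: measurable_funM.
  by do 2! apply: measurable_funD => //; apply: measurable_funM.
split => // f mf f0.
pose g := (fun x => (a * x.1 + c.1, t * x.1 + b * x.2 + c.2)%R) : mplane R -> mplane R.
have mfg : measurable_fun setT (f \o g) by exact: measurableT_comp.
have fg0 x : 0 <= (f \o g) x by exact: f0.
rewrite /plane_measure (fubini_tonelli1 _ mfg fg0) (fubini_tonelli1 _ mf f0).
have mF := measurable_fun_fubini_tonelli_F (m2 := @lebesgue_measure R) _ mf f0.
have F0 x : 0 <= fubini_F (@lebesgue_measure R) f x by apply: integral_ge0.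
rewrite -[RHS](ge0_integral_affine c.1 a0 mF F0) EFinM -muleA; congr *%E.
rewrite -ge0_integralZl//; last 2 first.
- exact: (measurable_fun_fubini_tonelli_F (m2 := @lebesgue_measure R) _ mfg fg0).
- by move=> x _; apply: integral_ge0.
apply: eq_integral => x _; rewrite /fubini_F.
have mfx : measurable_fun setT (fun y => f (a * x + c.1, y)%R).
  by apply: measurableT_comp.
rewrite -[RHS](ge0_integral_affine (t * x + c.2)%R b0 mfx)//.
congr *%E; apply: eq_integral => y _.
by rewrite /g /=; congr (f (_, _)); ring.
Qed.

Local Close Scope ereal_scope.

Lemma pairD (x y : plane R) : x + y = (x.1 + y.1, x.2 + y.2).
Proof. by []. Qed.

Lemma det_mx2 (A : 'M[R]_2) : \det A = (A 0 0 * A 1 1 - A 0 1 * A 1 0)%R.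
Proof.
rewrite (expand_det_row _ 0) !big_ord_recl big_ord0 addr0 /cofactor !det_mx11 !mxE /=.
rewrite (_ : lift 0 0 = 1 :> 'I_2); last exact: val_inj.
rewrite (_ : lift 1 0 = 0 :> 'I_2); last exact: val_inj.
by rewrite expr0 mul1r expr1 mulN1r mulrN.
Qed.

(** Gaussian elimination: if the upper left entry is nonzero, the matrix is a lower triangular one
    times an upper shear, and the shear is a lower one conjugated by the swap of coordinates.
    Otherwise the columns are exchanged beforehand. *)
Lemma change_of_variable_mx (A : 'M[R]_2) (c : plane R) : \det A != 0%R ->
  change_of_variable (fun x => mx_act A x + c)%R `|\det A|.
Proof.
rewrite det_mx2 => d0; rewrite /mx_act.
set a := A 0 0 in d0 *; set b := A 0 1 in d0 *.
set a' := A 1 0 in d0 *; set b' := A 1 1 in d0 *.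
have gen (p q r s : R) : p != 0%R -> (p * s - q * r)%R != 0%R ->
    change_of_variable (fun x : plane R => (p * x.1 + q * x.2 + c.1, r * x.1 + s * x.2 + c.2)%R)
      `|p * s - q * r|.
  move=> p0 D0.
  pose D := ((p * s - q * r) / p)%R.
  have D'0 : D != 0%R by rewrite mulf_neq0 ?invr_eq0.
  have H1 := @change_of_variable_lower p D r c p0 D'0.
  have H2 := @change_of_variable_lower 1 1 (q / p)%R 0 (oner_neq0 _) (oner_neq0 _).
  have H3 := change_of_variable_comp ler01 change_of_variable_swap
    (change_of_variable_comp (mulr_ge0 (normr_ge0 1) (normr_ge0 1)) H2 change_of_variable_swap).
  have pD : (0 <= `|p| * `|D|)%R by rewrite mulr_ge0.
  have := change_of_variable_comp pD H1 H3.
  rewrite normr1 !mulr1 -normrM (_ : (p * D = p * s - q * r)%R); last by rewrite /D; field.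
  congr (change_of_variable _ _); apply/funext => x /=.
  by congr pair; rewrite /D; field.
have [a0|a0] := boolP (a == 0%R); last exact: gen.
rewrite (eqP a0) in d0 *.
have b0 : b != 0%R by apply: contra_neq d0 => ->; ring.
have d0' : (b * a' - 0 * b')%R != 0%R by rewrite (_ : _ - _ = - (0 * b' - b * a')) ?oppr_eq0//; ring.
have := change_of_variable_comp (normr_ge0 _) (gen b 0%R b' a' b0 d0') change_of_variable_swap.
rewrite mulr1 (_ : `|b * a' - 0 * b'|%R = `|0 * b' - b * a'|%R); last first.
  by rewrite -normrN; congr (`|_|%R); ring.
congr (change_of_variable _ _); apply/funext => x /=.
by rewrite [RHS]pairD /=; congr pair; ring.
Qed.

End ChangeOfVariables.

(** * Smooth functions and Fourier transforms *)

Section RealSmooth.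
Context {R : realType}.
Implicit Types (u w : plane R -> R) (x y : plane R) (k : bool) (s : seq bool).

Lemma is_derive_line u x v (d : R) :
  is_derive (0 : R) (1 : R) (fun h => u (h *: v + x)) d -> is_derive x v u d.
Proof.
move=> [du <-]; apply: DeriveDef; first exact/(derivable1P u x v).2.
rewrite /derive; congr (lim (_ @ 0^')); apply/funext => h /=.
by rewrite addr0 scale0r add0r [_%:A]mulr1.
Qed.

Lemma is_derive_lineP u x v (d : R) :
  is_derive x v u d -> is_derive (0 : R) (1 : R) (fun h => u (h *: v + x)) d.
Proof.
move=> [du <-]; apply: DeriveDef; first exact/(derivable1P u x v).1.
rewrite /derive; congr (lim (_ @ 0^')); apply/funext => h /=.
by rewrite addr0 scale0r add0r [_%:A]mulr1.
Qed.

Definition partial k u : plane R -> R := fun x => 'D_(coord_dir k) u x.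

Lemma iter_partial_rcons s k u :
  iter_partial (rcons s k) u = iter_partial s (partial k u).
Proof. by elim: s => //= k' s ->. Qed.

Lemma smooth_continuous u : smooth u -> continuous u.
Proof. by move=> /(_ [::])[]. Qed.

Lemma smooth_derivable u k x : smooth u -> derivable u x (coord_dir k).
Proof. by move=> /(_ [::])[_]; apply. Qed.

Lemma smooth_partial u k : smooth u -> smooth (partial k u).
Proof. by move=> su s; rewrite -iter_partial_rcons. Qed.

(** Smoothness as a greatest fixed point: functions are shown to be smooth by placing them in a
    class of differentiable functions that is closed under partial derivatives. The induction
    removes the innermost derivative, the last letter of the word. *)
Lemma smooth_class (F : set (plane R -> R)) :
  (forall u, F u -> continuous u /\
     forall k, (forall x, derivable u x (coord_dir k)) /\ F (partial k u)) ->
  F `<=` smooth.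
Proof.
move=> H u Fu s; elim/last_ind: s u Fu => [|s k IH] u Fu.
  by have [cu du] := H u Fu; split=> // k x; have [] := du k.
by rewrite iter_partial_rcons; apply: IH; have [_ /(_ k)[]] := H u Fu.
Qed.

Lemma partialD k u w : smooth u -> smooth w ->
  partial k (u \+ w) = partial k u \+ partial k w.
Proof. by move=> su sw; apply/funext => x; apply: deriveD; exact: smooth_derivable. Qed.

Lemma partialM k u w : smooth u -> smooth w ->
  partial k (u \* w) = (u \* partial k w) \+ (partial k u \* w).
Proof.
move=> su sw; apply/funext => x; rewrite /partial.
by rewrite deriveM /=; [rewrite [partial k u x * _]mulrC|exact: smooth_derivable..].
Qed.

Lemma partial_cst k (c : R) : partial k (cst c) = cst 0.
Proof. by apply/funext => x; rewrite /partial derive_cst. Qed.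

Lemma smooth_cst (c : R) : smooth (cst c : plane R -> R).
Proof.
apply: (@smooth_class (range cst)); last by exists c.
move=> _ [{}c _ <-]; split; first exact: cst_continuous.
by move=> k; split; [move=> x; exact: derivable_cst|rewrite partial_cst; exists 0].
Qed.

(** The Leibniz rule turns a product into a sum of products of smooth functions; this is the
    smallest class that it does not leave. *)
Inductive product_algebra : set (plane R -> R) :=
| product_algebra_mul u w : smooth u -> smooth w -> product_algebra (u \* w)
| product_algebra_add u w : product_algebra u -> product_algebra w ->
    product_algebra (u \+ w).

Lemma smooth_product_algebra : product_algebra `<=` smooth.
Proof.
apply: smooth_class => u; elim => [{}u w su sw|{}u w Fu [cu du] Fw [cw dw]].
  split; first by move=> x; apply: cvgM; exact: smooth_continuous.
  move=> k; split; first by move=> x; apply: derivableM; exact: smooth_derivable.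
  rewrite partialM; [|exact: su|exact: sw].
  exact: product_algebra_add (product_algebra_mul su (smooth_partial k sw))
    (product_algebra_mul (smooth_partial k su) sw).
split; first by move=> x; apply: cvgD; [exact: cu|exact: cw].
move=> k; have [du1 du2] := du k; have [dw1 dw2] := dw k; split.
  by move=> x; apply: derivableD.
rewrite (_ : partial k _ = partial k u \+ partial k w); first exact: product_algebra_add.
by apply/funext => x; exact: deriveD.
Qed.

Lemma smoothM u w : smooth u -> smooth w -> smooth (u \* w).
Proof. by move=> su sw; apply: smooth_product_algebra; exact: product_algebra_mul. Qed.

Lemma smoothD u w : smooth u -> smooth w -> smooth (u \+ w).
Proof.
move=> su sw; apply: smooth_product_algebra.
(* The generators of the class are products, hence the factors [1]. *)
rewrite (_ : u \+ w = (u \* cst 1) \+ (w \* cst 1)); last first.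
  by apply/funext => x /=; rewrite !mulr1.
exact: product_algebra_add (product_algebra_mul su (smooth_cst 1))
  (product_algebra_mul sw (smooth_cst 1)).
Qed.

Definition coord k x : R := if k then x.2 else x.1.

Lemma continuous_inner x : continuous (inner x).
Proof.
move=> y; rewrite /inner; apply: cvgD; apply: cvgMr.
  exact: cvg_fst.
exact: cvg_snd.
Qed.

Lemma is_derive_inner x y k : is_derive y (coord_dir k) (inner x) (coord k x).
Proof.
apply: is_derive_line.
rewrite (_ : (fun _ => _) = (fun h : R => inner x y + coord k x * h)); last first.
  by apply/funext => h; rewrite /inner /coord; case: k => /=; rewrite ?pairD /= ?scaler0; rewrite /GRing.scale/=; ring.
by apply: is_derive_eq; rewrite ?add0r ?scaler1 ?mulr1 // /GRing.scale /=; ring.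
Qed.

(** The real span of the real and imaginary parts of [wave x]. It is stable under differentiation,
    which makes waves smooth. *)
Definition trig (x : plane R) (a b : R) : plane R -> R :=
  fun y => a * cos (2 * pi * inner x y) + b * sin (2 * pi * inner x y).

Lemma is_derive_trig x y a b k :
  is_derive y (coord_dir k) (trig x a b)
    (trig x (2 * pi * coord k x * b) (- (2 * pi * coord k x * a)) y).
Proof.
apply: is_derive_line.
have := is_derive_lineP (is_derive_inner x y k).
set g := (fun h : R => inner _ _) => dg.
have g0 : g 0 = inner x y by rewrite /g scale0r add0r.
rewrite /trig -g0.
rewrite (_ : (fun _ => _) = (fun h : R => a * cos (2 * pi * g h) + b * sin (2 * pi * g h))) //.
have dh : is_derive (0:R) (1:R) (fun h => 2 * pi * g h) (2 * pi * coord k x).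
  exact: is_deriveZ.
have d1 := @is_derive1_comp _ cos _ 0 _ _ (is_derive_cos _) dh.
have d2 := @is_derive1_comp _ sin _ 0 _ _ (is_derive_sin _) dh.
have d3 := is_deriveZ a d1.
have d4 := is_deriveZ b d2.
have d5 := is_deriveD d3 d4.
rewrite (_ : (fun _ => _) = a \*: (cos \o (fun h => 2 * pi * g h)) + b \*: (sin \o (fun h => 2 * pi * g h))) //.
apply: (is_derive_eq d5).
by rewrite /GRing.scale /=; ring.
Qed.

Lemma continuous_trig x a b : continuous (trig x a b).
Proof.
have c : continuous (fun y => 2 * pi * inner x y).
  by move=> y; apply: cvgMr; exact: continuous_inner.
move=> y; apply: cvgD; apply: cvgMr.
  by apply: (continuous_comp (c y)); exact: continuous_cos.
by apply: (continuous_comp (c y)); exact: continuous_sin.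
Qed.

Lemma partial_trig x a b k :
  partial k (trig x a b) = trig x (2 * pi * coord k x * b) (- (2 * pi * coord k x * a)).
Proof. by apply/funext => y; exact: (@derive_val _ _ _ _ _ _ _ (is_derive_trig x y a b k)). Qed.

Lemma smooth_trig x a b : smooth (trig x a b).
Proof.
apply: (@smooth_class [set u | exists a b, u = trig x a b]); last by exists a, b.
move=> _ [{}a [{}b ->]]; split; first exact: continuous_trig.
move=> k; split; first by move=> y; have [] := is_derive_trig x y a b k.
by rewrite partial_trig; do 2 eexists.
Qed.

Lemma partial_eq0 k u (A : set (plane R)) : closed A ->
  (forall x, ~ A x -> u x = 0) -> forall x, ~ A x -> partial k u x = 0.
Proof.
move=> cA uA x Ax; rewrite /partial.
rewrite -(derive_cst (0 : R) x (coord_dir k)).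
apply: near_eq_derive.
have := closed_openC cA => /(_ x Ax); apply: filterS => y /= Ay.
by rewrite uA.
Qed.

End RealSmooth.

#[global] Opaque smooth.

(* Locked, because [done] would otherwise unfold it. *)
HB.lock Definition csmooth {R : realType} (f : plane R -> R[i]) : Prop :=
  smooth (Re \o f) /\ smooth (Im \o f).

Section ComplexSmooth.
Context {R : realType}.
Implicit Types (f g : plane R -> R[i]) (x y : plane R) (k : bool) (s : seq bool).

Lemma complex_eq (z w : R[i]) : Re z = Re w -> Im z = Im w -> z = w.
Proof. by case: z => a b; case: w => c d /= -> ->. Qed.

Lemma csmoothP f : csmooth f <-> smooth (Re \o f) /\ smooth (Im \o f).
Proof. by rewrite csmooth.unlock. Qed.

Definition cpart k f : plane R -> R[i] :=
  fun x => partial k (Re \o f) x +i* partial k (Im \o f) x.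

Lemma cpartial_rcons s k f : cpartial (rcons s k) f = cpartial s (cpart k f).
Proof. by apply/funext => x; rewrite /cpartial !iter_partial_rcons. Qed.

Lemma csmooth_cpart k f : csmooth f -> csmooth (cpart k f).
Proof.
move=> /csmoothP[h1 h2]; apply/csmoothP.
by split; [exact: smooth_partial h1|exact: smooth_partial h2].
Qed.

Lemma ReM_fun f g : Re \o (fun x => f x * g x) =
  ((Re \o f) \* (Re \o g)) \+
  (cst (-1) \* ((Im \o f) \* (Im \o g))).
Proof. by apply/funext => x /=; case: (f x) => a b; case: (g x) => c d /=; rewrite mulN1r. Qed.

Lemma ImM_fun f g : Im \o (fun x => f x * g x) =
  ((Re \o f) \* (Im \o g)) \+
  ((Im \o f) \* (Re \o g)).
Proof. by apply/funext => x /=; case: (f x) => a b; case: (g x) => c d /=. Qed.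

Lemma ReD_fun f g : Re \o (fun x => f x + g x) =
  (Re \o f) \+ (Re \o g).
Proof. by apply/funext => x /=; case: (f x) => a b; case: (g x) => c d /=. Qed.

Lemma ImD_fun f g : Im \o (fun x => f x + g x) =
  (Im \o f) \+ (Im \o g).
Proof. by apply/funext => x /=; case: (f x) => a b; case: (g x) => c d /=. Qed.

Lemma csmoothM f g : csmooth f -> csmooth g -> csmooth (fun x => f x * g x).
Proof.
move=> /csmoothP[f1 f2] /csmoothP[g1 g2]; apply/csmoothP; rewrite ReM_fun ImM_fun; split.
  apply: smoothD; first exact: smoothM.
  apply: smoothM; first exact: smooth_cst.
  exact: smoothM.
by apply: smoothD; exact: smoothM.
Qed.

Lemma csmoothD f g : csmooth f -> csmooth g -> csmooth (fun x => f x + g x).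
Proof.
move=> /csmoothP[f1 f2] /csmoothP[g1 g2]; apply/csmoothP.
by rewrite ReD_fun ImD_fun; split; exact: smoothD.
Qed.

Lemma csmooth_cst (c : R[i]) : csmooth (fun=> c).
Proof. by apply/csmoothP; split; exact: smooth_cst. Qed.

Lemma csmoothZ (c : R[i]) f : csmooth f -> csmooth (fun x => c * f x).
Proof. by move=> sf; exact: csmoothM (csmooth_cst c) sf. Qed.

Lemma csmoothB f g : csmooth f -> csmooth g -> csmooth (fun x => f x - g x).
Proof.
move=> sf sg; under eq_fun do rewrite -mulN1r.
by apply: csmoothD => //; exact: csmoothZ.
Qed.

Lemma csmooth_wave x : csmooth (wave x).
Proof.
apply/csmoothP; split.
  rewrite (_ : _ \o _ = trig x 1 0); first exact: smooth_trig.
  by apply/funext => y; rewrite /trig /= mul1r mul0r addr0.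
rewrite (_ : _ \o _ = trig x 0 1); first exact: smooth_trig.
by apply/funext => y; rewrite /trig /= mul1r mul0r add0r.
Qed.

Lemma csmooth_sum (I : Type) (r : seq I) (F : I -> plane R -> R[i]) :
  (forall i, csmooth (F i)) -> csmooth (fun x => \sum_(i <- r) F i x).
Proof.
move=> sF; elim: r => [|i r IH].
  by under eq_fun do rewrite big_nil; exact: csmooth_cst.
by under eq_fun do rewrite big_cons; exact: csmoothD.
Qed.

Lemma cpartD k f g : csmooth f -> csmooth g ->
  cpart k (fun x => f x + g x) = (fun x => cpart k f x + cpart k g x).
Proof.
by move=> /csmoothP[f1 f2] /csmoothP[g1 g2]; rewrite /cpart ReD_fun ImD_fun !partialD.
Qed.

Lemma cpart_cst k (c : R[i]) : cpart k (fun=> c) = (fun=> 0).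
Proof.
apply/funext => x; rewrite /cpart.
by rewrite (_ : _ \o _ = cst (Re c))// (_ : Im \o _ = cst (Im c))// !partial_cst.
Qed.

Lemma cpartM k f g : csmooth f -> csmooth g ->
  cpart k (fun x => f x * g x) = (fun x => cpart k f x * g x + f x * cpart k g x).
Proof.
move=> /csmoothP[f1 f2] /csmoothP[g1 g2]; rewrite /cpart ReM_fun ImM_fun.
have s1 := smoothM f1 g1; have s2 := smoothM f2 g2.
have s3 := smoothM f1 g2; have s4 := smoothM f2 g1.
have c := smooth_cst (-1 : R).
rewrite partialD; [|exact: s1|exact: smoothM].
rewrite partialD; [|exact: s3|exact: s4].
rewrite (partialM k c s2) !partialM //.
apply/funext => x /=; rewrite partial_cst /=.
case: (f x) => a b; case: (g x) => a' b' /=.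
by apply: complex_eq => /=; ring.
Qed.

Lemma cpartZ k (c : R[i]) f : csmooth f -> cpart k (fun x => c * f x) = (fun x => c * cpart k f x).
Proof.
move=> sf; rewrite (cpartM k (csmooth_cst c) sf); apply/funext => x.
by rewrite cpart_cst mul0r add0r.
Qed.

Lemma cpart_wave k x : cpart k (wave x) = (fun y => (0 +i* (2 * pi * coord k x)) * wave x y).
Proof.
apply/funext => y; rewrite /cpart.
rewrite (_ : Re \o _ = trig x 1 0); last first.
  by apply/funext => z; rewrite /trig /= mul1r mul0r addr0.
rewrite (_ : Im \o _ = trig x 0 1); last first.
  by apply/funext => z; rewrite /trig /= mul1r mul0r add0r.
rewrite !partial_trig /trig /wave /expi /=.
by apply: complex_eq => /=; ring.
Qed.

Lemma cpart_sum k (I : Type) (r : seq I) (F : I -> plane R -> R[i]) :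
  (forall i, csmooth (F i)) ->
  cpart k (fun x => \sum_(i <- r) F i x) = (fun x => \sum_(i <- r) cpart k (F i) x).
Proof.
move=> sF; elim: r => [|i r IH].
  under eq_fun do rewrite big_nil; rewrite cpart_cst.
  by apply/funext => x; rewrite big_nil.
under eq_fun do rewrite big_cons.
rewrite cpartD; [|exact: sF|exact: csmooth_sum].
by rewrite IH; apply/funext => x; rewrite big_cons.
Qed.

Lemma cpart_eq0 k f (A : set (plane R)) : closed A ->
  (forall x, ~ A x -> f x = 0) -> forall x, ~ A x -> cpart k f x = 0.
Proof.
move=> cA fA x Ax; apply: complex_eq => /=.
  by apply: (partial_eq0 k cA _ Ax) => y Ay /=; rewrite fA.
by apply: (partial_eq0 k cA _ Ax) => y Ay /=; rewrite fA.
Qed.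

Definition box (m : R) : set (plane R) := [set x | `|x.1| <= m /\ `|x.2| <= m].

Lemma box_compact m : compact (box m).
Proof.
rewrite (_ : box m = `[- m, m]%classic `*` `[- m, m]%classic).
  by apply: compact_setX; exact: segment_compact.
by apply/funext => x; rewrite /box /= !in_itv /= !ler_norml.
Qed.

Lemma box_closed m : closed (box m).
Proof. by apply: compact_closed; [exact: norm_hausdorff|exact: box_compact]. Qed.

(** From here on, compact supports are handled through squares off which the function vanishes; this
    form passes to sums, products and derivatives directly. *)
Lemma test_functionP f : test_function f <->
  csmooth f /\ exists m, forall x, ~ box m x -> f x = 0.
Proof.
split=> [[f1 f2 cf]|[/csmoothP[f1 f2] [m fm]]].
  split; first exact/csmoothP; have [M [_ HM]] := compact_bounded cf.
  exists (M + 1) => x; apply: contra_notP => fx.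
  have : supp f x by apply: subset_closure; apply/eqP.
  move=> /(HM (M + 1) (ltr_pwDr ltr01 (lexx _))).
  by rewrite /= prod_normE ge_max => /andP[].
split=> //; apply: (@subclosed_compact _ _ (box m)).
- exact: closed_closure.
- exact: box_compact.
rewrite (closure_id (box m)).1; last exact: box_closed.
by apply: closureS => x /= fx; apply: contrapT => /fm fx0; move: fx; rewrite fx0 eqxx.
Qed.

End ComplexSmooth.

(** * Continuous functions with compact support; integrals of derivatives *)

Section CompactSupport.
Context {R : realType}.
Implicit Types (u w : plane R -> R).

Definition cc u := continuous u /\ exists m, forall x, ~ box m x -> u x = 0.

Lemma cc_continuous u : cc u -> continuous u. Proof. by case. Qed.

Lemma boxS (m n : R) : m <= n -> box m `<=` box n.
Proof. by move=> mn x [h1 h2]; split; apply: le_trans mn. Qed.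

Lemma box_max (m n : R) x : ~ box (Num.max m n) x -> ~ box m x /\ ~ box n x.
Proof. by move=> nb; split=> b; apply: nb; apply: boxS b; rewrite le_max lexx ?orbT. Qed.

Lemma ccD u w : cc u -> cc w -> cc (u \+ w).
Proof.
move=> [cu [m hm]] [cw [n hn]]; split; first by move=> x; apply: cvgD; [exact: cu|exact: cw].
by exists (Num.max m n) => x /box_max[bm bn] /=; rewrite hm ?hn ?addr0.
Qed.

Lemma ccM u w : cc u -> continuous w -> cc (u \* w).
Proof.
move=> [cu [m hm]] cw; split; first by move=> x; apply: cvgM; [exact: cu|exact: cw].
by exists m => x bx /=; rewrite hm ?mul0r.
Qed.

Lemma cc_bounded u : cc u -> exists2 B, 0 < B & forall x, `|u x| <= B.
Proof.
move=> [cu [m hm]].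
have : compact (u @` box m).
  by apply: continuous_compact; [exact: continuous_subspaceT|exact: box_compact].
move=> /compact_bounded[M [_ HM]]; exists (`|M| + 1); first by rewrite ltr_wpDl.
move=> x; have [bx|/hm ->] := pselect (box m x); last by rewrite normr0 addr_ge0.
apply: HM; last by exists x.
by rewrite (le_lt_trans (ler_norm _))// ltrDl.
Qed.

Lemma box_measurable (m : R) : measurable (box m : set (mplane R)).
Proof. by apply: closed_plane_measurable; exact: box_closed. Qed.

Lemma box_measure (m : R) : 0 <= m -> pleb (box m) = ((2 * m) ^+ 2)%:E.
Proof.
move=> m0; rewrite (_ : box m = `[- m, m]%classic `*` `[- m, m]%classic); last first.
  by apply/funext => x; rewrite /box /= !in_itv /= !ler_norml.
have mi : measurable (`[- m, m]%classic : set (measurableTypeR R)) by exact: measurable_itv.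
rewrite /plane_measure [LHS](product_measure1E _ _ mi mi) /= !lebesgue_measure_itv /= lte_fin.
have [|] := ltP (- m) m => h; first by rewrite -EFinB -EFinM; congr (_%:E); ring.
by rewrite mule0 (_ : m = 0) ?mulr0 ?expr0n//; apply/eqP; rewrite eq_le m0 andbT; lra.
Qed.

Lemma cc_integrable u : cc u -> pleb.-integrable setT (EFin \o u).
Proof.
move=> cu; have [B B0 uB] := cc_bounded cu; case: cu => cu [m hm].
have mu : measurable_fun [set: mplane R] (EFin \o u) by exact: continuous_plane_emeasurable.
apply/integrableP; split => //.
have -> : (\int[pleb]_x `|(EFin \o u) x| = \int[pleb]_(x in box `|m|) `|(EFin \o u) x|)%E.
  rewrite [RHS]integral_mkcond; apply: eq_integral => x _.
  rewrite patchE; case: ifPn => // /negP; rewrite inE => nb /=.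
  by rewrite hm ?normr0 // => b; apply: nb; apply: boxS b; exact: ler_norm.
apply: (@le_lt_trans _ _ (\int[pleb]_(x in box `|m|) B%:E)%E).
  apply: ge0_le_integral => //; first exact: box_measurable.
    by apply: measurable_funTS; exact: measurableT_comp.
  by move=> x _ /=; rewrite lee_fin.
rewrite integral_cst; last exact: box_measurable.
by rewrite box_measure// -EFinM ltry.
Qed.

Lemma cc_RintegralD u w : cc u -> cc w ->
  \int[pleb]_x (u x + w x) = \int[pleb]_x u x + \int[pleb]_x w x.
Proof. by move=> cu cw; apply: RintegralD => //; exact: cc_integrable. Qed.

Lemma cc_RintegralZ (c : R) u : cc u -> \int[pleb]_x (c * u x) = c * \int[pleb]_x u x.
Proof. by move=> cu; apply: RintegralZl => //; exact: cc_integrable. Qed.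

Lemma smooth_cc_partial u k : smooth u -> cc u -> cc (partial k u).
Proof.
move=> su [_ [m hm]]; split; first by apply: smooth_continuous; exact: smooth_partial.
by exists m; exact: partial_eq0 (@box_closed _ m) hm.
Qed.

Lemma integral_derive_cc (v : R -> R) (m : R) :
  (forall t, derivable v t 1) -> continuous (derive1 v) -> (forall t, m < `|t| -> v t = 0) ->
  (\int[leb]_t (derive1 v t)%:E = 0)%E.
Proof.
move=> dv cv hv.
(* [m] may be negative; since [n > m] and [n > 0], [v] vanishes at both ends of [[-n, n]]. *)
pose n : R := `|m| + 1.
have n0 : 0 < n by rewrite ltr_wpDl.
have mn : m < n by rewrite (le_lt_trans (ler_norm _))// ltrDl.
have v'0 t : n < `|t| -> derive1 v t = 0.
  move=> nt; rewrite derive1E -(derive_cst (0 : R) t 1); apply: near_eq_derive.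
  have : \forall s \near t, m < `|s|.
    exact: (@cvgr_norm_gt _ _ _ (nbhs t) _ id t cvg_id m (lt_trans mn nt)).
  by apply: filterS => s; exact: hv.
transitivity (\int[leb]_(t in `[(- n)%R, n]) (derive1 v t)%:E)%E.
  rewrite [RHS]integral_mkcond; apply: eq_integral => t _.
  rewrite patchE; case: ifPn => // /negP; rewrite inE /= in_itv /= => nt.
  by rewrite v'0// ltNge ler_norml; exact/negP.
have vcts t : {for t, continuous v} by apply/differentiable_continuous/derivable1_diffP.
rewrite (@continuous_FTC2 _ (derive1 v) v)//.
- by rewrite !hv ?subee// ?normrN gtr0_norm.
- lra.
- exact: continuous_subspaceT.
- split => //.
  + by apply: cvg_at_right_filter; exact: vcts.
  + by apply: cvg_at_left_filter; exact: vcts.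
Qed.

Definition slice k (x t : R) : plane R := if k then (x, t) else (t, x).

Lemma is_derive_slice u k (x t : R) : smooth u ->
  is_derive t (1 : R) (fun t => u (slice k x t)) (partial k u (slice k x t)).
Proof.
move=> su; have [h1 h2] : is_derive (slice k x t) (coord_dir k) u (partial k u (slice k x t)).
  by apply: derivableP; exact: smooth_derivable.
have E : (fun h : R => h^-1 *: (((fun t => u (slice k x t)) \o shift t) (h *: (1 : R)) - u (slice k x t))) =
  (fun h => h^-1 *: ((u \o shift (slice k x t)) (h *: coord_dir k) - u (slice k x t))).
  apply/funext => h; rewrite /= pairD /slice; case: (k); congr (_ *: (u (_, _) - _));
    by rewrite /= scaler0 add0r.
by apply: DeriveDef; rewrite /derivable /derive E.
Qed.

Lemma integral_slice u k x : smooth u -> cc u ->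
  (\int[leb]_t (partial k u (slice k x t))%:E = 0)%E.
Proof.
move=> su cu; have ci := smooth_cc_partial k su cu; case: cu => _ [m hm].
have vE (t : R) := is_derive_slice k x t su.
have v'E : derive1 (fun t => u (slice k x t)) = partial k u \o slice k x.
  by apply/funext => t; rewrite derive1E; have [_ ->] := vE t.
have := @integral_derive_cc (fun t => u (slice k x t)) m; rewrite v'E; apply.
- by move=> t; have [] := vE t.
- move=> t; apply: (@continuous_comp _ _ _ (slice k x) (partial k u)); last exact: cc_continuous.
  rewrite /slice; case: (k); first exact: (cvg_pair (cvg_cst (x : R)) cvg_id).
  exact: (cvg_pair cvg_id (cvg_cst (x : R))).
- move=> t mt; apply: hm => -[]; rewrite /slice.
  by case: (k) => /= h1 h2; move: mt; rewrite ltNge ?h1 ?h2.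
Qed.

(** Fubini, the coordinate [k] being integrated first: on each line the integral of the derivative
    vanishes. *)
Lemma Rintegral_partial u k : smooth u -> cc u -> \int[pleb]_x partial k u x = 0.
Proof.
move=> su cu; have := cc_integrable (smooth_cc_partial k su cu).
rewrite /Rintegral /plane_measure => intu; case: k intu => intu.
  rewrite -(integral12_prod_meas1 intu) (_ : (\int[_]_x _)%E = 0%E)//.
  by apply: integral0_eq => x _; exact: (integral_slice true).
rewrite -(integral21_prod_meas1 intu) (_ : (\int[_]_x _)%E = 0%E)//.
by apply: integral0_eq => x _; exact: (integral_slice false).
Qed.

End CompactSupport.

(** * Complex-valued integrals, waves and the inverse Fourier transform *)

Section ComplexIntegral.
Context {R : realType}.
Implicit Types (f g : plane R -> R[i]) (z w : R[i]) (x y : plane R).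

Lemma cmod_ge0 z : 0 <= cmod z.
Proof. by case: z => a b; exact: sqrtr_ge0. Qed.

Lemma cmod0 : cmod (0 : R[i]) = 0. Proof. exact: ComplexField.Normc.normc0. Qed.
Lemma cmodM z w : cmod (z * w) = cmod z * cmod w.
Proof. exact: ComplexField.Normc.normcM. Qed.
Lemma cmodD z w : cmod (z + w) <= cmod z + cmod w.
Proof. exact: le_normcD. Qed.
Lemma cmodN z : cmod (- z) = cmod z.
Proof. exact: normcN. Qed.
Lemma cmodBC z w : cmod (z - w) = cmod (w - z).
Proof. by rewrite -cmodN opprB. Qed.
Lemma cmodR (a : R) : cmod (a%:C) = `|a|.
Proof. by rewrite /cmod /= expr0n addr0 sqrtr_sqr. Qed.

Lemma cmod_sum (I : Type) (r : seq I) (P : pred I) (F : I -> R[i]) :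
  cmod (\sum_(i <- r | P i) F i) <= \sum_(i <- r | P i) cmod (F i).
Proof.
elim/big_ind2 : _ => [|a b c d h1 h2|//]; first by rewrite cmod0.
by apply: le_trans (cmodD _ _) _; exact: lerD.
Qed.

Lemma Re_le_cmod z : `|Re z| <= cmod z.
Proof.
by case: z => a b; rewrite /cmod /= -sqrtr_sqr ler_sqrt ?lerDl ?sqr_ge0// addr_ge0 ?sqr_ge0.
Qed.

Lemma Im_le_cmod z : `|Im z| <= cmod z.
Proof.
by case: z => a b; rewrite /cmod /= -sqrtr_sqr ler_sqrt ?lerDr ?sqr_ge0// addr_ge0 ?sqr_ge0.
Qed.

Lemma cmod_le z : cmod z <= `|Re z| + `|Im z|.
Proof.
rewrite {1}[z]complexE; apply: le_trans (cmodD _ _) _; rewrite cmodM !cmodR.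
by rewrite (_ : cmod 'i = 1) ?mul1r// /cmod /= expr0n expr1n add0r sqrtr1.
Qed.

Lemma expiD (a b : R) : expi (a + b) = expi a * expi b.
Proof. by rewrite /expi cosD sinD; apply/eqP; rewrite eq_complex /= eqxx addrC /= (mulrC (sin a)) eqxx. Qed.

Lemma expi0 : expi (0 : R) = 1.
Proof. by rewrite /expi cos0 sin0. Qed.

Lemma wave_add x y xi : wave (x + y) xi = wave x xi * wave y xi.
Proof. by rewrite /wave -expiD; congr expi; rewrite /inner pairD /=; ring. Qed.

Lemma derive_lipschitz (B : R) (v v' : R -> R) : (forall t, is_derive t (1 : R) v (v' t)) ->
  (forall t, `|v' t| <= B) -> forall a b, `|v a - v b| <= B * `|a - b|.
Proof.
move=> dv vB a b; wlog ab : a b / a <= b.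
  by move=> H; case/orP : (le_total a b) => h; [exact: H|rewrite distrC (distrC a); exact: H].
have cv : {within `[a, b], continuous v}.
  apply: continuous_subspaceT => t; apply/differentiable_continuous/derivable1_diffP.
  by have [] := dv t.
have [c _ E] := MVT_segment ab (fun t _ => dv t) cv.
by rewrite distrC E normrM (distrC a); exact: ler_wpM2r.
Qed.

Lemma expi_lip (a b : R) : cmod (expi a - expi b) <= 2 * `|a - b|.
Proof.
apply: le_trans (cmod_le _) _; rewrite mulr_natl mulr2n; apply: lerD => /=.
  rewrite -[leRHS]mul1r; apply: (derive_lipschitz (fun t => is_derive_cos t)) => t.
  by rewrite normrN ler_norml sin_geN1 sin_le1.
rewrite -[leRHS]mul1r; apply: (derive_lipschitz (fun t => is_derive_sin t)) => t.
by rewrite ler_norml cos_geN1 cos_le1.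
Qed.

Definition ccc f := cc (Re \o f) /\ cc (Im \o f).

Lemma test_ccc f : test_function f -> ccc f.
Proof.
move=> /test_functionP[/csmoothP[f1 f2] [m hm]]; split; split.
- exact: smooth_continuous.
- by exists m => x /hm /= ->.
- exact: smooth_continuous.
- by exists m => x /hm /= ->.
Qed.

Lemma test_box f : test_function f -> exists2 m, 0 <= m & forall x, ~ box m x -> f x = 0.
Proof.
move=> /test_functionP[_ [m hm]]; exists `|m| => // x nb; apply: hm => b; apply: nb.
by apply: boxS b; exact: ler_norm.
Qed.

Lemma csmooth_continuous f : csmooth f ->
  continuous (Re \o f) /\ continuous (Im \o f).
Proof. by move=> /csmoothP[f1 f2]; split; exact: smooth_continuous. Qed.

Lemma ccZ (c : R) (u : plane R -> R) : cc u -> cc (cst c \* u).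
Proof.
move=> [cu [m hm]]; split; last by exists m => x /hm /= ->; rewrite mulr0.
by move=> x; apply: cvgMr; exact: cu.
Qed.

Lemma cccM f g : ccc f -> csmooth g -> ccc (fun x => f x * g x).
Proof.
move=> [f1 f2] /csmooth_continuous[g1 g2]; rewrite /ccc ReM_fun ImM_fun.
split; last by apply: ccD; exact: ccM.
apply: ccD; first exact: ccM.
by apply: ccZ; exact: ccM.
Qed.

Lemma cccD f g : ccc f -> ccc g -> ccc (fun x => f x + g x).
Proof. by move=> [f1 f2] [g1 g2]; rewrite /ccc ReD_fun ImD_fun; split; exact: ccD. Qed.

Lemma cccZ z f : ccc f -> ccc (fun x => z * f x).
Proof.
move=> cf; rewrite (_ : (fun _ => _) = (fun x => f x * z)); last by apply/funext => x; rewrite mulrC.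
by apply: cccM => //; exact: csmooth_cst.
Qed.

Lemma cintegralD f g : ccc f -> ccc g ->
  cintegral (fun x => f x + g x) = cintegral f + cintegral g.
Proof.
move=> [f1 f2] [g1 g2]; rewrite /cintegral.
rewrite -[X in (\int[_]_x X x) +i* _]/(Re \o (fun x => f x + g x)).
rewrite -[X in _ +i* (\int[_]_x X x)]/(Im \o (fun x => f x + g x)).
by rewrite ReD_fun ImD_fun /= !cc_RintegralD.
Qed.

Lemma cintegralZ z f : ccc f -> cintegral (fun x => z * f x) = z * cintegral f.
Proof.
case: z => a b [f1 f2]; rewrite /cintegral.
have E1 : (fun x => Re ((a +i* b) * f x)) =
    (fun x => (a * Re (f x)) + ((- b) * Im (f x))).
  by apply/funext => x; case: (f x) => c d /=; rewrite mulNr.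
have E2 : (fun x => Im ((a +i* b) * f x)) =
    (fun x => (a * Im (f x)) + (b * Re (f x))).
  by apply/funext => x; case: (f x) => c d /=; ring.
have cz (c : R) (u : plane R -> R) : cc u -> cc (fun x => c * u x) by exact: ccZ.
rewrite E1 E2 (cc_RintegralD (cz a _ f1) (cz (- b) _ f2)) (cc_RintegralD (cz a _ f2) (cz b _ f1)).
rewrite !cc_RintegralZ//.
by apply: complex_eq => /=; ring.
Qed.

Lemma cintegral0 : cintegral (fun=> 0 : R[i]) = 0.
Proof. by rewrite /cintegral /Rintegral !integral0. Qed.

Lemma ccc0 : ccc (fun=> 0).
Proof. by split; (split; [exact: cst_continuous|exists 0]). Qed.

Lemma cintegral_sum (I : Type) (r : seq I) (F : I -> plane R -> R[i]) :
  (forall i, ccc (F i)) ->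
  cintegral (fun x => \sum_(i <- r) F i x) = \sum_(i <- r) cintegral (F i).
Proof.
move=> cF; elim: r => [|i r IH].
  by under eq_fun do rewrite big_nil; rewrite cintegral0 big_nil.
under eq_fun do rewrite big_cons.
rewrite cintegralD ?IH ?big_cons//.
elim: r {IH} => [|j r IH]; first by under eq_fun do rewrite big_nil; exact: ccc0.
by under eq_fun do rewrite big_cons; exact: cccD.
Qed.

Lemma cmod_continuous f : continuous (Re \o f) -> continuous (Im \o f) ->
  continuous (fun x => cmod (f x)).
Proof.
move=> c1 c2; rewrite (_ : (fun _ => _) =
  (fun x => Num.sqrt ((Re (f x)) ^+ 2 + (Im (f x)) ^+ 2))); last first.
  by apply/funext => x; rewrite /cmod; case: (f x).
move=> x; apply: (@continuous_comp _ _ _ (fun x => (Re (f x)) ^+ 2 + (Im (f x)) ^+ 2)).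
  by apply: cvgD; rewrite /= expr2; under eq_cvg do rewrite expr2; apply: cvgM; [exact: c1|exact: c1|exact: c2|exact: c2].
exact: sqrt_continuous.
Qed.

Lemma ccc_cmod f : ccc f -> cc (fun x => cmod (f x)).
Proof.
move=> [[c1 [m h1]] [c2 [n h2]]]; split; first exact: cmod_continuous.
exists (Num.max m n) => x /box_max[bm bn].
have := cmod_le (f x); rewrite [Re (f x)](h1 _ bm) [Im (f x)](h2 _ bn).
by rewrite normr0 addr0 => h; apply/eqP; rewrite eq_le h cmod_ge0.
Qed.

Lemma cc_Rintegral_norm (u : plane R -> R) (v : plane R -> R) : cc u -> cc v ->
  (forall x, `|u x| <= v x) -> `|\int[pleb]_x u x| <= \int[pleb]_x v x.
Proof.
move=> cu cv uv; apply: le_trans (le_normr_Rintegral _ (cc_integrable cu)) _ => //.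
apply: le_Rintegral => //; [|exact: cc_integrable].
exact: (integrable_norm (cc_integrable cu)).
Qed.

Lemma fourierD (a : R[i]) f g : test_function f -> test_function g ->
  fourier (fun x => a * f x + g x) = (fun xi => a * fourier f xi + fourier g xi).
Proof.
move=> tf tg; apply/funext => xi; rewrite /fourier.
have e y : expi (- (2 * pi * inner y xi)) = wave (- xi) y.
  by congr expi; rewrite /inner /=; ring.
have c1 := test_ccc tf; have c2 := test_ccc tg.
rewrite -cintegralZ; last first.
  under eq_fun do rewrite e; apply: cccM => //; exact: csmooth_wave.
rewrite -cintegralD; last 2 first.
- apply: cccZ; under eq_fun do rewrite e; apply: cccM => //; exact: csmooth_wave.
- under eq_fun do rewrite e; apply: cccM => //; exact: csmooth_wave.
by congr cintegral; apply/funext => x; rewrite mulrDl mulrA.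
Qed.

(** The constant is [2] from [expi_lip], [2 * pi] from the phase and [2] for the two coordinates, as
    [|x - x'|] is the maximum norm. *)
Lemma wave_lip m x x' y : box m y -> cmod (wave x y - wave x' y) <= 8 * pi * m * `|x - x'|.
Proof.
move=> [b1 b2]; apply: le_trans (expi_lip _ _) _.
rewrite (_ : 2 * pi * inner x y - 2 * pi * inner x' y = 2 * pi * inner (x - x') y); last first.
  by rewrite /inner /=; ring.
rewrite !normrM (ger0_norm (pi_ge0 R)) ger0_norm// /inner.
have h : `|(x - x').1 * y.1 + (x - x').2 * y.2| <= 2 * (`|x - x'| * m).
  apply: le_trans (ler_normD _ _) _; rewrite mulr_natl mulr2n !normrM.
  by apply: lerD; apply: ler_pM => //; rewrite prod_normE le_max lexx ?orbT.
have p0 : 0 <= 2 * 2 * pi :> R by rewrite mulr_ge0 ?pi_ge0.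
have := ler_wpM2l p0 h; lra.
Qed.

Lemma fourier_inv_continuous f : test_function f ->
  continuous (Re \o fourier_inv f) /\ continuous (Im \o fourier_inv f).
Proof.
move=> tf; have cf := test_ccc tf.
have [m m0 hm] := test_box tf.
have cw x : ccc (fun y => f y * wave x y) by apply: cccM => //; exact: csmooth_wave.
have cm := ccc_cmod cf.
set B := \int[pleb]_y cmod (f y).
have B0 : 0 <= B by apply: Rintegral_ge0 => y _; exact: cmod_ge0.
have key x x' y : cmod (f y * wave x y - f y * wave x' y) <= 8 * pi * m * `|x - x'| * cmod (f y).
  rewrite -mulrBr cmodM mulrC.
  have [/hm ->|by_] := pselect (~ box m y); first by rewrite cmod0 !mulr0.
  apply: ler_wpM2r; first exact: cmod_ge0.
  by apply: wave_lip; exact: contrapT.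
(* [F] stands for [Re] and [Im], which are treated at once. *)
have lip (F : R[i] -> R) : (forall z w, F z - F w = F (z - w)) -> (forall z, `|F z| <= cmod z) ->
    (forall g, ccc g -> cc (F \o g)) ->
    continuous (fun x => \int[pleb]_y F (f y * wave x y)).
  move=> FB Fc Fcc x; apply/cvgrPdist_lt => e e0.
  have K0 : 0 < 8 * pi * m * B + 1 by rewrite ltr_wpDl// !mulr_ge0// pi_ge0.
  near=> x'.
  have c1 := cc_integrable (Fcc _ (cw x)); have c2 := cc_integrable (Fcc _ (cw x')).
  rewrite -RintegralB//.
  apply: (@le_lt_trans _ _ (8 * pi * m * `|x - x'| * B)).
    rewrite -cc_RintegralZ//; apply: cc_Rintegral_norm.
    - under eq_fun do rewrite FB; apply: Fcc.
      under eq_fun do rewrite -mulN1r; apply: cccD => //; exact: cccZ.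
    - exact: (ccZ _ cm).
    - by move=> y; rewrite FB; apply: le_trans (Fc _) _; exact: key.
  have : `|x - x'| < e / (8 * pi * m * B + 1).
    by near: x'; apply: cvgr_dist_lt; [exact: cvg_id|rewrite divr_gt0].
  rewrite ltr_pdivlMr// => h; apply: le_lt_trans h.
  by rewrite -subr_ge0 (_ : _ - _ = `|x - x'|)//; ring.
split.
  apply: (lip Re) => [[? ?] [? ?]//|z|g []//]; exact: Re_le_cmod.
apply: (lip Im) => [[? ?] [? ?]//|z|g []//]; exact: Im_le_cmod.
Unshelve. all: by end_near. Qed.

Lemma test_cpart k f : test_function f -> test_function (cpart k f).
Proof.
move=> /test_functionP[sf [m hm]]; apply/test_functionP; split; first exact: csmooth_cpart.
by exists m; exact: cpart_eq0 (@box_closed _ m) hm.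
Qed.

Lemma testM f g : test_function f -> csmooth g -> test_function (fun x => f x * g x).
Proof.
move=> /test_functionP[sf [m hm]] sg; apply/test_functionP; split; first exact: csmoothM.
by exists m => x /hm ->; rewrite mul0r.
Qed.

Lemma test_wave f x : test_function f -> test_function (fun y => f y * wave x y).
Proof. by move=> tf; apply: testM => //; exact: csmooth_wave. Qed.

Lemma testD f g : test_function f -> test_function g -> test_function (fun x => f x + g x).
Proof.
move=> /test_functionP[sf [m hm]] /test_functionP[sg [n hn]].
apply/test_functionP; split; first exact: csmoothD.
by exists (Num.max m n) => x /box_max[bm bn]; rewrite hm ?hn ?addr0.
Qed.

Lemma testZ z f : test_function f -> test_function (fun x => z * f x).
Proof.
move=> /test_functionP[sf [m hm]]; apply/test_functionP; split; first exact: csmoothZ.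
by exists m => x /hm ->; rewrite mulr0.
Qed.

Lemma test0 : test_function (fun=> 0 : R[i]).
Proof. by apply/test_functionP; split; [exact: csmooth_cst|exists 0]. Qed.

Lemma test_sum (I : Type) (r : seq I) (F : I -> plane R -> R[i]) :
  (forall i, test_function (F i)) -> test_function (fun x => \sum_(i <- r) F i x).
Proof.
move=> tF; elim: r => [|i r IH]; first by under eq_fun do rewrite big_nil; exact: test0.
by under eq_fun do rewrite big_cons; exact: testD.
Qed.

Lemma cintegral_cpart k f : test_function f -> cintegral (cpart k f) = 0.
Proof.
move=> tf; have [/csmoothP[f1 f2] _] := (test_functionP f).1 tf; have [c1 c2] := test_ccc tf.
by rewrite /cintegral /= !Rintegral_partial.
Qed.

(** Integration by parts: the derivative of [f y * wave x y] has integral zero. This makes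
    [lattice_sum] commute with partial derivatives. *)
Lemma fourier_inv_cpart k f x : test_function f ->
  fourier_inv (cpart k f) x = (0 -i* (2 * pi * coord k x)) * fourier_inv f x.
Proof.
move=> tf; have [sf _] := (test_functionP f).1 tf.
have tw := test_wave x tf.
have sw := @csmooth_wave R x.
have := cintegral_cpart k tw; rewrite (cpartM k sf sw) cpart_wave.
rewrite cintegralD; last 2 first.
- by apply: cccM => //; apply: test_ccc; exact: test_cpart.
- apply: test_ccc; apply: testM => //; exact: csmoothZ.
rewrite -/(fourier_inv (cpart k f) x) => /eqP; rewrite addr_eq0 => /eqP ->.
under eq_fun do rewrite mulrCA.
rewrite cintegralZ; last exact: test_ccc.
rewrite -mulNr; congr (_ * _).
by apply/eqP; rewrite eq_complex /= oppr0 !eqxx.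
Qed.

End ComplexIntegral.

(** * Periodization along a lattice *)

Section Kernel.
Context {R : realType}.
Implicit Types (n m : nat) (x t : R).

Lemma bin_le_central n j : ('C(2 * n, j) <= 'C(2 * n, n))%N.
Proof.
have step k : (k < n)%N -> ('C(2 * n, k) <= 'C(2 * n, k.+1))%N.
  move=> kn; have := mul_bin_left (2 * n) k => E.
  rewrite -(leq_pmul2l (ltn0Sn k)) E leq_mul2r; apply/orP; right.
  by lia.
have low k : (k <= n)%N -> ('C(2 * n, k) <= 'C(2 * n, n))%N.
  move=> kn; rewrite -(subKn kn); elim: (n - k)%N => [|d IH]; first by rewrite subn0.
  have [dn|dn] := ltnP d n; last first.
    by rewrite (_ : n - d.+1 = n - d)%N//; lia.
  apply: leq_trans IH; rewrite (_ : n - d = (n - d.+1).+1)%N; last by lia.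
  by apply: step; lia.
have [/low//|nj] := leqP j n.
have [jn|jn] := leqP j (2 * n); last by rewrite bin_small.
by rewrite -bin_sub//; apply: low; lia.
Qed.

(* The coefficients, shifted by [n], of the de la Vallee-Poussin kernel: they
   lie in [[0, 1]], and the central one is [1]. *)
Definition kernel_weight n (j : nat) : R := 'C(2 * n, j)%:R / 'C(2 * n, n)%:R.

Definition kernel n x : R := (4 * cos (pi * x) ^+ 2) ^+ n / 'C(2 * n, n)%:R.

Lemma central_gt0 n : 0 < 'C(2 * n, n)%:R :> R.
Proof. by rewrite ltr0n bin_gt0 leq_pmull. Qed.

Lemma kernel_weight_itv n j : 0 <= kernel_weight n j <= 1.
Proof.
rewrite /kernel_weight divr_ge0 ?ler0n//= ler_pdivrMr ?central_gt0// mul1r ler_nat.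
exact: bin_le_central.
Qed.

Lemma kernel_weight_center n : kernel_weight n n = 1.
Proof. by rewrite /kernel_weight divff// gt_eqF// central_gt0. Qed.

(** With [e = expi (2 * pi * x)] one has [4 cos^2 (pi x) = e^-1 (1 + e)^2], so the binomial theorem
    gives the Fourier coefficients of the [n]-th power. *)
Lemma kernel_expi n x : (kernel n x)%:C =
  \sum_(j < (2 * n).+1) (kernel_weight n j)%:C * expi (2 * pi * (x * (j%:R - n%:R))).
Proof.
have E1 : (4 * cos (pi * x) ^+ 2)%:C = expi (- (2 * pi * x)) * (1 + expi (2 * pi * x)) ^+ 2.
  have -> : 2 * pi * x = pi * x + pi * x by ring.
  have E0 : expi (- (pi * x)) * (1 + expi (pi * x + pi * x)) = (2 * cos (pi * x))%:C.
    rewrite mulrDr mulr1 -expiD addrA addNr add0r /expi cosN sinN.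
    by apply: complex_eq => /=; ring.
  rewrite opprD expiD -expr2 -exprMn E0 -rmorphXn /= exprMn.
  by congr (_%:C); ring.
have expiX (a : R) k : expi a ^+ k = expi (k%:R * a).
  elim: k => [|k IH]; first by rewrite expr0 mul0r expi0.
  by rewrite exprS IH -expiD; congr expi; rewrite -[in RHS]addn1 natrD; ring.
rewrite /kernel mulrC rmorphM rmorphXn /= E1 exprMn -exprM expiX exprDn mulr_sumr mulr_sumr.
apply: eq_bigr => j _; rewrite expr1n mul1r expiX mulrnAr -expiD.
rewrite (_ : n%:R * - (2 * pi * x) + j%:R * (2 * pi * x) = 2 * pi * (x * (j%:R - n%:R))); last by ring.
rewrite /kernel_weight rmorphM rmorph_nat /=; set e := expi _.
by rewrite -[X in _ * X = _]mulr_natl mulrA [X in X * e = _]mulrC.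
Qed.

Lemma kernel_cos n x : kernel n x =
  \sum_(j < (2 * n).+1) kernel_weight n j * cos (2 * pi * (j%:R - n%:R) * x).
Proof.
have := congr1 Re (kernel_expi n x) => /= ->.
have ReS (r : seq 'I_(2 * n).+1) (F : 'I_(2 * n).+1 -> R[i]) :
    Re (\sum_(i <- r) F i) = \sum_(i <- r) Re (F i).
  by elim: r => [|i r IH]; rewrite ?big_nil// !big_cons -IH; case: (F i) (\sum_(_ <- _) _) => ? ? [].
rewrite ReS; apply: eq_bigr => j _ /=; rewrite mul0r subr0; congr (_ * cos _); ring.
Qed.

Lemma kernel_ge0 n x : 0 <= kernel n x.
Proof. by rewrite /kernel divr_ge0// exprn_ge0// mulr_ge0// sqr_ge0. Qed.

Lemma cos2_le1 x : cos x ^+ 2 <= 1.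
Proof. by rewrite -[leRHS](cos2Dsin2 x) lerDl sqr_ge0. Qed.

(** [4 ^ n = 2 ^ (2n)] is a sum of [2n + 1] binomial coefficients, none larger than the central one.
    The normalization thus costs a factor linear in [n] only, and the kernel decays geometrically
    away from the integers. *)
Lemma kernel_le n x : kernel n x <= (2 * n).+1%:R * (cos (pi * x) ^+ 2) ^+ n.
Proof.
rewrite /kernel exprMn ler_pdivrMr ?central_gt0// mulrAC; apply: ler_wpM2r.
  by rewrite exprn_ge0// sqr_ge0.
rewrite (_ : 4 = 2 ^+ 2); last by ring.
rewrite -exprM -[2]/(1 + 1) exprDn.
apply: (@le_trans _ _ (\sum_(j < (2 * n).+1) 'C(2 * n, n)%:R)).
  by apply: ler_sum => j _; rewrite !expr1n mulr1 ler_nat bin_le_central.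
by rewrite sumr_const card_ord mulr_natl.
Qed.

Lemma continuous_kernel n : continuous (kernel n).
Proof.
move=> x; rewrite /kernel; apply: cvgMl.
apply: (@continuous_comp _ _ _ (fun x => 4 * cos (pi * x) ^+ 2) (fun y => y ^+ n)); last exact: exprn_continuous.
apply: cvgMr.
apply: (@continuous_comp _ _ _ (fun x => cos (pi * x)) (fun y => y ^+ 2)); last exact: exprn_continuous.
apply: (@continuous_comp _ _ _ (fun x => pi * x) (@cos R)); last exact: continuous_cos.
by apply: cvgMr; exact: cvg_id.
Qed.

Lemma sin_natpi k : sin (pi * k%:R) = 0 :> R.
Proof.
elim: k => [|k IH]; first by rewrite mulr0 sin0.
by rewrite -addn1 natrD mulrDr mulr1 sinDpi IH oppr0.
Qed.

Lemma cos2_addintpi x (k : int) : cos (pi * (x + k%:~R)) ^+ 2 = cos (pi * x) ^+ 2.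
Proof.
have nat_case (y : R) (i : nat) : cos (pi * (y + i%:R)) ^+ 2 = cos (pi * y) ^+ 2.
  elim: i => [|i IH]; first by rewrite addr0.
  by rewrite -addn1 natrD addrA mulrDr mulr1 cosDpi sqrrN IH.
case: k => i; first exact: nat_case.
rewrite NegzE mulrNz -[LHS](nat_case _ i.+1); congr (cos (pi * _) ^+ 2).
by rewrite -pmulrn subrK.
Qed.

(** By periodicity only the distance to the nearest integer matters. It is at most [1/2], and [cos]
    is nonnegative and decreasing on [[0, pi/2]]. *)
Lemma near_int_of_cos2 (d x : R) : 0 < d -> d <= 2^-1 ->
  cos (pi * d) ^+ 2 < cos (pi * x) ^+ 2 -> exists k : int, `|x - k%:~R| < d.
Proof.
move=> d0 d12 h; exists (Num.floor (x + 2^-1)).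
set k := Num.floor _.
have /andP[k1 k2] := floor_itv (x + 2^-1).
rewrite -/k in k1 k2; rewrite intrD in k2.
have E : cos (pi * x) ^+ 2 = cos (pi * `|x - k%:~R|) ^+ 2.
  rewrite -[in LHS](subrK k%:~R x) cos2_addintpi -[in RHS](ger0_norm (pi_ge0 R)).
  by rewrite -normrM cos_norm.
rewrite ltNge; apply/negP => dx.
have x12 : `|x - k%:~R| <= 2^-1 by rewrite ler_norml; apply/andP; split; lra.
have pi2 : pi * 2^-1 <= pi :> R by have := pi_gt0 R; lra.
have le_pih y : y <= 2^-1 -> pi * y <= pi * 2^-1 :> R by move=> ?; rewrite ler_wpM2l// pi_ge0.
have pos y : 0 <= y -> 0 <= pi * y :> R by move=> ?; rewrite mulr_ge0// pi_ge0.
have : cos (pi * `|x - k%:~R|) <= cos (pi * d).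
  move: dx; rewrite le_eqVlt => /orP[/eqP->//|dx].
  have in1 : pi * `|x - k%:~R| \in `[0, pi].
    by rewrite in_itv /= pos//= (le_trans (le_pih _ x12) pi2).
  have in2 : pi * d \in `[0, pi].
    by rewrite in_itv /= (pos _ (ltW d0)) (le_trans (le_pih _ d12) pi2).
  by apply: ltW; rewrite ltr_cos// ltr_pM2l ?pi_gt0.
have c0 : 0 <= cos (pi * `|x - k%:~R|).
  apply: cos_ge0_pihalf; apply/andP; split; last exact: le_pih.
  by apply: (@le_trans _ _ 0); [rewrite oppr_le0 divr_ge0// pi_ge0|exact: pos].
move=> le; move: h; rewrite E ltNge => /negP; apply.
by rewrite ler_pXn2r// nnegrE// (le_trans c0 le).
Qed.

(** An antiderivative of the [j]-th cosine of the kernel. The frequency is zero for [j = n], where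
    the cosine is the constant [1]. *)
Definition kernel_primitive_term n (j : 'I_(2 * n).+1) : R -> R :=
  if nat_of_ord j == n then id
  else fun t => (2 * pi * (j%:R - n%:R))^-1 * sin (2 * pi * (j%:R - n%:R) * t).

Lemma is_derive_kernel_primitive_term n j x :
  is_derive x (1 : R) (@kernel_primitive_term n j) (cos (2 * pi * (j%:R - n%:R) * x)).
Proof.
rewrite /kernel_primitive_term; case: ifPn => [/eqP ->|jn].
  by rewrite subrr mulr0 mul0r cos0; exact: is_derive_id.
set c := 2 * pi * _.
have c0 : c != 0.
  apply: mulf_neq0; last by rewrite subr_eq0 eqr_nat.
  by rewrite gt_eqF// mulr_gt0// pi_gt0.
have dl : is_derive x (1 : R) (fun t => c * t) c.
  by have := is_deriveZ c (is_derive_id x (1 : R)); rewrite /GRing.scale /= mulr1.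
have d1 := @is_derive1_comp _ sin _ x _ _ (is_derive_sin _) dl.
have d2 := is_deriveZ c^-1 d1.
apply: (is_derive_eq d2); rewrite /GRing.scale /=.
by field.
Qed.

Definition kernel_primitive n : R -> R :=
  \sum_(j < (2 * n).+1) kernel_weight n j \*: kernel_primitive_term j.

Lemma is_derive_kernel_primitive n x :
  is_derive x (1 : R) (kernel_primitive n) (kernel n x).
Proof.
rewrite kernel_cos; apply: is_derive_sum => j.
exact: is_deriveZ (is_derive_kernel_primitive_term j x).
Qed.

Lemma kernel_primitiveE n x : kernel_primitive n x =
  \sum_(j < (2 * n).+1) kernel_weight n j * kernel_primitive_term j x.
Proof. by rewrite /kernel_primitive fct_sumE. Qed.

(** At half-integers every sine is taken at a multiple of [pi], so only the term of frequency zero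
    survives. The sign [s] covers both ends of the interval of integration. *)
Lemma kernel_primitive_half n m (s : R) : s = 1 \/ s = -1 ->
  kernel_primitive n (s * (m%:R + 2^-1)) = s * (m%:R + 2^-1).
Proof.
move=> hs; rewrite kernel_primitiveE.
have nn : (n < (2 * n).+1)%N by rewrite ltnS leq_pmull.
rewrite (bigD1 (Ordinal nn))//= big1 ?addr0.
  by rewrite kernel_weight_center mul1r /kernel_primitive_term /= eqxx.
move=> j jn; rewrite /kernel_primitive_term ifN; last first.
  by apply: contra jn => /eqP e; apply/eqP/val_inj.
have sinz (a b : nat) : sin (pi * ((a%:R - b%:R) * (2 * m + 1)%:R)) = 0 :> R.
  rewrite mulrBl mulrBr sinB -!natrM !sin_natpi; ring.
rewrite (_ : sin _ = 0) ?mulr0//.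
have E : 2 * pi * (j%:R - n%:R) * (m%:R + 2^-1) = pi * ((j%:R - n%:R) * (2 * m + 1)%:R) :> R.
  by rewrite natrD natrM; field.
by case: hs => ->; rewrite ?mul1r ?mulN1r ?mulrN ?sinN E sinz ?oppr0.
Qed.

Lemma integral_kernel n m :
  (\int[leb]_(x in `[(- (m%:R + 2^-1))%R, (m%:R + 2^-1)%R]) (kernel n x)%:E = (2 * m + 1)%:R%:E)%E.
Proof.
have m0 : 0 < m%:R + 2^-1 :> R by rewrite ltr_wpDl.
rewrite (@continuous_FTC2 _ (kernel n) (kernel_primitive n)).
- rewrite -EFinB; congr (_%:E).
  have := @kernel_primitive_half n m 1 (or_introl erefl); rewrite mul1r => ->.
  have := @kernel_primitive_half n m (-1) (or_intror erefl); rewrite mulN1r => ->.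
  by rewrite natrD natrM; field.
- lra.
- exact/continuous_subspaceT/continuous_kernel.
- have cp t : {for t, continuous (kernel_primitive n)}.
    apply/differentiable_continuous/derivable1_diffP.
    by have [] := is_derive_kernel_primitive n t.
  split.
  + by move=> t _; have [] := is_derive_kernel_primitive n t.
  + by apply: cvg_at_right_filter; exact: cp.
  + by apply: cvg_at_left_filter; exact: cp.
- by move=> t _; rewrite derive1E; have [_ ->] := is_derive_kernel_primitive n t.
Qed.

End Kernel.

(** * The product kernel as an approximate identity at the integer points *)

Section ApproximateIdentity.
Context {R : realType}.
Implicit Types (n m : nat) (x : plane R).

Definition kernel2 n x : R := kernel n x.1 * kernel n x.2.

Lemma kernel2_ge0 n x : 0 <= kernel2 n x.
Proof. by rewrite mulr_ge0// kernel_ge0. Qed.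

Lemma continuous_kernel2 n : continuous (kernel2 n).
Proof.
move=> x; apply: cvgM.
  by apply: (@continuous_comp _ _ _ fst (kernel n)); [exact: cvg_fst|exact: continuous_kernel].
by apply: (@continuous_comp _ _ _ snd (kernel n)); [exact: cvg_snd|exact: continuous_kernel].
Qed.

Lemma integral_kernel2 n m :
  (\int[pleb]_(x in box (m%:R + 2^-1)) (kernel2 n x)%:E = ((2 * m + 1)%:R ^+ 2)%:E)%E.
Proof.
pose I : set (measurableTypeR R) := `[(- (m%:R + 2^-1))%R, (m%:R + 2^-1)%R]%classic.
pose g : measurableTypeR R -> \bar R := (fun t => (kernel n t)%:E) \_ I.
have mI : measurable I by exact: measurable_itv.
have g0 t : (0 <= g t)%E by rewrite /g patchE; case: ifP => // _; rewrite lee_fin kernel_ge0.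
have mg : measurable_fun setT g.
  apply/(measurable_restrictT _ mI); apply: measurable_funTS; apply/measurable_EFinP.
  by apply: continuous_measurable_fun; exact: continuous_kernel.
have ig : (\int[leb]_t g t = (2 * m + 1)%:R%:E)%E.
  by rewrite -integral_mkcond integral_kernel.
rewrite integral_mkcond.
have -> : ((fun x => (kernel2 n x)%:E) \_ (box (m%:R + 2^-1)) = (fun x => g x.1 * g x.2)%E).
  apply/funext => x; rewrite /g !patchE.
  have bE : (x \in box (m%:R + 2^-1)) = (x.1 \in I) && (x.2 \in I).
    have inI (t : R) : (t \in I) = (`|t| <= m%:R + 2^-1).
      by apply/idP/idP => [/set_mem|h]; [|apply/mem_set; move: h]; rewrite /I /= in_itv /= ler_norml.
    by rewrite !inI; apply/idP/andP => [/set_mem[]//|[h1 h2]]; exact/mem_set.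
  by rewrite bE; do 2 case: (_ \in I); rewrite ?mul0e ?mule0//= -EFinM.
have mgg : measurable_fun [set: mplane R] (fun x => g x.1 * g x.2)%E.
  by apply: emeasurable_funM; exact: measurableT_comp.
have gg0 (x : mplane R) : (0 <= g x.1 * g x.2)%E by rewrite mule_ge0.
rewrite /plane_measure (fubini_tonelli1 _ mgg gg0).
under eq_integral => t _.
  rewrite /fubini_F /= ge0_integralZl//; over.
by rewrite /= ig ge0_integralZr// ?ig -?EFinM ?expr2.
Qed.

Lemma bounded_box_integrable (r B : R) (u : plane R -> R) : 0 <= r ->
  measurable_fun [set: mplane R] (u : mplane R -> measurableTypeR R) ->
  (forall x, box r x -> `|u x| <= B) -> pleb.-integrable (box r) (EFin \o u).
Proof.
move=> r0 mu uB; have mb := box_measurable r.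
have me : measurable_fun (box r : set (mplane R)) (EFin \o u).
  by apply: measurable_funTS; exact/measurable_EFinP.
apply/integrableP; split; first exact: me.
apply: (@le_lt_trans _ _ (\int[pleb]_(x in box r) `|B|%:E)%E).
  apply: ge0_le_integral => //; first exact: measurableT_comp.
  by move=> x bx; rewrite lee_fin; apply: le_trans (uB x bx) (ler_norm _).
by rewrite integral_cst// box_measure// -EFinM ltry.
Qed.

Lemma kernel2_le n (q : R) x : 0 <= q ->
  ~ (q < cos (pi * x.1) ^+ 2 /\ q < cos (pi * x.2) ^+ 2) ->
  kernel2 n x <= (2 * n).+1%:R ^+ 2 * q ^+ n.
Proof.
move=> q0 H.
have c1 t : 0 <= cos t ^+ 2 :> R by rewrite sqr_ge0.
have kle t : kernel n t <= (2 * n).+1%:R :> R.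
  apply: le_trans (kernel_le _ _) _; rewrite ler_piMr ?ler0n// exprn_ile1// cos2_le1.
have kq t : cos (pi * t) ^+ 2 <= q -> kernel n t <= (2 * n).+1%:R * q ^+ n :> R.
  move=> tq; apply: le_trans (kernel_le _ _) _; apply: ler_wpM2l; first exact: ler0n.
  by rewrite lerXn2r ?nnegrE.
rewrite /kernel2 expr2.
have [h1|h1] := ltP q (cos (pi * x.1) ^+ 2); last first.
by rewrite [leRHS]mulrAC; apply: ler_pM => //; [exact: kernel_ge0|exact: kernel_ge0|exact: kq].
have [h2|h2] := ltP q (cos (pi * x.2) ^+ 2); first by exfalso; apply: H.
by rewrite -[leRHS]mulrA; apply: ler_pM => //; [exact: kernel_ge0|exact: kernel_ge0|exact: kq].
Qed.

Lemma kernel2_integrable n (r B : R) (f : plane R -> R) : 0 <= r ->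
  measurable_fun [set: mplane R] (f : mplane R -> measurableTypeR R) ->
  (forall x, `|f x| <= B) -> pleb.-integrable (box r) (EFin \o (fun x => f x * kernel2 n x)).
Proof.
move=> r0 mf fB; apply: (@bounded_box_integrable r (B * ((2 * n).+1%:R ^+ 2 * 1 ^+ n))) => //.
  by apply: measurable_funM => //; apply: continuous_plane_measurable; exact: continuous_kernel2.
move=> x _; rewrite normrM; apply: ler_pM => //; rewrite ger0_norm ?kernel2_ge0//.
by apply: kernel2_le => // -[]; rewrite ltNge cos2_le1.
Qed.

(** [h0] is the integral of [h0 * kernel2 n] over the unit square [box 2^-1]. The integrands differ
    by at most [e] times the kernel near the integer points, and elsewhere by at most [2 * B] times
    the small bound of [kernel2_le]. The factor [(2m + 1)^2] is both the area of the large square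
    and the integral of the kernel over it. *)
Lemma kernel2_approx (h : plane R -> R) (h0 B e q : R) m n :
  cc h -> (forall x, `|h x| <= B) -> `|h0| <= B -> 0 <= q -> 0 <= e ->
  (forall x, ~ box (m%:R + 2^-1) x -> h x = 0) ->
  (forall x, box (m%:R + 2^-1) x -> q < cos (pi * x.1) ^+ 2 -> q < cos (pi * x.2) ^+ 2 ->
     `|h x - h0 * \1_(box (2^-1 : R)) x| <= e) ->
  `|\int[pleb]_x (h x * kernel2 n x) - h0| <=
    (e + 2 * B * ((2 * n).+1%:R ^+ 2 * q ^+ n)) * (2 * m + 1)%:R ^+ 2.
Proof.
move=> ch hB h0B q0 e0 hsupp hnear.
set r : R := m%:R + 2^-1; have r0 : 0 <= r by rewrite addr_ge0.
have r2 : 2^-1 <= r by rewrite /r lerDr.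
pose D : set (mplane R) := box r.
have mD : measurable D by exact: box_measurable.
pose u1 := fun x => h x * kernel2 n x.
pose u2 := fun x => h0 * \1_(box (2^-1 : R)) x * kernel2 n x.
set Q := (2 * n).+1%:R ^+ 2 * q ^+ n.
have Q0 : 0 <= Q by rewrite mulr_ge0// exprn_ge0.
have B0 : 0 <= B by apply: le_trans h0B.
have mh : measurable_fun [set: mplane R] (h : mplane R -> measurableTypeR R).
  by apply: continuous_plane_measurable; exact: cc_continuous.
have i1 : pleb.-integrable D (EFin \o u1) := kernel2_integrable n r0 mh hB.
have i2 : pleb.-integrable D (EFin \o u2).
  apply: (@kernel2_integrable n _ B) => // [|x].
    by apply: measurable_funM => //; apply: measurable_indic; exact: box_measurable.
  rewrite normrM -[leRHS]mulr1; apply: ler_pM => //.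
  by rewrite indicE; case: (_ \in _); rewrite ?normr1 ?normr0.
have ik s : 0 <= s -> pleb.-integrable (box s) (EFin \o kernel2 n).
  move=> s0; rewrite (_ : kernel2 n = fun x => 1 * kernel2 n x).
    by apply: (@kernel2_integrable n _ 1) => // x; rewrite normr1.
  by apply/funext => x; rewrite mul1r.
have E1 : \int[pleb]_x (h x * kernel2 n x) = \int[pleb]_(x in D) u1 x.
  rewrite [RHS]Rintegral_mkcond; apply: eq_Rintegral => x _; rewrite patchE.
  by case: ifPn => // /negP; rewrite inE => /hsupp ->; rewrite mul0r.
have E2 : h0 = \int[pleb]_(x in D) u2 x.
  transitivity (\int[pleb]_(x in box (2^-1 : R)) (h0 * kernel2 n x)).
    rewrite RintegralZl //; last first.
    - exact: ik.
    - exact: box_measurable.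
    rewrite /Rintegral; have := integral_kernel2 n 0; rewrite add0r => ->.
    by rewrite muln0 add0n /= expr1n mulr1.
  rewrite Rintegral_mkcond [RHS]Rintegral_mkcond; apply: eq_Rintegral => x _.
  rewrite !patchE /u2 indicE; have [bx|bx] := boolP (x \in box _).
    rewrite mem_set ?mulr1//; move: bx; rewrite inE; exact: boxS.
  by rewrite mulr0 mul0r; case: ifP.
rewrite E1 {1}E2 -RintegralB//.
have ie : pleb.-integrable D (EFin \o (fun x => e * kernel2 n x)).
  by apply: (@kernel2_integrable n _ e) => // x; rewrite ger0_norm.
have iQ : pleb.-integrable D (EFin \o (fun=> 2 * B * Q)).
  by apply: (@bounded_box_integrable r `|2 * B * Q|).
have ib : pleb.-integrable D (EFin \o (fun x => e * kernel2 n x + 2 * B * Q)).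
  by have := integrableD mD ie iQ.
have i12 : pleb.-integrable D (EFin \o (fun x => u1 x - u2 x)).
  by have := integrableB mD i1 i2.
apply: le_trans (le_normr_Rintegral mD i12) _.
apply: (@le_trans _ _ (\int[pleb]_(x in D) (e * kernel2 n x + 2 * B * Q))).
  apply: le_Rintegral => //; first exact: (integrable_norm i12).
  move=> x Dx; rewrite /u1 /u2 -mulrBl normrM (ger0_norm (kernel2_ge0 n x)).
  have := pselect (q < cos (pi * x.1) ^+ 2 /\ q < cos (pi * x.2) ^+ 2) => -[[q1 q2]|nq].
    apply: ler_wpDr; first by rewrite (mulr_ge0 (mulr_ge0 _ B0) Q0).
    by apply: ler_wpM2r; [exact: kernel2_ge0|exact: hnear].
  apply: ler_wpDl; first exact: (mulr_ge0 e0 (kernel2_ge0 n x)).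
  apply: ler_pM; [by []|exact: kernel2_ge0| |exact: kernel2_le].
  apply: le_trans (ler_normB _ _) _; rewrite mulr_natl mulr2n; apply: lerD => //.
  rewrite normrM -[leRHS]mulr1; apply: ler_pM => //.
  by rewrite indicE; case: (_ \in _); rewrite ?normr1 ?normr0.
rewrite RintegralD//.
have fD : fine (pleb D) = (2 * m + 1)%:R ^+ 2.
  by rewrite box_measure//=; congr (_ ^+ 2); rewrite /r natrD natrM; field.
rewrite (RintegralZl _ mD (ik _ r0)) Rintegral_cst// fD (_ : \int[pleb]_(x in D) kernel2 n x = (2 * m + 1)%:R ^+ 2).
  by rewrite -mulrDl.
by rewrite /Rintegral integral_kernel2.
Qed.

End ApproximateIdentity.

(** * Lattices and weighted partial sums of periodizations *)

Section Lattice.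
Context {R : realType}.
Implicit Types (A M : 'M[R]_2) (x y xi : plane R) (n : nat).

Lemma mx_actD A x y : mx_act A (x + y) = mx_act A x + mx_act A y.
Proof. by rewrite [RHS]pairD /mx_act !pairD /=; congr pair; ring. Qed.

Lemma mx_actN A x : mx_act A (- x) = - mx_act A x.
Proof.
rewrite [RHS](_ : _ = (- (mx_act A x).1, - (mx_act A x).2))// /mx_act /=.
by congr pair; ring.
Qed.

Lemma mulmx2E A M i j : (A *m M) i j = A i 0 * M 0 j + A i 1 * M 1 j.
Proof.
rewrite !mxE !big_ord_recl big_ord0 addr0; congr (_ + A i _ * M _ j); exact: val_inj.
Qed.

Lemma mx_actM A M x : mx_act (A *m M) x = mx_act A (mx_act M x).
Proof. by rewrite /mx_act !mulmx2E /=; congr pair; ring. Qed.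

Lemma mx_act1 x : mx_act 1%:M x = x.
Proof. by case: x => a b; rewrite /mx_act !mxE /=; congr pair; ring. Qed.

Lemma mx_actK A x : A \in unitmx -> mx_act (invmx A) (mx_act A x) = x.
Proof. by move=> uA; rewrite -mx_actM mulVmx// mx_act1. Qed.

Lemma mx_actVK A x : A \in unitmx -> mx_act A (mx_act (invmx A) x) = x.
Proof. by move=> uA; rewrite -mx_actM mulmxV// mx_act1. Qed.

Lemma inner_mx A x y : inner (mx_act A x) y = inner x (mx_act A^T y).
Proof. by rewrite /inner /mx_act !mxE /=; ring. Qed.

Definition mx_size A : R := `|A 0 0| + `|A 0 1| + `|A 1 0| + `|A 1 1|.

Lemma mx_size_ge0 A : 0 <= mx_size A. Proof. by rewrite !addr_ge0. Qed.

Lemma mx_act_box A r x : box r x -> box (mx_size A * r) (mx_act A x).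
Proof.
move=> [h1 h2]; have r0 : 0 <= r by apply: le_trans h1.
have bnd (a b c d : R) : `|a * x.1 + b * x.2| <= (`|a| + `|b| + `|c| + `|d|) * r.
  apply: le_trans (ler_normD _ _) _; rewrite !normrM !mulrDl.
  have := ler_wpM2l (normr_ge0 a) h1; have := ler_wpM2l (normr_ge0 b) h2.
  have : 0 <= `|c| * r by rewrite mulr_ge0. have : 0 <= `|d| * r by rewrite mulr_ge0.
  lra.
split; first exact: bnd.
rewrite (_ : mx_size A = `|A 1 0| + `|A 1 1| + `|A 0 0| + `|A 0 1|); first exact: bnd.
by rewrite /mx_size; ring.
Qed.

Lemma boxN r x : box r x -> box r (- x).
Proof. by move=> [h1 h2]; split => /=; rewrite normrN. Qed.

Lemma boxD r s x y : box r x -> box s y -> box (r + s) (x + y).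
Proof.
move=> [h1 h2] [h3 h4]; split; rewrite pairD /=; apply: le_trans (ler_normD _ _) _; exact: lerD.
Qed.

Lemma change_of_variable_measure (g : mplane R -> mplane R) (d : R) (S : set (mplane R)) :
  change_of_variable g d -> measurable S -> (d%:E * pleb (g @^-1` S) = pleb S)%E.
Proof.
move=> [mg Hg] mS.
have mI : measurable_fun [set: mplane R] (EFin \o (\1_S : mplane R -> R)).
  by apply/measurable_EFinP; exact: measurable_indic.
have mgS : measurable (g @^-1` S) by rewrite -[X in measurable X]setTI; exact: mg.
have := Hg _ mI (fun x => ltac:(by rewrite lee_fin)).
rewrite [RHS](integral_indic _ measurableT mS) setIT => <-; congr (_ * _)%E.
by rewrite -[X in pleb X]setIT -(integral_indic _ measurableT mgS).
Qed.

(** Scaling by [d > 0] preserves infinite integrals of the positive and negative parts, and [fine]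
    then sends both sides to [0]. *)
Lemma Rintegral_cov (g : mplane R -> mplane R) (d : R) (f : plane R -> R) :
  0 < d -> change_of_variable g d ->
  measurable_fun [set: mplane R] (f : mplane R -> measurableTypeR R) ->
  d * \int[pleb]_x f (g x) = \int[pleb]_x f x.
Proof.
move=> d0 [mg Hg] mf.
have me : measurable_fun [set: mplane R] (EFin \o f) by exact/measurable_EFinP.
rewrite /Rintegral integralE [in RHS]integralE.
rewrite -(Hg ((EFin \o f)^\+)%E)//; last exact: measurable_funepos.
rewrite -(Hg ((EFin \o f)^\-)%E)//; last exact: measurable_funeneg.
set P := (\int[pleb]_x ((EFin \o f)^\+ (g x)))%E.
set N := (\int[pleb]_x ((EFin \o f)^\- (g x)))%E.
have P0 : (0 <= P)%E by apply: integral_ge0.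
have N0 : (0 <= N)%E by apply: integral_ge0.
rewrite -[(fun x => (f (g x))%:E)]/((EFin \o f) \o g) funepos_comp funeneg_comp.
transitivity (d * fine (P - N)%E); first by [].
case: P P0 => [r||]// _; case: N N0 => [s||]// _.
- by rewrite /= mulrBr.
- by rewrite gt0_muley ?lte_fin //= mulr0.
- by rewrite gt0_muley ?lte_fin //= mulr0.
- by rewrite gt0_muley ?lte_fin //= mulr0.
Qed.

(** The frequencies of [kernel2 n], that is, the integer points of [[-n, n]^2]; the shift by [n]
    comes from the indexing of the coefficients. *)
Definition kpt n (k : 'I_(2 * n).+1 * 'I_(2 * n).+1) : plane R :=
  (k.1%:R - n%:R, k.2%:R - n%:R).

Definition kweight n (k : 'I_(2 * n).+1 * 'I_(2 * n).+1) : R :=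
  kernel_weight n k.1 * kernel_weight n k.2.

Lemma kweight_itv n (k : 'I_(2 * n).+1 * 'I_(2 * n).+1) : 0 <= kweight k <= 1.
Proof.
have /andP[a0 a1] := @kernel_weight_itv R n k.1; have /andP[b0 b1] := @kernel_weight_itv R n k.2.
by rewrite /kweight mulr_ge0//= mulr_ile1.
Qed.

Lemma kernel2_expi n x : (kernel2 n x)%:C =
  \sum_k (kweight k)%:C * expi (2 * pi * inner (@kpt n k) x).
Proof.
rewrite /kernel2 rmorphM /= !kernel_expi big_distrlr /= pair_bigA /=.
apply: eq_bigr => k _; rewrite mulrACA -expiD /kweight [in RHS]rmorphM; congr (_ * expi _).
by rewrite /inner /kpt /=; ring.
Qed.

Definition dual_pt M (k : plane R) : plane R := mx_act (invmx M)^T k.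

Lemma inner_dual_pt M k x : M \in unitmx -> inner (dual_pt M k) (mx_act M x) = inner k x.
Proof. by move=> uM; rewrite /dual_pt inner_mx trmxK mx_actK. Qed.

(* The partial Fourier sums, weighted by the coefficients of the kernel, of the
   periodization of [chi] with respect to the lattice [M Z^2]. *)
Definition lattice_sum M n (chi : plane R -> R[i]) : plane R -> R[i] := fun xi =>
  \sum_k (@kweight n k * `|\det M|^-1)%:C *
    (fourier_inv chi (dual_pt M (kpt k)) * wave (- dual_pt M (kpt k)) xi).

Lemma ReZ (a : R) (z : R[i]) : Re (a%:C * z) = a * Re z.
Proof. by case: z => b c /=; rewrite mul0r subr0. Qed.

Lemma ImZ (a : R) (z : R[i]) : Im (a%:C * z) = a * Im z.
Proof. by case: z => b c /=; rewrite mul0r addr0. Qed.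

Lemma wave_opp x y xi : wave x y * wave (- x) xi = wave x (y - xi).
Proof. by rewrite /wave -expiD; congr expi; rewrite /inner /=; ring. Qed.

(** A Poisson summation formula with finitely many terms: expand the kernel into exponentials and
    substitute [y = M x + xi], whose inverse is [q]. *)
Lemma lattice_sum_integral M n chi xi : \det M != 0 -> test_function chi ->
  Re (lattice_sum M n chi xi) =
    \int[pleb]_x (Re (chi (mx_act M x + xi)) * kernel2 n x) /\
  Im (lattice_sum M n chi xi) =
    \int[pleb]_x (Im (chi (mx_act M x + xi)) * kernel2 n x).
Proof.
move=> dM tchi; have uM : M \in unitmx by rewrite unitmxE unitfE.
have d0 : 0 < `|\det M| by rewrite normr_gt0.
pose g (x : mplane R) : mplane R := mx_act M x + xi.
have cov : change_of_variable g `|\det M| by exact: change_of_variable_mx.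
pose q y := mx_act (invmx M) (y - xi).
have qg x : q (g x) = x by rewrite /q /g addrK mx_actK.
have cchi := test_ccc tchi.
have E : lattice_sum M n chi xi =
    (`|\det M|^-1)%:C * cintegral (fun y => (kernel2 n (q y))%:C * chi y).
  rewrite /lattice_sum.
  have -> : (fun y => (kernel2 n (q y))%:C * chi y) =
    (fun y => \sum_k (kweight k)%:C * (wave (- dual_pt M (@kpt n k)) xi *
        (chi y * wave (dual_pt M (kpt k)) y))).
    apply/funext => y; rewrite kernel2_expi mulr_suml; apply: eq_bigr => k _.
    rewrite -[LHS]mulrA; congr (_ * _).
    have -> : expi (2 * pi * inner (@kpt n k) (q y)) =
        wave (dual_pt M (kpt k)) y * wave (- dual_pt M (kpt k)) xi.
      by rewrite wave_opp /wave -(inner_dual_pt _ _ uM) /q mx_actVK.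
    by rewrite mulrC (mulrC (wave _ y)) mulrCA.
  have cw k : ccc (fun y => chi y * wave (dual_pt M (@kpt n k)) y).
    by apply: cccM => //; exact: csmooth_wave.
  rewrite cintegral_sum; last by move=> k; do 2 apply: cccZ.
  rewrite mulr_sumr; apply: eq_bigr => k _.
  rewrite cintegralZ; last exact: cccZ.
  rewrite cintegralZ// -/(fourier_inv chi _) rmorphM /=.
  by rewrite (mulrC (fourier_inv _ _)) [RHS]mulrCA mulrA.
have cont (F : R[i] -> R) : cc (F \o chi) ->
    measurable_fun [set: mplane R] ((fun y => kernel2 n (q y) * F (chi y)) : mplane R -> measurableTypeR R).
  move=> Fc; apply: measurable_funM; last first.
    by apply: continuous_plane_measurable; exact: (cc_continuous Fc).
  have mq : measurable_fun [set: mplane R] (q : mplane R -> mplane R).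
    have di : \det (invmx M) != 0 by rewrite det_inv invr_eq0.
    have [+ _] := change_of_variable_mx (mx_act (invmx M) (- xi)) di.
    by congr measurable_fun; apply/funext => y; rewrite /q mx_actD.
  apply: (measurableT_comp _ mq).
  by apply: continuous_plane_measurable; exact: continuous_kernel2.
rewrite E ReZ ImZ /cintegral /=.
have fin (F : R[i] -> R) : cc (F \o chi) ->
   `|\det M|^-1 * \int[pleb]_y (kernel2 n (q y) * F (chi y)) =
   \int[pleb]_x (F (chi (mx_act M x + xi)) * kernel2 n x).
  move=> Fc; rewrite -(Rintegral_cov d0 cov (cont _ Fc)) mulKf ?gt_eqF//.
  by apply: eq_Rintegral => x _; rewrite qg mulrC.
case: cchi => c1 c2; split; rewrite -fin//; congr (_ * _); apply: eq_Rintegral => y _.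
  by rewrite -ReZ.
by rewrite -ImZ.
Qed.

End Lattice.

(** * Uniform convergence of the weighted sums *)

Section LatticeConvergence.
Context {R : realType}.
Implicit Types (M : 'M[R]_2) (x y xi : plane R) (n : nat).

Lemma smooth_lipschitz (u : plane R -> R) : smooth u -> cc u ->
  exists2 L, 0 < L & forall x y, `|u x - u y| <= L * (`|x.1 - y.1| + `|x.2 - y.2|).
Proof.
move=> su cu.
have [B1 B10 H1] := cc_bounded (smooth_cc_partial false su cu).
have [B2 B20 H2] := cc_bounded (smooth_cc_partial true su cu).
exists (B1 + B2) => [|[x1 x2] [y1 y2] /=]; first exact: addr_gt0.
rewrite (_ : u (x1, x2) - u (y1, y2) =
  (u (x1, x2) - u (y1, x2)) + (u (y1, x2) - u (y1, y2))); last by ring.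
apply: le_trans (ler_normD _ _) _; rewrite mulrDr; apply: lerD.
  apply: le_trans (derive_lipschitz (fun t => is_derive_slice false x2 t su) (fun t => H1 _) x1 y1) _.
  by apply: ler_wpM2r => //; rewrite lerDl ltW.
apply: le_trans (derive_lipschitz (fun t => is_derive_slice true y1 t su) (fun t => H2 _) x2 y2) _.
by apply: ler_wpM2r => //; rewrite lerDr ltW.
Qed.

Lemma expr_bernoulli_le (r : R) n : 0 <= r <= 1 -> r ^+ n * (1 + n%:R * (1 - r)) <= 1.
Proof.
move=> /andP[r0 r1]; elim: n => [|n IH]; first by rewrite expr0 mul0r addr0 mulr1.
apply: le_trans IH; rewrite exprSr -mulrA; apply: ler_wpM2l; first exact: exprn_ge0.
rewrite -[n.+1]addn1 natrD; have n0 : 0 <= n%:R :> R by exact: ler0n.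
rewrite -subr_ge0 (_ : _ - _ = n%:R * (1 - r) ^+ 2 + (1 - r) ^+ 2); last by ring.
by rewrite addr_ge0 ?sqr_ge0// mulr_ge0 ?sqr_ge0.
Qed.

Lemma quadratic_geometric_small (q e : R) : 0 <= q < 1 -> 0 < e ->
  exists N, forall n, (N <= n)%N -> (2 * n).+1%:R ^+ 2 * q ^+ n <= e.
Proof.
(* The fourth root splits [q ^ n] into four factors [r ^ n]: two absorb the factors [2n + 1], one is
   bounded by [1] and one tends to [0]. *)
move=> /andP[q0 q1] e0; pose r := Num.sqrt (Num.sqrt q).
have r0 : 0 <= r by exact: sqrtr_ge0.
have rq : r ^+ 4 = q by rewrite (exprM r 2 2) !sqr_sqrtr// sqrtr_ge0.
have r1 : r < 1 by rewrite -(@ltr_pXn2r _ 4)// ?nnegrE// rq expr1n.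
(* Chosen so that [2n + 1 <= C * (1 + n (1 - r))]; Bernoulli's inequality then bounds
   [(2n + 1) * r ^ n] by [C]. *)
pose C := 2 / (1 - r) + 1.
have C0 : 0 < C by rewrite addr_gt0// divr_gt0// subr_gt0.
have : r ^+ n @[n --> \oo] --> (0 : R) by apply: cvg_expr; rewrite ger0_norm.
move=> /cvgrPdist_le /(_ (e / C ^+ 2)).
rewrite divr_gt0 ?exprn_gt0// => /(_ isT) [N _ HN].
exists N => n /HN /=; rewrite sub0r normrN ger0_norm ?exprn_ge0// ler_pdivlMr ?exprn_gt0// => h.
apply: le_trans h.
have b : (2 * n).+1%:R * r ^+ n <= C.
  have := expr_bernoulli_le n (_ : 0 <= r <= 1); rewrite r0 ltW// => /(_ isT) H.
  have n0 : 0 <= n%:R :> R by exact: ler0n.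
  have : (2 * n).+1%:R <= C * (1 + n%:R * (1 - r)).
    rewrite -[(2 * n).+1]addn1 natrD natrM /C [leRHS]mulrDl mul1r.
    rewrite (_ : 2 / (1 - r) * (1 + n%:R * (1 - r)) = 2 / (1 - r) + 2 * n%:R); last first.
      by field; rewrite subr_eq0 gt_eqF.
    have : 0 <= 2 / (1 - r) by rewrite divr_ge0// subr_ge0 ltW.
    have : 0 <= n%:R * (1 - r) by rewrite mulr_ge0// subr_ge0 ltW.
    lra.
  move=> /(ler_wpM2r (exprn_ge0 n r0)) h2; apply: le_trans h2 _.
  by rewrite -mulrA; apply: ler_piMr; [exact: ltW|rewrite mulrC].
rewrite -rq (_ : _ * _ = r ^+ n * (r ^+ n) * ((2 * n).+1%:R * r ^+ n) ^+ 2); last first.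
  by rewrite -exprM (mulnC 4%N) exprM -[4%N]/(2 + 2)%N exprD exprMn; ring.
have rn0 : 0 <= r ^+ n by exact: exprn_ge0.
have rn1 : r ^+ n <= 1 by rewrite exprn_ile1// ltW.
apply: ler_pM => //; [by rewrite mulr_ge0|by rewrite sqr_ge0|by rewrite ler_piMl|].
by rewrite lerXn2r// nnegrE ?(ltW C0)// mulr_ge0.
Qed.

Lemma continuous_mx_act M : continuous (mx_act M).
Proof.
move=> x.
have lin (a b : R) : (fun y : plane R => a * y.1 + b * y.2) @ x --> a * x.1 + b * x.2.
  by apply: cvgD; apply: cvgMr; [exact: cvg_fst|exact: cvg_snd].
exact: (cvg_pair (lin _ _) (lin _ _)).
Qed.

Lemma norm_intr_ge1 (k : int) : k != 0 -> 1 <= `|k%:~R : R|.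
Proof. by move=> k0; rewrite -intr_norm -[1]/(1%:~R) ler_int -gtz0_ge1 normr_gt0. Qed.

(* [u] need only vanish at the nonzero points of the lattice centred at [xi]:
   the sums converge to the periodization of [u]. *)
Lemma lattice_approx M (u : plane R -> R) (A : set (plane R)) (r : R) :
  \det M != 0 -> smooth u -> cc u -> A `<=` box r ->
  (forall xi (k l : int), A xi -> (k, l) != (0, 0) ->
     u (mx_act M (k%:~R, l%:~R) + xi) = 0) ->
  forall e, 0 < e -> exists N, forall n, (N <= n)%N -> forall xi, A xi ->
    `|\int[pleb]_x (u (mx_act M x + xi) * kernel2 n x) - u xi| <= e.
Proof.
move=> dM su cu Ar avoid e e0; have uM : M \in unitmx by rewrite unitmxE unitfE.
have [B B0 uB] := cc_bounded cu; have [L L0 uL] := smooth_lipschitz su cu.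
have [cont [mu hmu]] := cu.
(* If [xi] lies in [A] and [M x + xi] in the support square of [u], then [x] lies in [box a]. It is
   enlarged to a half-integer, as the kernel is integrated exactly over such squares. *)
pose a := mx_size (invmx M) * (mu + r).
pose m := (Num.truncn `|a|).+1.
have am : a <= m%:R + 2^-1.
  have h1 := truncnS_gt `|a|; have h2 := ler_norm a.
  by rewrite -/m in h1; lra.
have supp xi x : A xi -> ~ box (m%:R + 2^-1) x -> u (mx_act M x + xi) = 0.
  move=> /Ar bxi nbx; apply: hmu => b; apply: nbx; apply: boxS am _ _.
  have := mx_act_box (invmx M) (boxD b (boxN bxi)).
  by rewrite addrK mx_actK.
set W : R := (2 * m + 1)%:R ^+ 2.
have W0 : 0 < W by rewrite exprn_gt0// ltr0n addn1.
pose e' := e / (2 * W).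
have e'0 : 0 < e' by rewrite divr_gt0// mulr_gt0.
pose S := mx_size M; have S0 : 0 <= S := mx_size_ge0 M.
have LS : 0 < 2 * L * S + 1 by rewrite ltr_wpDl// !mulr_ge0// ltW.
(* The second bound keeps the variation of [u] under a displacement by [M] of [box d] below [e'];
   the bound [1/4] ensures that a point of [box 2^-1] is within [d] of no integer point but [0]. *)
pose d := Num.min (4^-1) (e' / (2 * L * S + 1)).
have d0 : 0 < d by rewrite lt_min invr_gt0 ltr0n divr_gt0.
have d4 : d <= 4^-1 by rewrite ge_min lexx.
have dL : L * (2 * (S * d)) <= e'.
  have : d <= e' / (2 * L * S + 1) by rewrite ge_min lexx orbT.
  rewrite ler_pdivlMr// => h; apply: le_trans h.
  by rewrite -subr_ge0 (_ : _ - _ = d) ?ltW//; ring.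
(* Where [cos^2] exceeds [q] in both coordinates, the point is within [d] of an integer point;
   elsewhere the kernel is small. *)
pose q := cos (pi * d) ^+ 2.
have q01 : 0 <= q < 1.
  rewrite sqr_ge0/= /q cos2sin2 ltrBlDl ltrDr exprn_gt0// sin_gt0_pi//.
  rewrite mulr_gt0 ?pi_gt0//= -[ltRHS]mulr1 ltr_pM2l ?pi_gt0//.
  by lra.
have [N HN] := quadratic_geometric_small q01 (divr_gt0 e'0 (mulr_gt0 (ltr0Sn _ 1) B0)).
exists N => n /HN Hn xi Axi.
have cch : cc (fun x => u (mx_act M x + xi)).
  split; last by exists (m%:R + 2^-1) => x; exact: supp.
  move=> x; apply: (@continuous_comp _ _ _ (fun x => mx_act M x + xi) u); last exact: cont.
  apply: cvgD; last exact: cvg_cst.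
  exact: continuous_mx_act.
have q0 : 0 <= q by have /andP[] := q01.
apply: le_trans (@kernel2_approx _ _ (u xi) B e' q m n cch _ _ q0 (ltW e'0) (supp xi ^~ Axi) _) _.
- by move=> x; exact: uB.
- exact: uB.
- move=> x bx q1 q2.
  have d2 : d <= 2^-1 by lra.
  have [k kx] := near_int_of_cos2 d0 d2 q1.
  have [l lx] := near_int_of_cos2 d0 d2 q2.
  have near : `|u (mx_act M x + xi) - u (mx_act M (k%:~R, l%:~R) + xi)| <= e'.
    have bd : box d (x - (k%:~R, l%:~R)) by split => /=; exact: ltW.
    have [b1 b2] := mx_act_box M bd.
    rewrite mx_actD mx_actN in b1 b2.
    apply: le_trans (uL _ _) _; apply: le_trans dL; apply: ler_wpM2l; first exact: ltW.
    rewrite mulr_natl mulr2n; apply: lerD.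
      by move: b1; congr (`|_| <= _); rewrite !pairD /=; ring.
    by move: b2; congr (`|_| <= _); rewrite !pairD /=; ring.
  (* Near the origin [u] is compared with [u xi]; near any other integer point it is compared with
     [0], its value there by hypothesis, and the indicator vanishes. *)
  rewrite indicE; have [kl|kl] := eqVneq (k, l) (0, 0).
    move: kl kx lx near => [-> ->]; rewrite !mulr0z !subr0 => kx lx.
    rewrite (_ : mx_act M (0, 0) = 0); last by rewrite /mx_act /= !mulr0 addr0.
    rewrite add0r mem_set ?mulr1//; split.
      by apply: ltW (lt_le_trans kx _); lra.
    by apply: ltW (lt_le_trans lx _); lra.
  rewrite (avoid xi k l Axi kl) subr0 in near.
  rewrite memNset ?mulr0 ?subr0// => -[b1 b2].
  have big (j : int) (t : R) : `|t| <= 2^-1 -> `|t - j%:~R| < d -> j = 0.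
    move=> t2 tj; apply/eqP; apply: contraT => /norm_intr_ge1 j1.
    have : `|j%:~R : R| <= `|t| + `|t - j%:~R|.
      by rewrite -{1}(subKr t j%:~R); exact: ler_normB.
    by lra.
  by move: kl; rewrite (big k x.1)// (big l x.2)// eqxx.
rewrite -/W -ler_pdivlMr// (_ : e / W = e' + e'); last by rewrite /e'; field; rewrite gt_eqF.
rewrite lerD2l; move: Hn; rewrite ler_pdivlMr ?mulr_gt0// => Hn.
by rewrite mulrC.
Qed.

Lemma lattice_sum_cvg M chi (A : set (plane R)) (r : R) :
  \det M != 0 -> test_function chi -> A `<=` box r ->
  (forall xi (k l : int), A xi -> (k, l) != (0, 0) ->
     chi (mx_act M (k%:~R, l%:~R) + xi) = 0) ->
  forall e, 0 < e -> exists N, forall n, (N <= n)%N -> forall xi, A xi ->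
    cmod (lattice_sum M n chi xi - chi xi) <= e.
Proof.
move=> dM tchi Ar avoid e e0.
have [/csmoothP[s1 s2] _] := (test_functionP chi).1 tchi; have [c1 c2] := test_ccc tchi.
have e2 : 0 < e / 2 by rewrite divr_gt0.
have av1 xi (k l : int) : A xi -> (k, l) != (0, 0) ->
    (Re \o chi) (mx_act M (k%:~R, l%:~R) + xi) = 0.
  by move=> Axi kl /=; rewrite avoid.
have av2 xi (k l : int) : A xi -> (k, l) != (0, 0) ->
    (Im \o chi) (mx_act M (k%:~R, l%:~R) + xi) = 0.
  by move=> Axi kl /=; rewrite avoid.
have [N1 H1] := lattice_approx dM s1 c1 Ar av1 e2.
have [N2 H2] := lattice_approx dM s2 c2 Ar av2 e2.
exists (maxn N1 N2) => n; rewrite geq_max => /andP[n1 n2] xi Axi.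
have [E1 E2] := lattice_sum_integral n xi dM tchi.
apply: le_trans (cmod_le _) _.
rewrite (_ : e = e / 2 + e / 2); last by field.
apply: lerD.
  rewrite (_ : Re _ = Re (lattice_sum M n chi xi) - Re (chi xi)); last first.
    by case: (lattice_sum _ _ _ _); case: (chi xi).
  by rewrite E1; exact: H1.
rewrite (_ : Im _ = Im (lattice_sum M n chi xi) - Im (chi xi)); last first.
  by case: (lattice_sum _ _ _ _); case: (chi xi).
by rewrite E2; exact: H2.
Qed.

End LatticeConvergence.

(** * Band pieces of a distribution *)

Section Distributions.
Context {R : realType}.
Implicit Types (f h phi chi : plane R -> R[i]) (x y xi : plane R) (k : bool) (s : seq bool).
Implicit Types (g : (plane R -> R[i]) -> R[i]) (M : 'M[R]_2) (n : nat).

Lemma cpartial_nil f : cpartial [::] f = f.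
Proof. by apply/funext => x; rewrite /cpartial /=; case: (f x). Qed.

Lemma cpartialD s f h : csmooth f -> csmooth h ->
  cpartial s (fun x => f x + h x) = (fun x => cpartial s f x + cpartial s h x).
Proof.
elim/last_ind: s f h => [|s k IH] f h sf sh; first by rewrite !cpartial_nil.
by rewrite !cpartial_rcons cpartD// IH//; exact: csmooth_cpart.
Qed.

Lemma cpartialZ s (c : R[i]) f : csmooth f ->
  cpartial s (fun x => c * f x) = (fun x => c * cpartial s f x).
Proof.
elim/last_ind: s f => [|s k IH] f sf; first by rewrite !cpartial_nil.
by rewrite !cpartial_rcons cpartZ// IH//; exact: csmooth_cpart.
Qed.

Lemma test_csmooth f : test_function f -> csmooth f.
Proof. by move=> /test_functionP[]. Qed.

Lemma test_cpartials s f : test_function f -> test_function (cpartial s f).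
Proof.
elim/last_ind: s f => [|s k IH] f tf; first by rewrite cpartial_nil.
by rewrite cpartial_rcons; exact/IH/test_cpart.
Qed.

Lemma test_bounded f : test_function f -> exists2 B, 0 < B & forall x, cmod (f x) <= B.
Proof.
move=> tf; have [B B0 HB] := cc_bounded (ccc_cmod (test_ccc tf)).
by exists B => // x; apply: le_trans (HB x); exact: ler_norm.
Qed.

Lemma Zspace_fourier f : test_function f -> Zspace (fourier f).
Proof. by move=> tf; exists f. Qed.

Section HatLinear.
Variables (g : (plane R -> R[i]) -> R[i]) (hg : Zdual g).

Lemma hat_lin (a : R[i]) f h : test_function f -> test_function h ->
  hat g (fun x => a * f x + h x) = a * hat g f + hat g h.
Proof.
move=> tf th; rewrite /hat fourierD//; case: hg => _ H _.
by apply: H; exact: Zspace_fourier.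
Qed.

Lemma hat0 : hat g (fun=> 0) = 0.
Proof.
have := @hat_lin (-1) _ _ test0 test0.
by under eq_fun do rewrite mulr0 addr0; rewrite mulN1r addNr.
Qed.

Lemma hatD f h : test_function f -> test_function h ->
  hat g (fun x => f x + h x) = hat g f + hat g h.
Proof.
move=> tf th; have := @hat_lin 1 _ _ tf th.
by under eq_fun do rewrite mul1r; rewrite mul1r.
Qed.

Lemma hatZ (a : R[i]) f : test_function f -> hat g (fun x => a * f x) = a * hat g f.
Proof.
move=> tf; have := @hat_lin a _ _ tf test0.
by under eq_fun do rewrite addr0; rewrite hat0 addr0.
Qed.

Lemma hatB f h : test_function f -> test_function h ->
  hat g (fun x => f x - h x) = hat g f - hat g h.
Proof.
move=> tf th; under eq_fun do rewrite -mulN1r.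
by rewrite hatD ?hatZ ?mulN1r//; exact: testZ.
Qed.

Lemma hat_sum (I : Type) (r : seq I) (F : I -> plane R -> R[i]) :
  (forall i, test_function (F i)) ->
  hat g (fun x => \sum_(i <- r) F i x) = \sum_(i <- r) hat g (F i).
Proof.
move=> tF; elim: r => [|i r IH].
  by under eq_fun do rewrite big_nil; rewrite hat0 big_nil.
under eq_fun do rewrite big_cons.
by rewrite hatD ?IH ?big_cons//; exact: test_sum.
Qed.

(** Continuity of [g] at [0] yields an absolutely convex set of test functions whose trace on each
    compact set contains a ball of some [C^N] norm. *)
Lemma hat_seminorm (m : R) (e : R) : 0 < e ->
  exists N d, 0 < d /\ forall f, test_function f -> (forall x, ~ box m x -> f x = 0) ->
    (forall s x, (size s <= N)%N -> cmod (cpartial s f x) <= d) -> cmod (hat g f) < e.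
Proof.
move=> e0; case: hg => _ lin cont.
(* [f0] is some test function with the same transform as [0]. As [hat g] depends on the transform
   alone, [hat g f0 = 0] and [f0] can be subtracted. *)
have [f0 [tf0 E0] [V [VU _ HV]]] := cont _ (Zspace_fourier test0) e e0.
have [N [d [d0 Hd]]] := HV _ (@box_compact R m).
exists N, d; split => // f tf fm fd.
have sf : supp f `<=` box m.
  rewrite (closure_id (box m)).1; last exact: box_closed.
  by apply: closureS => x /= fx; apply: contrapT => /fm fx0; move: fx; rewrite fx0 eqxx.
have [_ /=] := VU _ (Hd f tf sf fd).
have -> : g (fourier (fun x => f0 x + f x)) = hat g f0 + hat g f by rewrite -hatD.
have -> : hat g f0 = 0 by rewrite /hat E0 -/(hat g _) hat0.
by rewrite -/(hat g _) hat0 add0r subr0.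
Qed.

(** There are finitely many words of length at most [N], and a filter is closed under finite
    intersections. *)
Lemma near_words (T : Type) (F : set_system T) {FF : Filter F} (P : seq bool -> T -> Prop) :
  (forall s, \forall t \near F, P s t) ->
  forall N, \forall t \near F, forall s, (size s <= N)%N -> P s t.
Proof.
move=> HP N; elim: N P HP => [|N IH] P HP.
  by near=> t; case=> // _; near: t; exact: HP.
have h0 := IH (fun s => P (true :: s)) (fun s => HP (true :: s)).
have h1 := IH (fun s => P (false :: s)) (fun s => HP (false :: s)).
near=> t; case=> [_|[] s sN].
- by near: t; exact: HP.
- by move: s sN; near: t; exact: h0.
- by move: s sN; near: t; exact: h1.
Unshelve. all: by end_near. Qed.

Lemma hat_cvg (T : Type) (F : set_system T) {FF : Filter F} (m : R) (f : T -> plane R -> R[i]) :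
  (forall t, test_function (f t)) -> (forall t x, ~ box m x -> f t x = 0) ->
  (forall s e, 0 < e -> \forall t \near F, forall x, cmod (cpartial s (f t) x) <= e) ->
  forall e, 0 < e -> \forall t \near F, cmod (hat g (f t)) < e.
Proof.
move=> tf fm fs e e0; have [N [d [d0 Hd]]] := hat_seminorm m e0.
have H := @near_words _ _ FF (fun s t => forall x, cmod (cpartial s (f t) x) <= d) (fun s => fs s d d0) N.
by apply: (filterS _ H) => t Ht; apply: (Hd (f t) (tf t) (fm t)) => s x sN; exact: Ht.
Qed.

End HatLinear.

Lemma cmod_lim_coord (c : plane R) (k : bool) (e : R) : 0 < e ->
  \forall y \near c, cmod ((0 +i* (2 * pi * coord k y)) - (0 +i* (2 * pi * coord k c))) <= e.
Proof.
move=> e0; have p0 : 0 < 2 * pi :> R by rewrite mulr_gt0// pi_gt0.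
have : \forall y \near c, `|c - y| < e / (2 * pi).
  exact: (@cvgr_dist_lt _ _ _ (nbhs c) _ id c cvg_id _ (divr_gt0 e0 p0)).
apply: filterS => y; rewrite ltr_pdivlMr// => h; apply: le_trans (cmod_le _) _.
rewrite /= subr0 normr0 add0r -mulrBr normrM (ger0_norm (ltW p0)).
apply: le_trans (ltW h); rewrite mulrC; apply: ler_wpM2r; first exact: ltW.
by rewrite distrC prod_normE le_max /coord; case: k; rewrite /= lexx ?orbT.
Qed.

(** The derivative of [phi * (wave x' - wave x)] consists of two terms of the same kind, with
    [cpart k phi] and with [c x' * phi], and of [(c x' - c x) * phi * wave x], which is small as its
    last factors are bounded with all derivatives. Hence the induction generalizes over [phi]. *)
Lemma wave_partials_cvg phi x s : test_function phi -> forall e, 0 < e ->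
  \forall x' \near x, forall xi,
    cmod (cpartial s (fun y => phi y * (wave x' y - wave x y)) xi) <= e.
Proof.
have sw x' : csmooth (fun y => wave x' y - wave x y).
  by apply: csmoothB; exact: csmooth_wave.
elim/last_ind: s phi => [|s k IH] phi tphi e e0.
  have [B B0 HB] := test_bounded tphi.
  have [m m0 hm] := test_box tphi.
  have K0 : 0 < 8 * pi * m * B + 1 by rewrite ltr_wpDl// !mulr_ge0// ?pi_ge0// ltW.
  have : \forall x' \near x, `|x - x'| < e / (8 * pi * m * B + 1).
    exact: (@cvgr_dist_lt _ _ _ (nbhs x) _ id x cvg_id _ (divr_gt0 e0 K0)).
  apply: filterS => x'; rewrite ltr_pdivlMr// => h xi; rewrite cpartial_nil.
  have [/hm ->|bx] := pselect (~ box m xi); first by rewrite mul0r cmod0 ltW.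
  apply: le_trans (ltW h); rewrite cmodM mulrC cmodBC.
  have h1 := wave_lip x x' (contrapT bx).
  apply: (@le_trans _ _ ((8 * pi * m * `|x - x'|) * B)).
    by apply: ler_pM; [exact: cmod_ge0|exact: cmod_ge0|exact: h1|exact: HB].
  by rewrite -subr_ge0 (_ : _ - _ = `|x - x'|)//; ring.
have tk := test_cpart k tphi.
have sphi := test_csmooth tphi.
have [B B0 HB] := test_bounded (test_cpartials s (test_wave x tphi)).
pose c (y : plane R) : R[i] := 0 +i* (2 * pi * coord k y).
have e3 : 0 < e / 3 by rewrite divr_gt0.
have C0 : 0 < cmod (c x) + 1 by rewrite ltr_wpDl// cmod_ge0.
have N1 := IH _ tk _ e3.
have N2 := IH _ tphi _ (divr_gt0 e3 C0).
have N3 := cmod_lim_coord x k (divr_gt0 e3 B0).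
have N4 := cmod_lim_coord x k ltr01.
have sws x' : csmooth (wave x' : plane R -> R[i]) by exact: csmooth_wave.
have E x' : cpart k (fun y => phi y * (wave x' y - wave x y)) =
    (fun y => cpart k phi y * (wave x' y - wave x y) +
       (c x' * (phi y * (wave x' y - wave x y)) + (c x' - c x) * (phi y * wave x y))).
  rewrite cpartM//; apply/funext => y; congr (_ + _).
  under [X in cpart k X]eq_fun do rewrite -mulN1r.
  by rewrite cpartD ?cpartZ ?cpart_wave// -/(c x) -/(c x'); [ring|exact: csmoothZ].
near=> x' => xi.
have b1 := csmoothM (csmooth_cpart k sphi) (sw x').
have b2 := csmoothM sphi (sw x').
have b3 := csmoothM sphi (sws x).
rewrite cpartial_rcons E cpartialD//; last by apply: csmoothD; exact: csmoothZ.
rewrite cpartialD; [|exact: csmoothZ..].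
rewrite !cpartialZ// (_ : e = e / 3 + (e / 3 + e / 3)); last by field.
apply: le_trans (cmodD _ _) _; apply: lerD; first by move: xi; near: x'; exact: N1.
apply: le_trans (cmodD _ _) _; rewrite !cmodM; apply: lerD.
  rewrite (_ : e / 3 = (cmod (c x) + 1) * (e / 3 / (cmod (c x) + 1))); last first.
    by rewrite [RHS]mulrC divfK// gt_eqF.
  apply: ler_pM; [exact: cmod_ge0|exact: cmod_ge0| |by move: xi; near: x'; exact: N2].
  rewrite -{1}(subrK (c x) (c x')) addrC; apply: le_trans (cmodD _ _) _; rewrite lerD2l.
  by near: x'; exact: N4.
rewrite (_ : e / 3 = (e / 3 / B) * B); last by rewrite divfK// gt_eqF.
by apply: ler_pM; [exact: cmod_ge0|exact: cmod_ge0|near: x'; exact: N3|exact: HB].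
Unshelve. all: by end_near. Qed.

(** The frequency band [F^-1 (phi g^)], whose [L^p] norms make up [decomp_norm]. *)
Definition band g phi : plane R -> R[i] := distr_fourier_inv (distr_mul phi (hat g)).

Lemma bandE g phi x : band g phi x = hat g (fun xi => phi xi * wave x xi).
Proof. by []. Qed.

(** Continuity provides the measurability of bands, and makes an essential bound of a band a bound
    at every point. *)
Lemma band_continuous g phi : Zdual g -> test_function phi ->
  continuous (Re \o band g phi) /\ continuous (Im \o band g phi).
Proof.
move=> hg tphi.
have tw x := test_wave x tphi.
have H x e : 0 < e -> \forall x' \near x, cmod (band g phi x - band g phi x') < e.
  move=> e0; have [_ [m hm]] := (test_functionP phi).1 tphi.
  have tt t : test_function (fun y => phi y * (wave t y - wave x y)).
    by apply: testM => //; apply: csmoothB; exact: csmooth_wave.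
  have z t y : ~ box m y -> phi y * (wave t y - wave x y) = 0 by move=> /hm ->; rewrite mul0r.
  have H := @hat_cvg g hg _ (nbhs x) (nbhs_filter x) m (fun x' y => phi y * (wave x' y - wave x y))
    tt z (fun s e e0 => wave_partials_cvg x s tphi e0) e e0.
  apply: (filterS _ H) => x'.
  under [X in hat g X]eq_fun do rewrite mulrBr.
  by rewrite hatB// cmodBC.
split => x; apply/cvgrPdist_lt => e e0; apply: filterS (H x e e0) => x' h; apply: le_lt_trans h.
  rewrite (_ : _ - _ = Re (band g phi x - band g phi x')); first exact: Re_le_cmod.
  by rewrite /=; case: (band g phi x); case: (band g phi x').
rewrite (_ : _ - _ = Im (band g phi x - band g phi x')); first exact: Im_le_cmod.
by rewrite /=; case: (band g phi x); case: (band g phi x').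
Qed.

Lemma csmooth_lattice_sum M n chi : csmooth (lattice_sum M n chi).
Proof. by apply: csmooth_sum => k; apply: csmoothZ; apply: csmoothZ; exact: csmooth_wave. Qed.

Lemma cpart_lattice_sum k M n chi : test_function chi ->
  cpart k (lattice_sum M n chi) = lattice_sum M n (cpart k chi).
Proof.
move=> tchi; rewrite /lattice_sum cpart_sum; last first.
  by move=> i; apply: csmoothZ; apply: csmoothZ; exact: csmooth_wave.
apply/funext => xi; apply: eq_bigr => i _.
have s1 := @csmooth_wave R (- dual_pt M (kpt i)).
rewrite cpartZ; last exact: csmoothZ.
rewrite cpartZ// cpart_wave fourier_inv_cpart//; congr (_ * _).
rewrite (_ : coord k (- dual_pt M (kpt i)) = - coord k (dual_pt M (kpt i))); last by case: (k).
by rewrite mulrN mulrA (mulrC (fourier_inv _ _)).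
Qed.

(** Differentiation falls on [phi] or on [chi], and derivatives still vanish off the closed sets [A]
    and [B]. The claim for [cpart k phi] and [cpart k chi] is therefore an instance of the same
    statement for a shorter word. *)
Lemma lattice_sum_partials_cvg M (A B : set (plane R)) (r : R) s :
  \det M != 0 -> closed A -> closed B -> A `<=` box r ->
  (forall xi (k l : int), A xi -> (k, l) != (0, 0) ->
     ~ B (mx_act M (k%:~R, l%:~R) + xi)) ->
  forall phi chi, test_function phi -> test_function chi ->
  (forall x, ~ A x -> phi x = 0) -> (forall x, ~ B x -> chi x = 0) ->
  forall e, 0 < e -> \forall n \near \oo, forall xi,
    cmod (cpartial s (fun y => phi y * (chi y - lattice_sum M n chi y)) xi) <= e.
Proof.
move=> dM cA cB Ar avoid.
elim/last_ind: s => [|s k IH] phi chi tphi tchi phiA chiB e e0.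
  have [C C0 HC] := test_bounded tphi.
  have av xi (k l : int) : A xi -> (k, l) != (0, 0) -> chi (mx_act M (k%:~R, l%:~R) + xi) = 0.
    by move=> Axi kl; exact/chiB/avoid.
  have [N HN] := lattice_sum_cvg dM tchi Ar av (divr_gt0 e0 C0).
  exists N => // n Nn xi; have Hn := HN n Nn; rewrite cpartial_nil.
  have [/phiA ->|Ax] := pselect (~ A xi); first by rewrite mul0r cmod0 ltW.
  rewrite cmodM cmodBC (_ : e = C * (e / C)); last by rewrite [RHS]mulrC divfK// gt_eqF.
  by apply: ler_pM => //; [exact: cmod_ge0|exact: cmod_ge0|apply: Hn; exact: contrapT].
have e2 : 0 < e / 2 by rewrite divr_gt0.
have sphi := test_csmooth tphi; have schi := test_csmooth tchi.
have skphi := test_csmooth (test_cpart k tphi).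
have skchi := test_csmooth (test_cpart k tchi).
have N1 := IH _ _ (test_cpart k tphi) tchi (cpart_eq0 k cA phiA) chiB _ e2.
have N2 := IH _ _ tphi (test_cpart k tchi) phiA (cpart_eq0 k cB chiB) _ e2.
have sb n h : csmooth h -> csmooth (fun y => h y - lattice_sum M n h y).
  by move=> sh; apply: csmoothB => //; exact: csmooth_lattice_sum.
apply: filterS2 N1 N2 => n H1 H2 xi.
rewrite cpartial_rcons cpartM//; last exact: sb.
have -> : cpart k (fun y => chi y - lattice_sum M n chi y) =
    (fun y => cpart k chi y - lattice_sum M n (cpart k chi) y).
  under eq_fun do rewrite -mulN1r.
  rewrite cpartD//; last by apply: csmoothZ; exact: csmooth_lattice_sum.
  rewrite cpartZ; last exact: csmooth_lattice_sum.
  by rewrite cpart_lattice_sum//; apply/funext => y; rewrite mulN1r.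
rewrite cpartialD; last 2 first.
- by apply: csmoothM => //; exact: sb.
- by apply: csmoothM => //; exact: sb.
rewrite (_ : e = e / 2 + e / 2); last by field.
by apply: (le_trans (cmodD _ _)); apply: lerD; [exact: H1|exact: H2].
Qed.

(** The sampling formula at the origin: the left term is [F^-1 (phi chi g^)] at [0], the sums sample
    [band g phi] on the dual lattice. Other points and shifts are reached by multiplying [phi] and
    [chi] by waves. *)
Lemma hat_lattice_cvg g M (A B : set (plane R)) (r : R) phi chi :
  Zdual g -> \det M != 0 -> closed A -> closed B -> A `<=` box r ->
  (forall xi (k l : int), A xi -> (k, l) != (0, 0) ->
     ~ B (mx_act M (k%:~R, l%:~R) + xi)) ->
  test_function phi -> test_function chi ->
  (forall x, ~ A x -> phi x = 0) -> (forall x, ~ B x -> chi x = 0) ->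
  forall e, 0 < e -> \forall n \near \oo,
    cmod (hat g (fun y => phi y * chi y) -
      \sum_k (@kweight R n k * `|\det M|^-1)%:C *
        (fourier_inv chi (dual_pt M (kpt k)) *
         band g phi (- dual_pt M (kpt k)))) < e.
Proof.
move=> hg dM cA cB Ar avoid tphi tchi phiA chiB e e0.
have sphi := test_csmooth tphi; have schi := test_csmooth tchi.
have sb n : csmooth (fun y => chi y - lattice_sum M n chi y).
  by apply: csmoothB => //; exact: csmooth_lattice_sum.
have z (t : nat) y : ~ box r y -> phi y * (chi y - lattice_sum M t chi y) = 0.
  by move=> nb; rewrite phiA ?mul0r// => /Ar.
have H := @hat_cvg g hg _ \oo (@filter_filter _ _ eventually_filter) r (fun n y => phi y * (chi y - lattice_sum M n chi y))
  (fun n => testM tphi (sb n)) z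
  (fun s e e0 => lattice_sum_partials_cvg s dM cA cB Ar avoid tphi tchi phiA chiB e0) e e0.
apply: filterS H => n; under [X in hat g X]eq_fun do rewrite mulrBr.
rewrite hatB//; last 2 first.
- exact: testM.
- by apply: testM => //; exact: csmooth_lattice_sum.
congr (cmod (_ - _) < e).
rewrite /lattice_sum; under [X in hat g X]eq_fun do rewrite mulr_sumr.
have tw x := test_wave x tphi.
rewrite hat_sum//; last first.
  by move=> i; apply: testM => //; do 2 apply: csmoothZ; exact: csmooth_wave.
apply: eq_bigr => i _; rewrite bandE -hatZ// -hatZ//; last exact: testZ.
by congr (hat g _); apply/funext => y; rewrite mulrCA; congr (_ * _); rewrite mulrCA.
Qed.

End Distributions.

(** * The multiplier estimate *)

Section LatticeShift.
Context {R : realType}.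

Definition unit_square : set (mplane R) := `[0%R, 1%R[%classic `*` `[0%R, 1%R[%classic.

Lemma unit_square_measurable : measurable unit_square.
Proof. by apply: measurableX; exact: measurable_itv. Qed.

Lemma unit_square_measure : pleb unit_square = 1%E.
Proof.
have mi : measurable (`[0%R, 1%R[%classic : set (measurableTypeR R)) by exact: measurable_itv.
rewrite /plane_measure [LHS](product_measure1E _ _ mi mi) /= !lebesgue_measure_itv /= lte_fin.
by rewrite ltr01 oppr0 adde0 mule1.
Qed.

Definition int_pt (k : int * int) : plane R := (k.1%:~R, k.2%:~R).

Lemma change_of_variable_translation (a : plane R) : change_of_variable (fun x => x + a) 1.
Proof.
have := change_of_variable_mx a (_ : \det (1%:M : 'M[R]_2) != 0).
rewrite det1 normr1 oner_neq0 => /(_ isT); congr (change_of_variable _ _).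
by apply/funext => x; rewrite mx_act1.
Qed.

Lemma translation_measurable (a : plane R) :
  measurable_fun [set: mplane R] ((fun x => x + a) : mplane R -> mplane R).
Proof. exact: (change_of_variable_translation a).1. Qed.

Lemma ge0_integral_translation (a : plane R) (f : mplane R -> \bar R) :
  measurable_fun setT f -> (forall x, 0 <= f x)%E ->
  (\int[pleb]_x f (x + a)%R = \int[pleb]_x f x)%E.
Proof.
by move=> mf f0; rewrite -[LHS]mul1e; exact: (change_of_variable_translation a).2.
Qed.

(** The translates of the unit square by integer points, numbered through [pickle] so that countable
    additivity applies; a number that codes no point gives the empty set. *)
Let tile (i : nat) : set (mplane R) :=
  if pickle_inv i is Some k then [set x | unit_square (x - int_pt k)] else set0.

Let shifted_square_measurable k :
  measurable ([set x | unit_square (x - int_pt k)] : set (mplane R)).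
Proof.
have := translation_measurable (- int_pt k) measurableT unit_square_measurable.
by rewrite setTI.
Qed.

Let tile_measurable i : measurable (tile i).
Proof. by rewrite /tile; case: pickle_inv. Qed.

Let int_close (a b : int) (t : R) : 0 <= t - a%:~R < 1 -> 0 <= t - b%:~R < 1 -> a = b.
Proof.
move=> /andP[h1 h2] /andP[h3 h4].
have l1 : a%:~R < (b + 1)%:~R :> R by rewrite intrD; lra.
have l2 : b%:~R < (a + 1)%:~R :> R by rewrite intrD; lra.
rewrite !ltr_int in l1 l2; lia.
Qed.

Let tile_trivIset : trivIset setT tile.
Proof.
apply/trivIsetP => i j _ _ ij; apply/seteqP; split => // x []; rewrite /tile.
have := pickle_invK (T := (int * int)%type) i; have := pickle_invK (T := (int * int)%type) j.
case: (pickle_inv i) => [k|//]; case: (pickle_inv j) => [l|//] /= jl ik [a1 a2] [b1 b2].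
move: ij; rewrite -jl -ik (_ : k = l) ?eqxx//.
case: k l a1 a2 b1 b2 {jl ik} => [k1 k2] [l1 l2] a1 a2 b1 b2; congr pair.
  exact: int_close a1 b1.
exact: int_close a2 b2.
Qed.

(* The average over [s] in the unit square of the sums of [H] over
   [Z^2 + s] is the integral of [H]. *)
Lemma exists_lattice_shift (H : plane R -> R) (D : R) : 0 < D ->
  measurable_fun [set: mplane R] (H : mplane R -> measurableTypeR R) ->
  (forall x, 0 <= H x) -> (\int[pleb]_x (H x)%:E <= D%:E)%E ->
  exists s : plane R, forall (K : finType) (e : K -> int * int), injective e ->
    \sum_k H (int_pt (e k) + s) <= 2 * D.
Proof.
move=> D0 mH H0 HD.
have mHE : measurable_fun [set: mplane R] (EFin \o H) by exact/measurable_EFinP.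
pose h (i : nat) (x : mplane R) : \bar R :=
  if pickle_inv i is Some k then (H (x + int_pt k))%:E else 0%E.
have mh i : measurable_fun setT (h i).
  rewrite /h; case: pickle_inv => [k|]; last exact: measurable_cst.
  exact: (measurableT_comp mHE (translation_measurable (int_pt k))).
have h0 i x : (0 <= h i x)%E by rewrite /h; case: pickle_inv => [k|]; rewrite ?lee_fin.
have mS := unit_square_measurable.
have int_h i : (\int[pleb]_(x in unit_square) h i x = \int[pleb]_(x in tile i) (H x)%:E)%E.
  rewrite /h /tile; case: pickle_inv => [k|]; last by rewrite integral0 integral_set0.
  rewrite integral_mkcond [RHS]integral_mkcond.
  rewrite -[RHS](ge0_integral_translation (int_pt k)).
  - apply: eq_integral => x _; rewrite !patchE.
    congr (if _ then _ else _); apply/idP/idP => /set_mem hx; apply/mem_set; move: hx.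
      by rewrite /= addrK.
    by rewrite /= addrK.
  - by apply/(measurable_restrictT _ (shifted_square_measurable k)); exact: measurable_funTS.
  - by move=> x; rewrite patchE; case: ifP => // _; rewrite lee_fin.
have tot : (\int[pleb]_(x in unit_square) (\sum_(i <oo) h i x) <= D%:E)%E.
  rewrite integral_nneseries//; last by move=> i; exact: measurable_funTS.
  under eq_eseriesr do rewrite int_h.
  rewrite -ge0_integral_bigcup//; last 2 first.
  - exact: measurable_funTS.
  - by move=> x _; rewrite lee_fin.
  apply: le_trans HD; apply: ge0_subset_integral => //.
  - exact: bigcup_measurable.
  - by move=> x _; rewrite lee_fin.
(* Otherwise the series would be at least [2 * D] on a square of area [1], and its integral would
   exceed [D]. *)
have [s Ss] : exists s, unit_square s /\ (\sum_(i <oo) h i s <= (2 * D)%:E)%E.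
  apply: contrapT => nex.
  have big x : unit_square x -> ((2 * D)%:E <= \sum_(i <oo) h i x)%E.
    by move=> Sx; rewrite leNgt; apply/negP => lt; apply: nex; exists x; split => //; exact: ltW.
  have : ((2 * D)%:E <= D%:E)%E.
    apply: le_trans tot.
    rewrite -[leLHS]mule1 -unit_square_measure -integral_cst//.
    apply: ge0_le_integral => //.
    - by move=> x _; rewrite lee_fin mulr_ge0// ltW.
    - by apply: measurable_funTS; apply: ge0_emeasurable_sum.
  by rewrite lee_fin; lra.
exists s => K e inj_e.
rewrite -lee_fin; apply: le_trans (Ss.2); rewrite -sumEFin.
pose E k := pickle (e k).
have hE k : h (E k) s = (H (int_pt (e k) + s))%:E by rewrite /h /E pickleK_inv addrC.
under eq_bigr do rewrite -hE.
have injE : injective E by move=> k l /(pcan_inj (@pickleK (int * int)%type)); exact: inj_e.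
have uE : uniq (map E (index_enum K)) by rewrite map_inj_uniq// index_enum_uniq.
rewrite -(big_map E predT (h ^~ s)).
rewrite (_ : \sum_(i <- map E _) _ = \sum_(i <- finmap.enum_fset (finmap.seq_fset tt (map E (index_enum K)))) h i s)%E.
  exact: (lee_sum_fset_lim (f := h ^~ s)).
by apply: perm_big; rewrite perm_sym (perm_trans (finmap.seq_fset_perm _ _))// undup_id.
Qed.

End LatticeShift.

(** * Powers of weighted sums *)

Section PowerSums.
Context {R : realType}.

(** The ratios of [x] and [y] to [x + y] lie in [[0, 1]], where a number is at most its [r]-th
    power, and they add up to [1]. *)
Lemma powRD_le (r x y : R) : 0 < r <= 1 -> 0 <= x -> 0 <= y ->
  (x + y) `^ r <= x `^ r + y `^ r.
Proof.
move=> /andP[r0 r1] x0 y0; have [xy|xy] := ltP 0 (x + y); last first.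
  have -> : x + y = 0 by apply/eqP; rewrite eq_le xy addr_ge0.
  by rewrite powR0 ?gt_eqF// addr_ge0// powR_ge0.
have xyn : x + y != 0 by rewrite gt_eqF.
have h z : 0 <= z -> z <= x + y -> z / (x + y) * (x + y) `^ r <= z `^ r.
  move=> z0 zxy; have [->|zn] := eqVneq z 0.
    by rewrite !mul0r powR_ge0.
  have zp : 0 < z by rewrite lt_neqAle eq_sym zn.
  rewrite -[leRHS](_ : (z / (x + y)) `^ r * (x + y) `^ r = _); last first.
    by rewrite -powRM; [rewrite divfK|rewrite divr_ge0// ltW|exact: ltW].
  apply: ler_wpM2r; first exact: powR_ge0.
  by apply: ger1_powR => //; rewrite divr_gt0//= ler_pdivrMr// mul1r.
have := lerD (h x x0 (_ : x <= x + y)) (h y y0 (_ : y <= x + y)).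
rewrite lerDl lerDr => /(_ y0 x0).
by rewrite -mulrDl -mulrDl divff// mul1r.
Qed.

Lemma powR_sum_le (K : Type) (s : seq K) (r : R) (x : K -> R) : 0 < r <= 1 ->
  (forall k, 0 <= x k) -> (\sum_(k <- s) x k) `^ r <= \sum_(k <- s) x k `^ r.
Proof.
move=> r01 x0; elim: s => [|k s IH].
  by rewrite !big_nil powR0// gt_eqF//; case/andP: r01.
rewrite !big_cons; apply: le_trans (powRD_le r01 (x0 k) _) _; first exact: sumr_ge0.
by rewrite lerD2l.
Qed.

(** Jensen's inequality for weights of total mass at most [D]: Young's inequality is applied to
    [t k] and [m ^ (r - 1)], where [m = S / D], and summed against the weights. *)
Lemma powR_sum_jensen (K : Type) (s : seq K) (r D : R) (a t : K -> R) : 1 <= r -> 0 < D ->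
  (forall k, 0 <= a k) -> (forall k, 0 <= t k) -> \sum_(k <- s) a k <= D ->
  (\sum_(k <- s) a k * t k) `^ r <= D `^ (r - 1) * \sum_(k <- s) a k * t k `^ r.
Proof.
rewrite le_eqVlt => /predU1P[<-|r1] D0 a0 t0 aD.
  rewrite subrr powRr0 mul1r powRr1; last by apply: sumr_ge0 => k _; rewrite mulr_ge0.
  by apply: ler_sum => k _; rewrite powRr1.
have r0 : 0 < r by apply: lt_trans r1.
set S := \sum_(k <- s) a k * t k.
have S0 : 0 <= S by apply: sumr_ge0 => k _; rewrite mulr_ge0.
pose m := S / D; have m0 : 0 <= m by rewrite divr_ge0// ltW.
pose q := r / (r - 1).
have rm1 : 0 < r - 1 by rewrite subr_gt0.
have q0 : 0 < q by rewrite divr_gt0.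
have rq : r^-1 + q^-1 = 1 by rewrite /q; field; rewrite !gt_eqF.
have H k : t k * m `^ (r - 1) <= t k `^ r / r + m `^ r / q.
  have := conjugate_powR (t0 k) (powR_ge0 m (r - 1)) r0 q0 rq.
  by rewrite -powRrM (_ : (r - 1) * q = r)// /q mulrC divfK// gt_eqF.
have : S * m `^ (r - 1) <= (\sum_(k <- s) a k * t k `^ r) / r + D * (m `^ r / q).
  rewrite /S mulr_suml mulr_suml.
  apply: (@le_trans _ _ (\sum_(k <- s) (a k * (t k `^ r) / r + a k * (m `^ r / q)))).
    by apply: ler_sum => k _; rewrite -!mulrA -mulrDr; apply: ler_wpM2l.
  rewrite big_split /= lerD2l -mulr_suml; apply: ler_wpM2r => //.
  by rewrite mulr_ge0 ?powR_ge0// invr_ge0 ltW.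
have SD : S = D * m by rewrite /m mulrC divfK// gt_eqF.
have -> : S * m `^ (r - 1) = D * m `^ r by rewrite SD -mulrA mulr_powRB1.
set T := \sum_(k <- s) a k * t k `^ r => H1.
have H2 : D * m `^ r <= T.
  have : D * m `^ r * (1 - q^-1) <= T / r.
    by move: H1; rewrite -lerBlDr; congr (_ <= _); ring.
  by rewrite -rq addrK ler_pM2r// invr_gt0.
rewrite SD powRM ?(ltW D0)// (_ : D `^ r = D `^ (r - 1) * D); last first.
  by rewrite mulrC mulr_powRB1// ltW.
by rewrite -mulrA; apply: ler_wpM2l => //; exact: powR_ge0.
Qed.

(** Subadditivity for [r <= 1] and Jensen for [r > 1], in one formula: only the former raises the
    weights to a power, only the latter uses their total mass. *)
Lemma powR_weighted_sum (K : Type) (s : seq K) (r D : R) (a t : K -> R) : 0 < r -> 0 < D ->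
  (forall k, 0 <= a k) -> (forall k, 0 <= t k) ->
  \sum_(k <- s) a k `^ Num.min r 1 <= D ->
  (\sum_(k <- s) a k * t k) `^ r <=
    D `^ (Num.max r 1 - 1) * \sum_(k <- s) a k `^ Num.min r 1 * t k `^ r.
Proof.
move=> r0 D0 a0 t0; have [r1|r1] := leP r 1.
  move=> _; rewrite subrr powRr0 mul1r.
  apply: le_trans (powR_sum_le _ _ _) _; first by rewrite r0.
    by move=> k; rewrite mulr_ge0.
  by apply: ler_sum => k _; rewrite powRM.
move=> aD; have E k : a k `^ 1 = a k by rewrite powRr1.
rewrite [X in _ <= _ * X](eq_bigr (fun k => a k * t k `^ r)); last by move=> k _; rewrite E.
by apply: powR_sum_jensen => //; [exact: ltW|move: aD; under eq_bigr do rewrite E].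
Qed.

Lemma ge0_le_poweR (x y : \bar R) (t : R) : 0 <= t -> (0 <= x)%E -> (x <= y)%E ->
  (x `^ t <= y `^ t)%E.
Proof.
move=> t0 x0 xy; apply: gt0_ler_poweR => //; rewrite in_itv /= leey andbT //.
exact: le_trans xy.
Qed.

End PowerSums.

Section FatouBounds.
Context {R : realType}.

Lemma limn_einf_ge (u : (\bar R)^nat) c : (\forall n \near \oo, (c <= u n)%E) ->
  (c <= limn_einf u)%E.
Proof.
move=> [N _ HN]; rewrite limn_einf_lim.
have cv : cvgn (einfs u) by exact: is_cvg_einfs.
apply: lime_ge => //; exists N => // n /= Nn.
by apply: le_ereal_inf_tmp => _ [k /= nk <-]; apply: HN; exact: leq_trans Nn nk.
Qed.

Lemma limn_einf_le (u : (\bar R)^nat) c : (forall n, (u n <= c)%E) -> (limn_einf u <= c)%E.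
Proof.
move=> uc; rewrite limn_einf_lim.
have cv : cvgn (einfs u) by exact: is_cvg_einfs.
apply: lime_le => //; apply: nearW => n.
apply: le_trans (uc n); apply: ereal_inf_lbound; by exists n => /=.
Qed.

End FatouBounds.

(** * Norms of superposed translates and the multiplier bound *)

Section Multiplier.
Context {R : realType}.
Implicit Types (g : (plane R -> R[i]) -> R[i]) (phi psi : plane R -> R[i]) (M : 'M[R]_2).

Definition pexp (p : \bar R) : R := if p is r%:E then Num.min r 1 else 1.

Lemma pexp_gt0 p : (0 < p)%E -> 0 < pexp p.
Proof. by case: p => [r||]//=; rewrite lte_fin lt_min => ->/=. Qed.

Lemma LnormE (r : R) (u : plane R -> R) : (forall x, 0 <= u x) ->
  Lnorm pleb r%:E (fun x => (u x)%:E) = ((\int[pleb]_x (u x `^ r)%:E) `^ r^-1)%E.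
Proof.
move=> u0; rewrite Lnorm.unlock; congr (_ `^ _)%E; apply: eq_integral => x _.
by rewrite /= (ger0_norm (u0 x)).
Qed.

Lemma measurable_cmod_powR (f : plane R -> R[i]) (r : R) :
  continuous (Re \o f) -> continuous (Im \o f) ->
  measurable_fun [set: mplane R] ((fun x => cmod (f x) `^ r) : mplane R -> measurableTypeR R).
Proof.
move=> c1 c2.
have mc : measurable_fun [set: mplane R] ((fun x => cmod (f x)) : mplane R -> measurableTypeR R).
  by apply: continuous_plane_measurable; exact: cmod_continuous.
exact: (measurableT_comp (measurable_powR r) mc).
Qed.

Lemma open_plane_measure_gt0 (O : set (plane R)) : open O -> O !=set0 -> (0 < pleb O)%E.
Proof.
move=> oO [x Ox]; have /nbhs_ballP[e /= e0 xeO] := oO x Ox.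
pose I (a : R) : set (measurableTypeR R) := `](a - e)%R, (a + e)%R[%classic.
have mI a : measurable (I a) by exact: measurable_itv.
apply: (@lt_le_trans _ _ (pleb (I x.1 `*` I x.2))).
  rewrite /plane_measure [X in (_ < X)%E](product_measure1E _ _ (mI x.1) (mI x.2)) /=.
  rewrite /I !lebesgue_measure_itv /= !lte_fin.
  have h (a : R) : a - e < a + e by lra.
  by rewrite !h -!EFinB -EFinM lte_fin mulr_gt0//; lra.
apply: le_measure; rewrite ?inE.
- exact: measurableX.
- exact: open_plane_measurable.
- move=> y [/= h1 h2]; apply: xeO; split; rewrite /ball /=.
    by move: h1; rewrite /I /= in_itv /= => /andP[? ?]; rewrite ltr_norml; apply/andP; split; lra.
  by move: h2; rewrite /I /= in_itv /= => /andP[? ?]; rewrite ltr_norml; apply/andP; split; lra.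
Qed.

Lemma plane_measureT_gt0 : (0 < pleb [set: plane R])%E.
Proof. by apply: open_plane_measure_gt0; [exact: openT|exists 0]. Qed.

Lemma Lnorm_infE (u : plane R -> R) : (forall x, 0 <= u x) ->
  Lnorm pleb +oo (fun x => (u x)%:E) = ess_sup pleb (fun x => (u x)%:E).
Proof.
move=> u0; rewrite Lnorm.unlock plane_measureT_gt0; congr (ess_sup _ _); apply/funext => x /=.
by rewrite (ger0_norm (u0 x)).
Qed.

(** A value above the essential supremum would be exceeded or nearly attained on a nonempty open
    set, which has positive measure. *)
Lemma ess_sup_continuous (u : plane R -> R) (x : plane R) : continuous u ->
  ((u x)%:E <= ess_sup pleb (EFin \o u))%E.
Proof.
move=> cu; rewrite leNgt; apply/negP => lt.
have [m [ltm mx]] : exists m : R, (ess_sup pleb (EFin \o u) <= m%:E)%E /\ m < u x.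
  case E : (ess_sup pleb (EFin \o u)) lt => [m||]//.
    by rewrite lte_fin => h; exists m.
  by move=> _; exists (u x - 1); split; [rewrite leNye|lra].
pose O : set (plane R) := u @^-1` `]m, +oo[%classic.
have oO : open O by move/continuousP: cu; apply; exact: interval_open.
have := open_plane_measure_gt0 oO (ex_intro _ x _).
rewrite {1}/O /= in_itv /= andbT => /(_ mx).
have /ess_supP[N [mN N0 HN]] := ltm.
rewrite ltNge => /negP; apply; rewrite -N0; apply: le_measure; rewrite ?inE//.
  exact: open_plane_measurable.
move=> y; rewrite /O /= in_itv /= andbT => my; apply: HN => /=.
by rewrite lee_fin => h; move: my; rewrite ltNge h.
Qed.

(* Fatou's lemma, together with Jensen's inequality if [p >= 1] and the
   subadditivity of [t `^ p] if [p <= 1]. *)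
Lemma Lnorm_translates_le (p : \bar R) (F U : plane R -> R) (K : nat -> finType)
    (a : forall n, K n -> R) (y : forall n, K n -> plane R) (E : R) :
  (0 < p)%E -> 0 < E -> continuous F -> continuous U ->
  (forall x, 0 <= F x) -> (forall x, 0 <= U x) -> (forall n k, 0 <= a n k) ->
  (forall n, \sum_k a n k `^ pexp p <= E) ->
  (forall x, \forall n \near \oo, F x <= 2 * \sum_k a n k * U (x + y n k)) ->
  (Lnorm pleb p (fun x => (F x)%:E) <=
    (2 * E `^ (pexp p)^-1)%:E * Lnorm pleb p (fun x => (U x)%:E))%E.
Proof.
move=> p0 E0 cF cU F0 U0 a0 aE HF.
case: p p0 aE => [r||]//= r_gt0 aE; last first.
  move: aE; rewrite invr1 powRr1 ?(ltW E0)// !Lnorm_infE// => aE.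
  have E2 : (0 < (2 * E)%:E)%E by rewrite lte_fin mulr_gt0.
  case EM : (ess_sup pleb (fun x => (U x)%:E)) => [m||].
  - have Um x : U x <= m by rewrite -lee_fin -EM; exact: (@ess_sup_continuous U).
    have m0 : 0 <= m by apply: le_trans (Um 0).
    apply/ess_supP; apply: nearW => x; rewrite -EFinM lee_fin -mulrA.
    have [n Hn] := filter_ex (HF x); apply: le_trans Hn _; apply: ler_wpM2l => //.
    apply: (@le_trans _ _ (\sum_k a n k * m)).
      by apply: ler_sum => k _; apply: ler_wpM2l.
    rewrite -mulr_suml; apply: ler_wpM2r => //; apply: le_trans (aE n).
    by apply: ler_sum => k _; rewrite powRr1.
  - by rewrite gt0_muley ?leey.
  - by have := ess_sup_continuous 0 cU; rewrite EM.
rewrite lte_fin in r_gt0; set t := Num.min r 1 in aE *.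
have rn : r != 0 by rewrite gt_eqF.
rewrite !LnormE//; set N := (\int[pleb]_x (U x `^ r)%:E)%E.
have N0 : (0 <= N)%E by apply: integral_ge0 => x _; rewrite lee_fin powR_ge0.
have S0 n x : 0 <= \sum_k a n k * U (x + y n k).
  by apply: sumr_ge0 => k _; rewrite mulr_ge0.
pose f n x := ((2 * \sum_k a n k * U (x + y n k)) `^ r)%:E.
pose mx := Num.max r 1.
(* [2 ^ r] is the power of the factor in front of the sums, and [E ^ (mx - 1)] comes from
   [powR_weighted_sum]. Summing the [a n k ^ t] contributes one more factor [E]. *)
pose C := 2 `^ r * E `^ (mx - 1).
have C0 : 0 <= C by rewrite mulr_ge0// powR_ge0.
have fle n x : (f n x <= C%:E * \sum_k (a n k `^ t)%:E * (U (x + y n k) `^ r)%:E)%E.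
  rewrite /f; under [X in (_ <= _ * X)%E]eq_bigr do rewrite -EFinM.
  rewrite sumEFin -EFinM lee_fin powRM//.
  rewrite /C -mulrA; apply: ler_wpM2l; first exact: powR_ge0.
  rewrite /mx; have := @powR_weighted_sum _ _ (index_enum _) r E (a n)
    (fun k => U (x + y n k)) r_gt0 E0 (a0 n) (fun k => U0 _).
  by apply; exact: aE.
have mU1 : measurable_fun [set: mplane R] (U : mplane R -> measurableTypeR R).
  exact: continuous_plane_measurable.
have mU : measurable_fun [set: mplane R] (fun x => (U x `^ r)%:E).
  by apply/measurable_EFinP; exact: (measurableT_comp (measurable_powR r) mU1).
have mUs z : measurable_fun [set: mplane R] (fun x => (U (x + z) `^ r)%:E).
  exact: (measurableT_comp mU (translation_measurable z)).
have Ur0 (x : mplane R) : (0 <= (U x `^ r)%:E)%E by rewrite lee_fin powR_ge0.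
have iU z : (\int[pleb]_x (U (x + z) `^ r)%:E = N)%E.
  exact: (ge0_integral_translation z mU).
have mf n : measurable_fun [set: mplane R] (f n).
  apply/measurable_EFinP; apply: (measurableT_comp (measurable_powR r)).
  apply: measurable_funM => //; apply: measurable_sum => k; apply: measurable_funM => //.
  exact: (measurableT_comp mU1 (translation_measurable (y n k))).
have f0 n x : (0 <= f n x)%E by rewrite lee_fin powR_ge0.
have at0 n k : (0 <= (a n k `^ t)%:E)%E by rewrite lee_fin powR_ge0.
have mterm n k : measurable_fun [set: mplane R]
    (fun x => (a n k `^ t)%:E * (U (x + y n k) `^ r)%:E)%E.
  by apply: emeasurable_funM => //; exact: mUs.
have term0 n k x : (0 <= (a n k `^ t)%:E * (U (x + y n k) `^ r)%:E)%E.
  by rewrite mule_ge0// lee_fin powR_ge0.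
have If n : (\int[pleb]_x f n x <= (C * E)%:E * N)%E.
  apply: (@le_trans _ _
    (\int[pleb]_x (C%:E * \sum_k (a n k `^ t)%:E * (U (x + y n k) `^ r)%:E))%E).
    apply: ge0_le_integral => //.
      by apply: emeasurable_funM => //; exact: emeasurable_sum.
  rewrite ge0_integralZl//; last 2 first.
  - exact: emeasurable_sum.
  - by move=> x _; apply: sume_ge0 => k _; exact: term0.
  rewrite (EFinM C E) -(muleA C%:E); apply: lee_wpmul2l; first by rewrite lee_fin.
  rewrite ge0_integral_sum//.
  rewrite (eq_bigr (fun k => (a n k `^ t)%:E * N)%E); last first.
    move=> k _; rewrite (ge0_integralZl_EFin _ measurableT _ (mUs _) (powR_ge0 _ _)).
      by rewrite iU.
    by move=> x _; rewrite lee_fin powR_ge0.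
  rewrite -ge0_sume_distrl//.
  by rewrite sumEFin; apply: lee_wpmul2r => //; rewrite lee_fin.
have Ile : (\int[pleb]_x (F x `^ r)%:E <= (C * E)%:E * N)%E.
  apply: (@le_trans _ _ (\int[pleb]_x limn_einf (f ^~ x))%E).
    apply: ge0_le_integral => //.
    - by move=> x _; rewrite lee_fin powR_ge0.
    - apply/measurable_EFinP; apply: (measurableT_comp (measurable_powR r)).
      exact: continuous_plane_measurable.
    - rewrite (_ : (fun _ => _) = (fun x => - limn_esup (fun n => - f n x))%E); last first.
        apply/funext => x; rewrite -[(fun n => - f n x)%E]/(-%E \o (f ^~ x)).
        by rewrite limn_esupN oppeK.
      apply: (measurableT_comp (@oppe_measurable R setT)).
      by apply: measurable_fun_limn_esup => n; exact: measurableT_comp.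
    - move=> x _; apply: limn_einf_ge; apply: filterS (HF x) => n h.
      rewrite lee_fin; apply: ge0_ler_powR; rewrite ?nnegrE ?(ltW r_gt0)//.
      by rewrite mulr_ge0.
  apply: le_trans (fatou _ _ _ _) _ => //.
  exact: limn_einf_le.
(* [max(r, 1) / r = 1 / min(r, 1)], which merges the two cases. *)
have -> : 2 * E `^ t^-1 = (C * E) `^ r^-1.
  rewrite /C -mulrA (_ : E `^ (mx - 1) * E = E `^ mx); last first.
    by rewrite mulrC mulr_powRB1 ?(ltW E0)// lt_max ltr01 orbT.
  rewrite powRM ?powR_ge0// -!powRrM divff// powRr1//; congr (2 * E `^ _).
  rewrite /t /mx; have [r1|r1] := leP r 1; first by rewrite mul1r.
  by rewrite divff// invr1.
rewrite -poweR_EFin -poweRM ?lee_fin ?mulr_ge0 ?(ltW E0)//.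
apply: ge0_le_poweR; rewrite ?invr_ge0 ?(ltW r_gt0)//.
- by apply: integral_ge0 => x _; rewrite lee_fin powR_ge0.
- exact: powR_ge0.
Qed.

Lemma fourier_inv_wave psi (s x : plane R) :
  fourier_inv (fun xi => psi xi * wave s xi) x = fourier_inv psi (x + s).
Proof.
congr cintegral; apply/funext => xi.
by rewrite -mulrA -[expi _]/(wave x xi) -wave_add addrC.
Qed.

Lemma scale_le (a b D : R) (x y : \bar R) : a * b = 1 -> 0 <= a -> (b%:E * x = y)%E ->
  (y <= D%:E)%E -> (x <= (a * D)%:E)%E.
Proof.
move=> ab a0 E yD; rewrite -[leLHS]mul1e -ab EFinM -muleA E EFinM.
by apply: lee_wpmul2l; rewrite ?lee_fin.
Qed.

Local Opaque fourier_inv cmod powR.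

Section Bound.
Variables (p : \bar R) (g : (plane R -> R[i]) -> R[i]) (phi psi : plane R -> R[i]).
Variables (M : 'M[R]_2) (A B : set (plane R)) (r0 D : R).
Hypotheses (p0 : (0 < p)%E) (hg : Zdual g) (dM : \det M != 0).
Hypotheses (cA : closed A) (cB : closed B) (Ar : A `<=` box r0).
Hypothesis avoid : forall xi (k l : int), A xi -> (k, l) != (0, 0) ->
  ~ B (mx_act M (k%:~R, l%:~R) + xi).
Hypotheses (tphi : test_function phi) (tpsi : test_function psi).
Hypotheses (phiA : forall x, ~ A x -> phi x = 0) (psiB : forall x, ~ B x -> psi x = 0).
Hypothesis D0 : 0 < D.
Hypothesis HD : (\int[pleb]_x (cmod (fourier_inv psi x) `^ pexp p)%:E <= D%:E)%E.

Let t := pexp p.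
Let t0 : 0 < t. Proof. exact: pexp_gt0. Qed.
Let dabs : 0 < `|\det M|. Proof. by rewrite normr_gt0. Qed.
(** [2] is lost in the choice of the shift; [|det M|^-t] is the power of the factor [1 / |det M|] of
    the coefficients, and [|det M|] the Jacobian of the passage to coordinates of the dual
    lattice. *)
Let E := 2 * (`|\det M| `^ (1 - t) * D).
Let E0 : 0 < E. Proof. by rewrite mulr_gt0// mulr_gt0// powR_gt0. Qed.

Let kpt_int n (k : 'I_(2 * n).+1 * 'I_(2 * n).+1) : int * int :=
  ((k.1)%:Z - n%:Z, (k.2)%:Z - n%:Z).

Let kpt_intE n k : int_pt (@kpt_int n k) = kpt k :> plane R.
Proof. by rewrite /int_pt /kpt_int /kpt /= !intrB. Qed.

Let kpt_int_inj n : injective (@kpt_int n).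
Proof.
move=> [a b] [c d] []/= /addIr [] ac /addIr [] bd.
by congr pair; exact: val_inj.
Qed.

(** A good shift exists for [|F^-1 psi|^t] read in the coordinates of the dual lattice. The kernel
    weights, being at most [1], are dropped. *)
Let coef_sum : exists s : plane R, forall n,
  \sum_k ((@kweight R n k * `|\det M|^-1) *
     cmod (fourier_inv psi (dual_pt M (kpt k) + s))) `^ t <= E.
Proof.
pose N := (invmx M)^T.
have dN : \det N = (\det M)^-1 by rewrite det_tr det_inv.
have dN0 : \det N != 0 by rewrite dN invr_neq0.
pose H x := cmod (fourier_inv psi (mx_act N x)) `^ t.
have [ci1 ci2] := fourier_inv_continuous tpsi.
have mF := measurable_cmod_powR t ci1 ci2.
have [mg Hg] := change_of_variable_mx 0 dN0.
have mN : measurable_fun [set: mplane R] (mx_act N : mplane R -> mplane R).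
  by move: mg; congr measurable_fun; apply/funext => x; rewrite addr0.
have mH : measurable_fun [set: mplane R] (H : mplane R -> measurableTypeR R).
  exact: (measurableT_comp mF mN).
have HH : (\int[pleb]_x (H x)%:E <= (`|\det M| * D)%:E)%E.
  have me : measurable_fun [set: mplane R] (fun x => (cmod (fourier_inv psi x) `^ t)%:E).
    by apply/measurable_EFinP; exact: mF.
  have F0 (x : mplane R) : (0 <= (cmod (fourier_inv psi x) `^ t)%:E)%E by rewrite lee_fin powR_ge0.
  have EH : (\int[pleb]_x (cmod (fourier_inv psi (mx_act N x + 0)) `^ t)%:E =
      \int[pleb]_x (H x)%:E)%E by apply: eq_integral => x _; rewrite addr0.
  have dMN : `|\det M| * `|\det N| = 1.
    rewrite -normrM.
    rewrite dN.
    rewrite (divff dM).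
    exact: normr1.
  apply: (scale_le dMN (normr_ge0 _) _ HD).
  exact: (etrans (congr1 (fun z => `|\det N|%:E * z)%E (esym EH)) (Hg _ me F0)).
have [s Hs] := exists_lattice_shift (mulr_gt0 dabs D0) mH (fun x => powR_ge0 _ _) HH.
exists (mx_act N s) => n.
have kw k := @kweight_itv R n k.
have dV : 0 <= `|\det M|^-1 by rewrite invr_ge0.
apply: (@le_trans _ _ (\sum_k `|\det M|^-1 `^ t * H (int_pt (@kpt_int n k) + s))).
  apply: ler_sum => k _; have /andP[k0 k1] := kw k.
  rewrite (powRM _ (mulr_ge0 k0 dV) (cmod_ge0 _)) (powRM _ k0 dV).
  rewrite /H mx_actD kpt_intE -/(dual_pt M _).
  apply: ler_wpM2r; first exact: powR_ge0.
  rewrite -[leRHS]mul1r; apply: ler_wpM2r; first exact: powR_ge0.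
  rewrite -[leRHS](_ : 1 `^ t = 1); last by rewrite powR1.
  by apply: ge0_ler_powR; rewrite ?nnegrE ?(ltW t0).
rewrite -mulr_sumr.
have := Hs _ (@kpt_int n) (@kpt_int_inj n).
move=> /(ler_wpM2l (powR_ge0 `|\det M|^-1 t)) h; apply: le_trans h _.
rewrite /E le_eqVlt; apply/orP; left; apply/eqP.
rewrite mulrCA; congr (2 * _); rewrite mulrA; congr (_ * D).
rewrite -{2}(powRr1 (ltW dabs)) -[`|_|^-1](powR_inv1 (normr_ge0 _)) -powRrM mulN1r -powRD; last first.
  by apply/implyP => _; rewrite gt_eqF.
by rewrite addrC.
Qed.

Let band_wave x y : band g (fun xi => phi xi * wave x xi) y = band g phi (x + y).
Proof.
rewrite !bandE; congr (hat g _); apply/funext => xi.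
by rewrite -mulrA -wave_add.
Qed.

Let F x := cmod (band g (fun xi => phi xi * psi xi) x).
Let U x := cmod (band g phi x).

(** The wave at [x] is the product of the waves at [x - s] and [s]. Attaching the former to [phi]
    and the latter to [psi] moves the samples of [F^-1 psi] to the shifted dual lattice. *)
Let pointwise_bound : exists s : plane R, exists a : forall n, 'I_(2 * n).+1 * 'I_(2 * n).+1 -> R,
  [/\ forall n k, 0 <= @a n k, forall n, \sum_k @a n k `^ t <= E &
   forall x, \forall n \near \oo, F x <= 2 * \sum_k @a n k * U (x - s - dual_pt M (kpt k))].
Proof.
have [s Hs] := coef_sum; exists s.
exists (fun n k => (kweight k * `|\det M|^-1) * cmod (fourier_inv psi (dual_pt M (kpt k) + s))).
have dV : 0 <= `|\det M|^-1 by rewrite invr_ge0.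
have kw n k : 0 <= @kweight R n k by have /andP[] := @kweight_itv R n k.
split => [n k|n|x].
- by rewrite !mulr_ge0// cmod_ge0.
- exact: Hs.
have tw := test_wave (x - s) tphi; have tc := test_wave s tpsi.
have twA y : ~ A y -> phi y * wave (x - s) y = 0 by move=> /phiA ->; rewrite mul0r.
have tcB y : ~ B y -> psi y * wave s y = 0 by move=> /psiB ->; rewrite mul0r.
have bound0 n : 0 <= \sum_k (@kweight R n k * `|\det M|^-1) *
    cmod (fourier_inv psi (dual_pt M (kpt k) + s)) * U (x - s - dual_pt M (kpt k)).
  apply: sumr_ge0 => k _; apply: mulr_ge0; last exact: cmod_ge0.
  by rewrite (mulr_ge0 (mulr_ge0 (kw n k) dV) (cmod_ge0 _)).
(* If [F x > 0], the error of the sampling sums is eventually below [F x / 2], so the sums reach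
   half of [F x]; this is the origin of the factor [2]. *)
have [F0|F0] := leP (F x) 0.
  by apply: nearW => n; apply: (le_trans F0); rewrite mulr_ge0.
have H := hat_lattice_cvg hg dM cA cB Ar avoid tw tc twA tcB (divr_gt0 F0 (ltr0Sn _ 1)).
apply: filterS H => n.
have -> : hat g (fun y => phi y * wave (x - s) y * (psi y * wave s y)) =
    band g (fun xi => phi xi * psi xi) x.
  rewrite bandE; congr (hat g _); apply/funext => y.
  by rewrite mulrACA -wave_add subrK.
set S := \sum_k _ => h.
have : F x <= F x / 2 + cmod S.
  rewrite {1}/F -[band _ _ x](subrK S); apply: le_trans (cmodD _ _) _.
  by rewrite lerD2r ltW.
have : cmod S <= \sum_k (@kweight R n k * `|\det M|^-1) *
    cmod (fourier_inv psi (dual_pt M (kpt k) + s)) * U (x - s - dual_pt M (kpt k)).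
  apply: le_trans (cmod_sum _ _ _) _; apply: ler_sum => k _.
  rewrite !cmodM cmodR (ger0_norm (mulr_ge0 (kw n k) dV)) band_wave mulrA /U.
  by rewrite fourier_inv_wave.
lra.
Qed.

Let U_cont : continuous (Re \o band g phi) /\ continuous (Im \o band g phi).
Proof. exact: band_continuous. Qed.

Lemma Lp_norm_multiplier :
  (Lp_norm p (band g (fun xi => phi xi * psi xi)%R) <=
    (2 * E `^ t^-1)%:E * Lp_norm p (band g phi))%E.
Proof.
have [s [a [a0 aE HF]]] := pointwise_bound.
have tphipsi : test_function (fun xi => phi xi * psi xi).
  by apply: testM => //; exact: test_csmooth.
have [u1 u2] := U_cont; have [f1 f2] := band_continuous hg tphipsi.
apply: (@Lnorm_translates_le p F U _ a (fun n k => - s - dual_pt M (kpt k)) E) => //.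
- exact: (cmod_continuous f1 f2).
- exact: (cmod_continuous u1 u2).
- by move=> x; exact: cmod_ge0.
- by move=> x; exact: cmod_ge0.
- move=> x; apply: filterS (HF x) => n.
  by under eq_bigr do rewrite -addrA.
Qed.

End Bound.

End Multiplier.

(** * Geometry of the coverings *)

Section PlaneGeometry.
Context {R : realType}.
Implicit Types x y z f : plane R.

(** For a unit vector [f], [inner x f] and [cross x f] are, up to sign, the coordinates of [x] along
    [f] and across it. [|cross x f|] is [|x|] times the sine of the angle, hence insensitive to
    directions modulo [pi]. *)
Definition cross x y : R := x.1 * y.2 - x.2 * y.1.

Lemma inner_ge0 x : 0 <= inner x x.
Proof. by rewrite /inner -!expr2 addr_ge0 ?sqr_ge0. Qed.

Lemma enorm_ge0 x : 0 <= enorm x.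
Proof. exact: sqrtr_ge0. Qed.

Lemma enorm_sqr x : enorm x ^+ 2 = inner x x.
Proof. by rewrite sqr_sqrtr ?inner_ge0. Qed.

Lemma ler_sqr_norm (a b : R) : 0 <= b -> a ^+ 2 <= b ^+ 2 -> `|a| <= b.
Proof.
by move=> b0 h; rewrite -(ger0_norm b0) -ler_sqr ?nnegrE// -!normrX !ger0_norm ?sqr_ge0.
Qed.

Lemma inner_le_enorm x y : inner y y = 1 -> `|inner x y| <= enorm x.
Proof.
rewrite /inner => h; apply: ler_sqr_norm; first exact: enorm_ge0.
rewrite enorm_sqr /inner; have := sqr_ge0 (cross x y); rewrite /cross => h2.
suff : (x.1 * y.1 + x.2 * y.2) ^+ 2 + (x.1 * y.2 - x.2 * y.1) ^+ 2 = x.1 * x.1 + x.2 * x.2 by lra.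
by rewrite -[RHS]mulr1 -h; ring.
Qed.

Lemma inner_cross_sqr x f : inner f f = 1 ->
  inner x f ^+ 2 + cross x f ^+ 2 = enorm x ^+ 2.
Proof. by move=> h; rewrite enorm_sqr -[RHS]mulr1 -h /inner /cross; ring. Qed.

(** The norm is at most the sum of the moduli of the two coordinates. Replacing [|x|] by
    [|inner x f|] thus costs [O(r^beta)] in a sector, which [beta <= alpha] makes harmless. *)
Lemma inner_near_enorm x f : inner f f = 1 ->
  `| `|inner x f| - enorm x| <= `|cross x f|.
Proof.
move=> h; have := inner_cross_sqr x h.
rewrite -(real_normK (num_real (inner x f))) -(real_normK (num_real (cross x f))).
have := enorm_ge0 x; have := normr_ge0 (inner x f); have := normr_ge0 (cross x f).
move: (enorm x) `|inner x f| `|cross x f| => e u v v0 u0 e0 E.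
have ue : u <= e by rewrite -ler_sqr ?nnegrE// -E lerDl sqr_ge0.
rewrite ler0_norm ?subr_le0// opprB lerBlDr.
by rewrite -ler_sqr ?nnegrE ?addr_ge0// -E; have := mulr_ge0 u0 v0; nra.
Qed.

Lemma enorm_le_box x f X Y : inner f f = 1 -> `|inner x f| <= X -> `|cross x f| <= Y ->
  box (X + Y) x.
Proof.
move=> h hX hY.
have f1 : `|f.1| <= 1.
  by apply: ler_sqr_norm => //; rewrite expr1n -h /inner; have := sqr_ge0 f.2; nra.
have f2 : `|f.2| <= 1.
  by apply: ler_sqr_norm => //; rewrite expr1n -h /inner; have := sqr_ge0 f.1; nra.
have E1 : x.1 = inner x f * f.1 + cross x f * f.2.
  by rewrite -[LHS]mulr1 -h /inner /cross; ring.
have E2 : x.2 = inner x f * f.2 - cross x f * f.1.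
  by rewrite -[LHS]mulr1 -h /inner /cross; ring.
have X0 := le_trans (normr_ge0 _) hX; have Y0 := le_trans (normr_ge0 _) hY.
have M a b c : `|a| <= c -> `|b| <= 1 -> `|a * b| <= c.
  by move=> ac b1; rewrite normrM -[c]mulr1 ler_pM.
split.
- by rewrite E1; apply: le_trans (ler_normD _ _) _; rewrite lerD ?M.
- by rewrite E2; apply: le_trans (ler_normB _ _) _; rewrite lerD ?M.
Qed.

(* Subadditivity of [|sin|]. *)
Lemma cross_triangle x y z : inner y y = 1 -> inner z z = 1 ->
  enorm x * `|cross y z| <= `|cross x y| + `|cross x z|.
Proof.
move=> hy hz; have [/eqP x0|xn0] := eqVneq (enorm x) 0.
  by rewrite (eqP x0) mul0r addr_ge0.
have e0 : 0 < enorm x by rewrite lt0r xn0 enorm_ge0.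
rewrite -(ler_pM2l e0) mulrA -expr2 enorm_sqr -{1}(ger0_norm (inner_ge0 x)) -normrM.
have -> : inner x x * cross y z = inner x y * cross x z - inner x z * cross x y.
  by rewrite /inner /cross; ring.
apply: le_trans (ler_normB _ _) _; rewrite !normrM addrC mulrDr.
by apply: lerD; apply: ler_wpM2r => //; exact: inner_le_enorm.
Qed.

(** The addition formula of the sine, for a change of reference direction from [y] to [z], with the
    cosines bounded by [1]. *)
Lemma cross_change x y z : inner y y = 1 -> inner z z = 1 ->
  `|cross x z| <= enorm x * `|cross y z| + `|cross x y|.
Proof.
move=> hy hz.
have -> : cross x z = inner x y * cross y z + cross x y * inner y z.
  by rewrite -[LHS]mulr1 -hy /inner /cross; ring.
apply: le_trans (ler_normD _ _) _; rewrite !normrM; apply: lerD.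
  by apply: ler_wpM2r => //; exact: inner_le_enorm.
rewrite -[leRHS]mulr1; apply: ler_wpM2l => //; apply: le_trans (inner_le_enorm _ hz) _.
by rewrite /enorm hy sqrtr1.
Qed.

Lemma continuous_inner_diag : continuous (fun x => inner x x).
Proof.
move=> x; rewrite /inner; apply: cvgD; apply: cvgM;
  first [exact: cvg_fst|exact: cvg_snd].
Qed.

Lemma continuous_enorm : continuous (@enorm R).
Proof.
move=> x; apply: (@continuous_comp _ _ _ (fun x => inner x x) (@Num.sqrt R)).
  exact: continuous_inner_diag.
exact: sqrt_continuous.
Qed.

Lemma continuous_innerl f : continuous (fun x => inner x f).
Proof.
move=> x; rewrite /inner; apply: cvgD; apply: cvgM;
  first [exact: cvg_fst|exact: cvg_snd|exact: cvg_cst].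
Qed.

Lemma continuous_crossl f : continuous (fun x => cross x f).
Proof.
move=> x; rewrite /cross; apply: cvgB; apply: cvgM;
  first [exact: cvg_fst|exact: cvg_snd|exact: cvg_cst].
Qed.

Lemma closed_le_plane (u : plane R -> R) c : continuous u -> closed [set x | u x <= c].
Proof. by move=> cu; apply: (@closed_comp _ _ u [set y | y <= c]) => [x _|]; [exact: cu|exact: closed_le]. Qed.

End PlaneGeometry.

(** * Radial and angular control of covering sets *)

Section CoveringGeometry.
Context {R : realType}.
Implicit Types (alpha beta : R) (x y z f : plane R).

Lemma interval_length_ge (L : set R) (a b : R) : is_interval L -> L a -> L b ->
  ((b - a)%:E <= lebesgue_measure L)%E.
Proof.
move=> iL La Lb; have [ab|ab] := ltP b a.
  by apply: (@le_trans _ _ 0%E); rewrite ?measure_ge0// lee_fin subr_le0 ltW.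
have h : `[a, b]%classic `<=` L.
  by move=> c /=; rewrite in_itv /= => acb; exact: (iL a b).
have : (lebesgue_measure (`[a, b]%classic : set (measurableTypeR R)) <= lebesgue_measure L)%E.
  apply: le_measure; [|rewrite inE|exact: h]; first by apply/mem_set; exact: measurable_itv.
  exact: is_interval_measurable.
apply: le_trans; rewrite lebesgue_measure_itv /= lte_fin; case: ltP => // ba.
by rewrite lee_fin subr_le0.
Qed.

Lemma norm_sin_le (t : R) : `|sin t| <= 2 * `|t|.
Proof.
have := le_trans (Im_le_cmod _) (expi_lip t 0).
by rewrite /expi /= sin0 !subr0.
Qed.

(* [C] bounds the spread of [|x|], and [f] is the direction of the pair of
   opposite sectors containing the set. *)
Definition polar_controlled alpha beta (C : R) (A : set (plane R)) f :=
  inner f f = 1 /\ forall x, A x ->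
    (forall y, A y -> `|enorm x - enorm y| <= C * (1 + enorm x) `^ alpha) /\
    `|cross x f| <= C * (1 + enorm x) `^ beta.

(** The length of [L_i] bounds the radial spread. The angular deviation of order
    [(1 + |x|)^(beta - 1)], multiplied by [|x|], bounds the distance to the axis by a multiple of
    [(1 + |x|)^beta]. *)
Lemma covering_polar (I : choiceType) (Q : I -> set (plane R)) alpha beta :
  alpha_beta_covering alpha beta Q ->
  exists2 C : R, 0 < C & forall i, exists f, polar_controlled alpha beta C (Q i) f.
Proof.
case=> _ _ _ [C1 C10 H1] [C2 C20 H2].
exists (C1 + 2 * C2); first by rewrite addr_gt0 ?mulr_gt0.
move=> i; have [L [iL _ HL]] := H1 i; have [t0 Ht] := H2 i.
exists (cos t0, sin t0); split; first by rewrite /inner /= -!expr2 cos2Dsin2.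
move=> x Qx; have e0 := enorm_ge0 x; have ax := powR_ge0 (1 + enorm x).
split=> [y Qy|].
  have [Lx mL] := HL _ Qx; have [Ly _] := HL _ Qy.
  apply: (@le_trans _ _ (C1 * (1 + enorm x) `^ alpha)); last first.
    by rewrite ler_wpM2r// lerDl mulr_ge0 ?ltW.
  rewrite ler_norml; apply/andP; split.
    rewrite lerNl opprB -lee_fin; apply: le_trans mL; exact: interval_length_ge.
  rewrite -lee_fin; apply: le_trans mL; exact: interval_length_ge.
have [t xE Hm] := Ht _ Qx.
apply: (@le_trans _ _ (2 * C2 * (1 + enorm x) `^ beta)); last first.
  by rewrite ler_wpM2r// lerDr ltW.
have -> : cross x (cos t0, sin t0) = - (enorm x * sin (t - t0)).
  by rewrite {1}xE /cross /= sinB; ring.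
rewrite normrN normrM (ger0_norm e0).
(* Adding [pi] to the angle only changes the sign of the sine, so both alternatives of the minimum
   yield the same bound. *)
have sm : `|sin (t - t0)| <= 2 * C2 * (1 + enorm x) `^ (beta - 1).
  rewrite -mulrA; apply: le_trans (ler_wpM2l (ler0n R 2) Hm); rewrite -ler_pdivrMl// le_min.
  rewrite !ler_pdivrMl// norm_sin_le /=.
  have -> : sin (t - t0) = - sin (t - (t0 + pi)).
    by rewrite -sinDpi; congr sin; ring.
  by rewrite normrN norm_sin_le.
apply: le_trans (ler_wpM2l e0 sm) _; rewrite mulrCA; apply: ler_wpM2l; first by rewrite mulr_ge0 ?ltW.
have r0 : 0 < 1 + enorm x by lra.
have -> : (1 + enorm x) `^ beta = (1 + enorm x) `^ (beta - 1) * (1 + enorm x).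
  rewrite -{3}(powRr1 (ltW r0)) -powRD ?subrK//.
  by apply/implyP => _; rewrite gt_eqF.
by rewrite mulrC; apply: ler_wpM2l => //; lra.
Qed.

Lemma powR_moderate (C a s t : R) : 0 < C -> 0 <= a <= 1 -> 1 <= t -> 0 <= s ->
  s <= (1 + C) * t -> s `^ a <= (1 + C) * t `^ a.
Proof.
move=> C0 /andP[a0 a1] t1 s0 st; have c1 : 1 <= 1 + C by lra.
apply: (@le_trans _ _ (((1 + C) * t) `^ a)).
  by apply: ge0_ler_powR; rewrite ?nnegrE//; apply: mulr_ge0; lra.
rewrite powRM; [|lra|lra]; apply: ler_wpM2r; first exact: powR_ge0.
rewrite -[leRHS]powRr1; last lra.
exact: ler_powR.
Qed.

(** As [alpha <= 1], the radial spread is at most [C * (1 + enorm x)]. *)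
Lemma polar_controlled_enorm alpha beta C A f x y : 0 < C -> 0 <= alpha <= 1 ->
  polar_controlled alpha beta C A f -> A x -> A y ->
  1 + enorm y <= (1 + C) * (1 + enorm x).
Proof.
move=> C0 /andP[a0 a1] [_ H] Ax Ay; have [/(_ _ Ay) + _] := H _ Ax.
have e0 := enorm_ge0 x.
have : (1 + enorm x) `^ alpha <= 1 + enorm x.
  by rewrite -[leRHS]powRr1; [apply: ler_powR => //; lra|lra].
rewrite ler_norml => h /andP[h1 _]; have := ler_wpM2l (ltW C0) h; nra.
Qed.

Lemma cross_unit y z : inner y y = 1 -> inner z z = 1 -> `|cross y z| <= 1.
Proof.
move=> hy hz; apply: ler_sqr_norm => //; rewrite expr1n.
have := inner_cross_sqr y hz; rewrite enorm_sqr hy; have := sqr_ge0 (inner y z); lra.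
Qed.

(** Dominates both constants that arise when two sets meet: [C (1 + C) + C] for the radius and
    [1 + C + 3 C (1 + C)^2] for the direction. *)
Definition polar_constant (C : R) := (1 + C) ^+ 2 * (1 + 3 * C).

(** Everything is transported through the common point [z]. At [z] both directions are nearly
    radial, so [cross_triangle] bounds [enorm z * |cross g f|]; as [enorm x] is comparable with
    [1 + enorm z], [cross_change] replaces [g] by [f] at [x]. The summand [1] is absorbed by
    [|cross g f| <= 1]. *)
Lemma polar_controlled_meet alpha beta C A B f g x0 x :
  0 < C -> 0 <= alpha <= 1 -> 0 <= beta <= 1 ->
  polar_controlled alpha beta C A f -> polar_controlled alpha beta C B g ->
  B `&` A !=set0 -> A x0 -> B x ->
  `|enorm x - enorm x0| <= polar_constant C * (1 + enorm x0) `^ alpha /\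
  `|cross x f| <= polar_constant C * (1 + enorm x0) `^ beta.
Proof.
move=> C0 ha hb hA hB [z [Bz Az]] Ax0 Bx.
have [uf HA] := hA; have [ug HB] := hB.
have zx0 := polar_controlled_enorm C0 ha hA Ax0 Az.
have xz := polar_controlled_enorm C0 ha hB Bz Bx.
have ez := enorm_ge0 z; have ex := enorm_ge0 x; have ex0 := enorm_ge0 x0.
have pow a : 0 <= a <= 1 -> 1 <= (1 + enorm x0) `^ a /\
    (1 + enorm z) `^ a <= (1 + C) * (1 + enorm x0) `^ a /\
    (1 + enorm x) `^ a <= (1 + C) ^+ 2 * (1 + enorm x0) `^ a.
  move=> a01; split.
    rewrite -[leLHS](powRr0 (1 + enorm x0)); apply: ler_powR; first lra.
    by case/andP: a01.
  have h1 : (1 + enorm z) `^ a <= (1 + C) * (1 + enorm x0) `^ a by apply: powR_moderate => //; lra.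
  have h2 : (1 + enorm x) `^ a <= (1 + C) * (1 + enorm z) `^ a by apply: powR_moderate => //; lra.
  split; [exact: h1|]; apply: (le_trans h2); rewrite expr2 -mulrA; apply: (ler_wpM2l _ h1); lra.
have [ra1 [raz rax]] := pow _ ha; have [rb1 [rbz rbx]] := pow _ hb.
split.
  have [/(_ _ Bx) h1 _] := HB _ Bz; have [/(_ _ Az) h2 _] := HA _ Ax0.
  have -> : enorm x - enorm x0 = - (enorm z - enorm x) - (enorm x0 - enorm z) by ring.
  apply: le_trans (ler_normB _ _) _; rewrite normrN.
  move: h1 h2 ra1 raz.
  move: `|enorm z - _| `|_ - enorm z| ((1 + enorm z) `^ alpha) ((1 + enorm x0) `^ alpha).
  clear - C0 => u v r s h1 h2 s1 rs.
  have h3 := ler_wpM2l (ltW C0) rs.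
  apply: (@le_trans _ _ ((C * (1 + C) + C) * s)); first lra.
  apply: ler_wpM2r; first lra.
  rewrite /polar_constant; nra.
have [_ cx] := HB _ Bx; have [_ czg] := HB _ Bz; have [_ czf] := HA _ Az.
have T := cross_triangle z ug uf; have c1 := cross_unit ug uf.
apply: le_trans (cross_change x ug uf) _.
have c0 : 0 <= `|cross g f| by [].
move: T c1 c0 cx czg czf rb1 rbz rbx.
move: `|cross g f| `|cross x g| `|cross z g| `|cross z f| ((1 + enorm z) `^ beta).
move: ((1 + enorm x0) `^ beta) ((1 + enorm x) `^ beta) xz ex ez.
move: (enorm x) (enorm z); clear - C0 => {}x {}z s t xz ex ez c u v w r T c1 c0 hu hv hw s1 rs ts.
have hc : c * x <= c * ((1 + C) * (1 + z)) by apply: ler_wpM2l => //; lra.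
have h1 := ler_wpM2l (ltW C0) rs; have h2 := ler_wpM2l (ltW C0) ts.
have h3 : (1 + C) * (z * c) <= (1 + C) * (2 * (C * ((1 + C) * s))).
  by apply: ler_wpM2l; lra.
have h4 : (1 + C) * c <= (1 + C) * s by apply: ler_wpM2l; lra.
apply: (@le_trans _ _ ((1 + C + 2 * C * (1 + C) ^+ 2 + C * (1 + C) ^+ 2) * s)); first nra.
apply: ler_wpM2r; first lra.
rewrite /polar_constant; nra.
Qed.

End CoveringGeometry.

(** * Areas of sectors and counting by area *)

Section Counting.
Context {R : realType}.
Implicit Types (x y z f : plane R).

(* As [|cross x g| <= inner x g], the function [enorm] grows at a rate bounded
   below along [g], so that the slices in this direction have length [O(X)]. *)
Definition sector_piece g (rho X Y : R) : set (plane R) :=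
  [set x | [/\ `|cross x g| <= Y, `|cross x g| <= inner x g & `|enorm x - rho| <= X]].

Lemma sector_piece_closed g rho X Y : closed (sector_piece g rho X Y).
Proof.
rewrite (_ : sector_piece _ _ _ _ = [set x : plane R | `|cross x g| <= Y] `&`
   [set x : plane R | `|cross x g| - inner x g <= 0] `&`
   [set x : plane R | `|enorm x - rho| <= X]); last first.
  apply/seteqP; split => x /=; first by case=> h1 h2 h3; rewrite subr_le0.
  by rewrite subr_le0 => -[[h1 h2] h3].
have c1 : continuous (fun x : plane R => `|cross x g|).
  by move=> x; apply: cvg_norm; exact: continuous_crossl.
apply: closedI; first apply: closedI; apply: closed_le_plane.
- exact: c1.
- by move=> x; apply: cvgB; [exact: c1|exact: continuous_innerl].
- by move=> x; apply: cvg_norm; apply: cvgB; [exact: continuous_enorm|exact: cvg_cst].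
Qed.

(** The piece for [g = (0, 1)], whose slices along [g] are sections over the first coordinate. *)
Definition polar_piece (rho X Y : R) : set (plane R) :=
  [set x | [/\ `|x.1| <= Y, `|x.1| <= x.2 & `|enorm x - rho| <= X]].

Lemma polar_piece_measurable rho X Y :
  measurable (polar_piece rho X Y : set (mplane R)).
Proof.
apply: closed_plane_measurable; rewrite (_ : polar_piece _ _ _ = sector_piece (0, 1) rho X Y).
  exact: sector_piece_closed.
apply/funext => x; rewrite /polar_piece /sector_piece /mkset.
have -> : inner x (0, 1) = x.2 by rewrite /inner /=; ring.
by have -> : cross x (0, 1) = x.1 by rewrite /cross /=; ring.
Qed.

(** If [p], [q] are the norms of the two points, then [(p - q)(p + q) = (a - b)(a + b)], where
    [p + q <= 2 (a + b)] in the sector and [p - q <= 2 X]. *)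
Lemma polar_piece_slice rho X Y (v a b : R) :
  polar_piece rho X Y (v, a) -> polar_piece rho X Y (v, b) -> a - b <= 4 * X.
Proof.
move=> [/= _ va ea] [/= _ vb eb].
have E c : `|v| <= c -> enorm (v, c) <= 2 * c.
  move=> vc; have c0 := le_trans (normr_ge0 _) vc.
  rewrite -ler_sqr ?nnegrE ?enorm_ge0 ?mulr_ge0// enorm_sqr /inner /= -expr2.
  by rewrite -(real_normK (num_real v)); have := normr_ge0 v; nra.
have Da := E _ va; have Db := E _ vb.
have sa := enorm_sqr (v, a); have sb := enorm_sqr (v, b).
rewrite /inner /= in sa sb.
have ea0 := enorm_ge0 (v, a); have eb0 := enorm_ge0 (v, b).
have a0 := le_trans (normr_ge0 _) va; have b0 := le_trans (normr_ge0 _) vb.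
have D : enorm (v, a) - enorm (v, b) <= 2 * X.
  by move: ea eb; rewrite !ler_norml => /andP[? ?] /andP[? ?]; lra.
have X0 := le_trans (normr_ge0 _) ea.
move: D sa sb ea0 eb0 Da Db; clear ea eb va vb E.
move: (enorm (v, a)) (enorm (v, b)) => p q D sa sb p0 q0 Dp Dq.
have [ab|ab] := leP (a + b) 0; first by lra.
rewrite leNgt; apply/negP => h.
have h1 : (p - q) * (p + q) = (a - b) * (a + b) by nra.
have h2 : (p - q) * (p + q) <= 2 * X * (2 * a + 2 * b).
  apply: (@le_trans _ _ (2 * X * (p + q))); first by apply: ler_wpM2r; lra.
  apply: ler_wpM2l; lra.
have : 4 * X * (a + b) < (a - b) * (a + b) by rewrite ltr_pM2r.
lra.
Qed.

(** The points of a slice lie within [4 * X] of any one of them, hence in an interval of length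
    [8 * X]; the slices range over an interval of length [2 * Y]. *)
Lemma polar_piece_measure rho X Y : 0 <= X -> 0 <= Y ->
  (pleb (polar_piece rho X Y) <= (16 * X * Y)%:E)%E.
Proof.
move=> X0 Y0; set T := polar_piece rho X Y.
have mT : measurable (T : set (mplane R)) := polar_piece_measurable rho X Y.
pose I : set (measurableTypeR R) := `[(- Y)%R, Y]%classic.
have mI : measurable I by exact: measurable_itv.
have le_slice v : (@lebesgue_measure R (xsection T v) <= ((cst (8 * X)%:E) \_ I) v)%E.
  have [Ta|T0] := pselect (exists a, T (v, a)); last first.
    rewrite (_ : xsection T v = set0) ?measure0.
      by rewrite patchE; case: ifP => // _; rewrite lee_fin mulr_ge0.
    apply/seteqP; split => // a /xsectionP h; apply: T0; by exists a.
  have [a {}Ta] := Ta.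
  have Iv : v \in I.
    apply/mem_set; rewrite /I /= in_itv /= -ler_norml; by case: Ta.
  rewrite patchE Iv /=.
  pose W : set (measurableTypeR R) := `[(a - 4 * X)%R, (a + 4 * X)%R]%classic.
  apply: (@le_trans _ _ (lebesgue_measure W)).
    apply: le_measure; rewrite ?inE.
    - exact: measurable_xsection.
    - exact: measurable_itv.
    - move=> b /xsectionP Tb; rewrite /W /= in_itv /=.
      have := polar_piece_slice Ta Tb; have := polar_piece_slice Tb Ta => h1 h2.
      by apply/andP; split; lra.
  rewrite /W lebesgue_measure_itv /= lte_fin; case: ifP => _; last by rewrite lee_fin mulr_ge0.
  by rewrite -EFinB lee_fin; lra.
rewrite /plane_measure [leLHS]/(product_measure1 _ _ _).
apply: (@le_trans _ _ (\int[@lebesgue_measure R]_x ((cst (8 * X)%:E) \_ I) x)%E).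
  apply: ge0_le_integral => //.
  - exact: measurable_fun_xsection.
  - by apply/(measurable_restrictT _ mI); exact: measurable_cst.
  - by move=> v _; exact: le_slice.
rewrite -integral_mkcond integral_cst//.
have mIY : (@lebesgue_measure R I <= (2 * Y)%:E)%E.
  rewrite /I lebesgue_measure_itv /= lte_fin.
  case: ifP => _; last by rewrite lee_fin mulr_ge0.
  by rewrite -EFinB lee_fin; lra.
have X8 : (0 <= (8 * X)%:E)%E by rewrite lee_fin mulr_ge0.
apply: le_trans (lee_wpmul2l X8 mIY) _.
by rewrite -EFinM lee_fin; lra.
Qed.

(** For a unit vector [g], the reflection exchanging [(0, 1)] and [g]; it reduces a sector in any
    direction to [polar_piece]. *)
Definition reflection g : 'M[R]_2 :=
  \matrix_(i, j) (if i == 0 then if j == 0 then - g.2 else g.1 else if j == 0 then g.1 else g.2).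

Lemma mx_act_reflection g x :
  mx_act (reflection g) x = (- g.2 * x.1 + g.1 * x.2, g.1 * x.1 + g.2 * x.2).
Proof. by rewrite /mx_act !mxE. Qed.

Lemma sector_piece_measure g rho X Y : inner g g = 1 -> 0 <= X -> 0 <= Y ->
  measurable (sector_piece g rho X Y : set (mplane R)) /\
  (pleb (sector_piece g rho X Y) <= (16 * X * Y)%:E)%E.
Proof.
move=> gg X0 Y0.
have gg' : g.1 * g.1 + g.2 * g.2 = 1 by [].
have dA : \det (reflection g) = -1 by rewrite det_mx2 !mxE /= -gg'; ring.
have d0 : \det (reflection g) != 0 by rewrite dA oppr_eq0 oner_eq0.
have cov := change_of_variable_mx 0 d0; set A := (fun x => _) in cov.
have AE x : A x = (- g.2 * x.1 + g.1 * x.2, g.1 * x.1 + g.2 * x.2).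
  by rewrite /A mx_act_reflection addr0.
have iA x : inner (A x) g = x.2.
  by rewrite AE /inner /= -[RHS]mulr1 -gg'; ring.
have cA x : cross (A x) g = - x.1.
  by rewrite AE /cross /= -[RHS]mulr1 -gg'; ring.
have eA x : enorm (A x) = enorm x.
  by rewrite /enorm; congr Num.sqrt; rewrite AE /inner /= -[RHS]mulr1 -gg'; ring.
have EA : A @^-1` (sector_piece g rho X Y) = polar_piece rho X Y.
  by apply/funext => x; rewrite /preimage /mkset /sector_piece /polar_piece /mkset iA cA eA normrN.
have mS : measurable (sector_piece g rho X Y : set (mplane R)).
  by apply: closed_plane_measurable; exact: sector_piece_closed.
split=> //; rewrite -(change_of_variable_measure cov mS) dA normrN1 mul1e [X in pleb X]EA.
exact: polar_piece_measure.
Qed.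

(** The four sectors of half-opening [pi/4] about the directions [f], [-f] and their normals fill
    the plane. In those about the normals, [|inner x f| < |cross x f| <= Y], so the same width [Y]
    serves. *)
Lemma sector_pieces_cover f x rho X Y : inner f f = 1 ->
  `|enorm x - rho| <= X -> `|cross x f| <= Y ->
  exists2 g : plane R, g \in [:: f; - f; (f.2, - f.1); (- f.2, f.1)] &
    sector_piece g rho X Y x.
Proof.
move=> ff hX hY; have [h|h] := leP `|cross x f| `|inner x f|.
  have [i0|i0] := leP 0 (inner x f).
    exists f; first by rewrite inE eqxx.
    by split=> //; rewrite -[leRHS]ger0_norm.
  exists (- f); first by rewrite !inE eqxx orbT.
  have i : inner x (- f) = - inner x f by rewrite /inner /=; ring.
  have c : cross x (- f) = - cross x f by rewrite /cross /=; ring.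
  by split=> //; rewrite c normrN// i -[leRHS]ltr0_norm.
have [c0|c0] := leP 0 (cross x f).
  exists (f.2, - f.1); first by rewrite !inE eqxx !orbT.
  have i : inner x (f.2, - f.1) = cross x f by rewrite /inner /cross /=; ring.
  have c : cross x (f.2, - f.1) = - inner x f by rewrite /inner /cross /=; ring.
  split=> //; rewrite c normrN; first exact: ltW (lt_le_trans h hY).
  by rewrite i -[leRHS]ger0_norm// ltW.
exists (- f.2, f.1); first by rewrite !inE eqxx !orbT.
have i : inner x (- f.2, f.1) = - cross x f by rewrite /inner /cross /=; ring.
have c : cross x (- f.2, f.1) = inner x f by rewrite /inner /cross /=; ring.
split=> //; rewrite c; first exact: ltW (lt_le_trans h hY).
by rewrite i -[leRHS]ltr0_norm// ltW.
Qed.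

Lemma card_neighbors_le (J : choiceType) (P : J -> set (plane R)) (N : nat) (j : J) (s : seq J) :
  (neighbors P j #<= `I_N)%card -> uniq s -> (forall l, l \in s -> neighbors P j l) ->
  (size s <= N)%N.
Proof.
move=> cN us sN.
apply: leq_trans (geq_card_fset_set cN); apply: uniq_leq_size => // l ls.
by rewrite in_fset_set ?inE; [exact: sN|apply/finite_set_leP; exists N].
Qed.

(** The sets containing a given point are all neighbors of one of them, so at most [N] of them
    overlap there. Integrating the sum of their indicators bounds the total area by [N] times that
    of four pieces, [4 * 16 = 64]. *)
Lemma sector_count (J : choiceType) (P : J -> set (plane R)) (N : nat) f (rho X Y m : R)
    (s : seq J) : inner f f = 1 -> 0 <= X -> 0 <= Y -> uniq s ->
  (forall j, open (P j)) -> (forall j, (neighbors P j #<= `I_N)%card) ->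
  (forall j, j \in s -> (m%:E <= pleb (P j))%E /\ forall x, P j x ->
     `|enorm x - rho| <= X /\ `|cross x f| <= Y) ->
  (size s)%:R * m <= N%:R * (64 * X * Y).
Proof.
move=> ff X0 Y0 us oP cN Hs.
pose gs := [:: f; - f; (f.2, - f.1); (- f.2, f.1)].
have gu g : g \in gs -> inner g g = 1.
  by rewrite !inE => /or4P[] /eqP->; rewrite -ff /inner /=; ring.
have mP j : measurable (P j : set (mplane R)) by apply: open_plane_measurable.
pose iP j : mplane R -> \bar R := EFin \o (\1_(P j) : mplane R -> R).
pose iS g : mplane R -> \bar R := EFin \o (\1_(sector_piece g rho X Y) : mplane R -> R).
have iPE j : (\int[pleb]_x iP j x = pleb (P j))%E.
  by rewrite [LHS](integral_indic _ measurableT (mP j)) setIT.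
have iSE g : g \in gs -> (\int[pleb]_x iS g x <= (16 * X * Y)%:E)%E.
  move=> gg; have [mS lS] := sector_piece_measure rho (gu g gg) X0 Y0.
  by rewrite [leLHS](integral_indic _ measurableT mS) setIT.
have miP j : measurable_fun [set: mplane R] (iP j).
  by apply/measurable_EFinP; exact: measurable_indic.
have iP0 j x : (0 <= iP j x)%E by rewrite lee_fin.
have iS0 g x : (0 <= iS g x)%E by rewrite lee_fin.
have miS g : measurable_fun [set: mplane R] (iS g).
  apply/measurable_EFinP; apply: measurable_indic.
  by apply: closed_plane_measurable; exact: sector_piece_closed.
have key x : (\sum_(j <- s) iP j x <= N%:R%:E * \sum_(g <- gs) iS g x)%E.
  rewrite /iP /iS /= !sumEFin -EFinM lee_fin.
  have -> : \sum_(j <- s) (\1_(P j) x : R) = (size [seq j <- s | x \in P j])%:R.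
    rewrite size_filter -sum1_count natr_sum [RHS]big_mkcond /=; apply: eq_bigr => j _.
    by rewrite indicE; case: (x \in P j).
  case E : [seq j <- s | x \in P j] => [|j0 l].
    by rewrite mulr_ge0// sumr_ge0.
  have j0s : (j0 \in s) && (x \in P j0).
    by have := mem_head j0 l; rewrite -E mem_filter andbC.
  have sz : (size (j0 :: l) <= N)%N.
    rewrite -E; apply: (card_neighbors_le (cN j0)); first exact: filter_uniq.
    move=> j; rewrite mem_filter => /andP[/set_mem xj _]; exists x; split=> //.
    by apply/set_mem; case/andP: j0s.
  apply: (@le_trans _ _ N%:R); first by rewrite ler_nat.
  rewrite -[leLHS]mulr1; apply: ler_wpM2l => //.
  have [j0' xj0] := andP j0s; have [_ /(_ x)] := Hs _ j0'; move/set_mem: xj0 => xj0 /(_ xj0)[h1 h2].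
  have [g gg Sg] := sector_pieces_cover ff h1 h2.
  rewrite (big_rem g gg) /= indicE (mem_set Sg) lerDl sumr_ge0//.
have : (\sum_(j <- s) pleb (P j) <= N%:R%:E * (64 * X * Y)%:E)%E.
  rewrite -(eq_bigr _ (fun j _ => iPE j)) -ge0_integral_sum//.
  have msum : measurable_fun [set: mplane R] (fun x => \sum_(g <- gs) iS g x)%E.
    exact: emeasurable_sum.
  have sum0 (x : mplane R) : (0 <= \sum_(g <- gs) iS g x)%E by apply: sume_ge0.
  apply: (@le_trans _ _ (\int[pleb]_x (N%:R%:E * \sum_(g <- gs) iS g x))%E).
    apply: ge0_le_integral => //.
    - by move=> x _; apply: sume_ge0.
    - exact: emeasurable_sum.
    - exact: emeasurable_funM.
  rewrite ge0_integralZl_EFin//; apply: lee_wpmul2l; first by rewrite lee_fin.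
  rewrite ge0_integral_sum// big_seq; apply: (le_trans (lee_sum _ iSE)).
  rewrite -big_seq /gs !big_cons big_nil -!EFinD lee_fin; lra.
have : (\sum_(j <- s) m%:E <= \sum_(j <- s) pleb (P j))%E.
  by rewrite big_seq [leRHS]big_seq; apply: lee_sum => j /Hs[].
move=> /le_trans h /h; rewrite sumEFin -EFinM lee_fin big_const_seq count_predT.
by rewrite iter_addr_0 -[m *+ _]mulr_natl.
Qed.

End Counting.

(** * Sets of one covering that meet a set of the other *)

Section CoveringPairs.
Context {R : realType}.
Implicit Types (x y z f : plane R).

Lemma polar_controlled_mono alpha beta (C D : R) A f : C <= D ->
  polar_controlled alpha beta C A f -> polar_controlled alpha beta D A f.
Proof.
move=> CD [ff H]; split=> // x Ax; have [h1 h2] := H x Ax.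
have p (a : R) : C * (1 + enorm x) `^ a <= D * (1 + enorm x) `^ a by rewrite ler_wpM2r ?powR_ge0.
by split=> [y Ay|]; [apply: le_trans (h1 y Ay) _|apply: le_trans h2 _].
Qed.

(** All sizes are expressed by one reference point [x0] of [Q i] and one direction [f]. The lower
    bound for the area of [P j] holds at a common point of the two sets and is moved to [x0] by the
    comparability of norms. *)
Lemma covering_pair (I J : choiceType) (Q : I -> set (plane R)) (P : J -> set (plane R))
    (alpha beta : R) : 0 <= alpha <= 1 -> 0 <= beta <= 1 ->
  alpha_beta_covering alpha beta Q -> alpha_beta_covering alpha beta P ->
  exists2 K : R, 0 < K & forall i x0, Q i x0 -> exists2 f, inner f f = 1 &
    let near x := `|enorm x - enorm x0| <= K * (1 + enorm x0) `^ alpha /\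
      `|cross x f| <= K * (1 + enorm x0) `^ beta in
    (forall x, Q i x -> near x) /\
    forall j, P j `&` Q i !=set0 -> (forall x, P j x -> near x) /\
      (((1 + enorm x0) `^ alpha * (1 + enorm x0) `^ beta)%:E <= K%:E * pleb (P j))%E.
Proof.
move=> ha hb hQ hP.
have [C1 C10 H1] := covering_polar hQ; have [C2 C20 H2] := covering_polar hP.
have [_ _ [C3 C30 H3] _ _] := hP.
pose C := C1 + C2; have C0 : 0 < C by exact: addr_gt0.
have pc0 : 0 <= polar_constant C by rewrite /polar_constant mulr_ge0 ?sqr_ge0//; lra.
have s0 : 0 < (1 + C) ^+ 2 * C3 by rewrite mulr_gt0// exprn_gt0//; lra.
pose K := polar_constant C + (1 + C) ^+ 2 * C3.
have KC : polar_constant C <= K by rewrite lerDl ltW.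
exists K; first by rewrite /K; lra.
move=> i x0 Qx0; have [f hf] := H1 i.
have {}hf : polar_controlled alpha beta C (Q i) f by apply: polar_controlled_mono hf; rewrite lerDl ltW.
have up x : `|enorm x - enorm x0| <= polar_constant C * (1 + enorm x0) `^ alpha /\
      `|cross x f| <= polar_constant C * (1 + enorm x0) `^ beta ->
    `|enorm x - enorm x0| <= K * (1 + enorm x0) `^ alpha /\
      `|cross x f| <= K * (1 + enorm x0) `^ beta.
  by move=> [h1 h2]; split; [apply: le_trans h1 _|apply: le_trans h2 _]; rewrite ler_wpM2r ?powR_ge0.
exists f; first by case: hf.
split=> [x Qx|j [z [Pz Qz]]].
  apply: up; apply: (polar_controlled_meet C0 ha hb hf hf _ Qx0 Qx).
  by exists x0.
have [g hg] := H2 j.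
have {}hg : polar_controlled alpha beta C (P j) g by apply: polar_controlled_mono hg; rewrite lerDr ltW.
split=> [x Px|].
  by apply: up; apply: (polar_controlled_meet C0 ha hb hf hg _ Qx0 Px); exists z.
have [_ hz] := H3 j z Pz.
have ez := enorm_ge0 z; have ex0 := enorm_ge0 x0.
have x0z := polar_controlled_enorm C0 ha hf Qz Qx0.
have pa : (1 + enorm x0) `^ alpha <= (1 + C) * (1 + enorm z) `^ alpha.
  by apply: powR_moderate => //; lra.
have pb : (1 + enorm x0) `^ beta <= (1 + C) * (1 + enorm z) `^ beta.
  by apply: powR_moderate => //; lra.
have pm0 : (0 <= pleb (P j))%E by exact: measure_ge0.
apply: (@le_trans _ _ (((1 + C) ^+ 2 * C3)%:E * pleb (P j))%E); last first.
  by apply: lee_wpmul2r => //; rewrite lee_fin /K lerDr.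
rewrite (EFinM (_ ^+ 2)) -muleA.
have c2 : (0 <= ((1 + C) ^+ 2)%:E)%E by rewrite lee_fin sqr_ge0.
apply: le_trans (lee_wpmul2l c2 hz); rewrite -EFinM lee_fin.
rewrite powRD; last by apply/implyP => _; rewrite gt_eqF//; lra.
have := ler_pM (powR_ge0 _ _) (powR_ge0 _ _) pa pb; rewrite expr2; lra.
Qed.

(** A repetition-free sequence in [A] of maximal length exhausts [A]. *)
Lemma bounded_uniq_seq (J : choiceType) (A : set J) (n : nat) :
  (forall s, uniq s -> (forall j, j \in s -> A j) -> (size s <= n)%N) ->
  exists s : seq J, [/\ uniq s, (size s <= n)%N & forall j, j \in s <-> A j].
Proof.
move=> H.
pose p k := `[< exists s : seq J, [/\ uniq s, forall j, j \in s -> A j & size s = k] >].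
have p0 : exists k, p k by exists 0%N; apply/asboolP; exists [::].
have pn k : p k -> (k <= n)%N by move=> /asboolP[s [us sA <-]]; exact: H.
have [k /asboolP[s [us sA sk]] kmax] := ex_maxnP p0 pn.
exists s; split=> //; first exact: H.
move=> j; split=> [/sA//|Aj]; apply: contrapT => /negP js.
have : p k.+1.
  apply/asboolP; exists (j :: s); split=> /=; [by rewrite js|move=> l|by rewrite sk].
  by rewrite inE => /orP[/eqP->|/sA].
by move=> /kmax; rewrite ltnn.
Qed.

(** With [u], [v] the powers of [1 + enorm x0], each [P j] has area at least [u v / K] and all lie
    in sectors of area [O(K^2 u v)]. The product [u v] cancels, leaving [64 N K^3]. *)
Lemma covering_count (I J : choiceType) (Q : I -> set (plane R)) (P : J -> set (plane R))
    (alpha beta : R) : 0 <= alpha <= 1 -> 0 <= beta <= 1 ->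
  alpha_beta_covering alpha beta Q -> alpha_beta_covering alpha beta P ->
  exists n : nat, forall i, exists s : seq J,
    [/\ uniq s, (size s <= n)%N & forall j, j \in s <-> P j `&` Q i !=set0].
Proof.
move=> ha hb hQ hP; have [K K0 HK] := covering_pair ha hb hQ hP.
have [oP [_ [N HN]] _ _ _] := hP.
pose B := N%:R * (64 * K * K) * K.
exists (Num.bound B) => i; apply: bounded_uniq_seq => s us sP.
have [[x0 Qx0]|Q0] := pselect (Q i !=set0); last first.
  case: s {us} sP => [//|j l] /(_ j (mem_head _ _)) [z [_ Qz]].
  by case: Q0; exists z.
have [f ff [_ Hf]] := HK i x0 Qx0.
have r0 : 0 < 1 + enorm x0 by have := enorm_ge0 x0; lra.
move: Hf; set u := _ `^ alpha; set v := _ `^ beta => Hf.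
have u0 : 0 < u by exact: powR_gt0.
have v0 : 0 < v by exact: powR_gt0.
have X0 : 0 <= K * u by rewrite mulr_ge0 ?ltW.
have Y0 : 0 <= K * v by rewrite mulr_ge0 ?ltW.
have := @sector_count R J P N f (enorm x0) (K * u) (K * v) (K^-1 * (u * v)) s ff X0 Y0 us
  (fun j => (oP j).1) HN.
have H j : j \in s -> ((K^-1 * (u * v))%:E <= pleb (P j))%E /\ forall x, P j x ->
    `|enorm x - enorm x0| <= K * u /\ `|cross x f| <= K * v.
  move=> /sP /Hf[h1 h2]; split=> //.
  by rewrite EFinM lee_pdivrMl.
move=> /(_ H) h.
have : (size s)%:R <= B.
  have uv : 0 < K^-1 * (u * v) by rewrite !mulr_gt0 ?invr_gt0.
  rewrite -(ler_pM2r uv); apply: le_trans h _.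
  rewrite /B le_eqVlt; apply/orP; left; apply/eqP; field; exact: lt0r_neq0.
move=> /le_lt_trans h'; rewrite -(ler_nat R) ltW//; apply: h'; apply: archi_boundP.
by rewrite /B !mulr_ge0// ltW.
Qed.

End CoveringPairs.

(** * Lattices separating opposite rectangles *)

Section Lattices.
Context {R : realType}.
Implicit Types (x y z f : plane R).

(** Two intervals of radius [X] about [rho] and [- rho] are met again after a translation only if
    its length is within [2 * X] of [0], [2 * rho] or [- 2 * rho]. The step [a] must avoid these and
    still be [O(X)], however large [rho] is. *)
Lemma sparse_progression (rho X : R) : 0 <= rho -> 0 < X -> exists2 a : R, 0 < a <= 30 * X &
  forall k : int, k != 0 ->
    [/\ 2 * X < `|k%:~R * a|, 2 * X < `|k%:~R * a - 2 * rho| & 2 * X < `|k%:~R * a + 2 * rho|].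
Proof.
move=> r0 X0.
have k1 (k : int) : k != 0 -> 1 <= `|k%:~R : R|.
  exact: norm_intr_ge1.
have big (k : int) (a : R) : 0 < a -> k != 0 -> a <= `|k%:~R * a|.
  by move=> a0 /k1 h; rewrite normrM (gtr0_norm a0) -[leLHS]mul1r; apply: ler_wpM2r; [exact: ltW|]; exact: h.
have [h|h] := leP rho (10 * X).
  (* Here [2 * rho + 2 * X <= 22 * X], so already the first step is long enough. *)
  exists (30 * X); first by apply/andP; split; lra.
  have X30 : 0 < 30 * X by lra.
  move=> k /(big k _ X30) H.
  split; first lra.
    apply: lt_le_trans (lerB_dist _ _); rewrite (ger0_norm (_ : 0 <= 2 * rho)); lra.
  rewrite -[X in _ + X]opprK; apply: lt_le_trans (lerB_dist _ _); rewrite normrN (ger0_norm (_ : 0 <= 2 * rho)); lra.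
(* For large [rho], the step is chosen so that [2 * rho] is [m + 1/2] steps, hence at least half a
   step from every multiple of [a]. With [m] the integer part of [s], at least [2], the step lies
   between [8 * X] and [30 * X], so half a step exceeds [2 * X]. *)
pose s := rho / (5 * X).
have s2 : 2 < s by rewrite /s ltr_pdivlMr; lra.
pose m := Num.truncn s.
have /andP[ms sm] : m%:R <= s < m.+1%:R by apply: truncn_itv; lra.
have m2 : (2 <= m)%N by rewrite /m -ltnS -(ltr_nat R); apply: lt_trans sm; exact: s2.
have m2' : 2 <= m%:R :> R by rewrite (ler_nat R 2).
have d0 : 0 < m%:R + 2^-1 :> R by lra.
pose a := 2 * rho / (m%:R + 2^-1).
have aE : a * (m%:R + 2^-1) = 2 * rho by rewrite /a divfK// gt_eqF.
have sE : s * (5 * X) = rho by rewrite /s divfK// gt_eqF//; lra.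
have a8 : 8 * X <= a by rewrite /a ler_pdivlMr//; nra.
have a0 : 0 < a by lra.
have a30 : a <= 30 * X.
  rewrite /a ler_pdivrMr//; move: sm; rewrite -natr1 => sm; nra.
exists a; first by rewrite a0.
have half (k : int) : 2^-1 <= `|k%:~R - (m%:R + 2^-1) : R|.
  have [h1|h1] := leP k m.
    have h2 : k%:~R <= m%:R :> R by rewrite pmulrn ler_int.
    rewrite ler0_norm; lra.
  have h2 : m%:R + 1 <= k%:~R :> R by rewrite natr1 pmulrn ler_int intS lez1D.
  rewrite ger0_norm; lra.
move=> k k0; split.
- by have := big k a a0 k0; lra.
- have -> : k%:~R * a - 2 * rho = (k%:~R - (m%:R + 2^-1)) * a by rewrite -aE; ring.
  rewrite normrM (gtr0_norm a0); apply: (@lt_le_trans _ _ (2^-1 * a)); first lra.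
  by rewrite ler_pM2r.
- have -> : k%:~R * a + 2 * rho = - (((- k)%:~R - (m%:R + 2^-1)) * a) by rewrite -aE rmorphN /=; ring.
  rewrite normrN normrM (gtr0_norm a0); apply: (@lt_le_trans _ _ (2^-1 * a)); first lra.
  by rewrite ler_pM2r.
Qed.

(** The columns are [a] times [f] and [b] times its normal [(f.2, - f.1)], so that the lattice is
    rectangular in the coordinates [inner] and [cross]. *)
Definition frame_mx f (a b : R) : 'M[R]_2 :=
  \matrix_(i, j) (if i == 0 then if j == 0 then a * f.1 else b * f.2
                  else if j == 0 then a * f.2 else - b * f.1).

Lemma frame_mxE f a b (k l : R) : inner f f = 1 ->
  [/\ \det (frame_mx f a b) = - (a * b),
      inner (mx_act (frame_mx f a b) (k, l)) f = k * a &
      cross (mx_act (frame_mx f a b) (k, l)) f = l * b].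
Proof.
rewrite /inner => ff; rewrite det_mx2 /mx_act /cross !mxE /=; split.
- by rewrite -[RHS]mulr1 -ff; ring.
- by rewrite -[RHS]mulr1 -ff; ring.
- by rewrite -[RHS]mulr1 -ff; ring.
Qed.

Definition double_rectangle f (rho X Y : R) : set (plane R) :=
  [set x | `| `|inner x f| - rho| <= X /\ `|cross x f| <= Y].

Lemma double_rectangle_closed f rho X Y : closed (double_rectangle f rho X Y).
Proof.
apply: (@closedI _ [set x | `| `|inner x f| - rho| <= X] [set x | `|cross x f| <= Y]);
  apply: closed_le_plane => x; apply: cvg_norm.
  by apply: cvgB; [apply: cvg_norm; exact: continuous_innerl|exact: cvg_cst].
exact: continuous_crossl.
Qed.

Lemma double_rectangle_box f rho X Y : inner f f = 1 -> 0 <= rho ->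
  double_rectangle f rho X Y `<=` box (rho + X + Y).
Proof.
move=> ff r0 x [h1 h2]; apply: (enorm_le_box ff _ h2).
by move: h1; rewrite ler_norml => /andP[? ?]; lra.
Qed.

(** Across [f], the step [3 * Y] exceeds the width [2 * Y] and forces [l = 0]; along [f],
    [sparse_progression] excludes [k != 0]. The covolume is at most [30 * 3] times [X * Y]. *)
Lemma double_rectangle_lattice f (rho X Y : R) : inner f f = 1 -> 0 <= rho -> 0 < X -> 0 < Y ->
  exists M : 'M[R]_2, [/\ \det M != 0, `|\det M| <= 90 * X * Y &
    forall x (k l : int), double_rectangle f rho X Y x -> (k, l) != (0, 0) ->
      ~ double_rectangle f rho X Y (mx_act M (k%:~R, l%:~R) + x)].
Proof.
move=> ff r0 X0 Y0; have [a /andP[a0 aX] Ha] := sparse_progression r0 X0.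
exists (frame_mx f a (3 * Y)).
have [dE _ _] := frame_mxE a (3 * Y) 0 0 ff.
split.
- by rewrite dE oppr_eq0 mulf_neq0 ?gt_eqF ?mulr_gt0.
- rewrite dE normrN ger0_norm; last by rewrite !mulr_ge0 ?ltW.
  by rewrite mulrA mulrC; have := ler_wpM2r (ltW Y0) aX; lra.
move=> x k l [ux vx] kl0 [].
have [_ iM cM] := frame_mxE a (3 * Y) k%:~R l%:~R ff.
have iD z : inner (z + x) f = inner z f + inner x f by rewrite /inner /=; ring.
have cD z : cross (z + x) f = cross z f + cross x f by rewrite /cross /=; ring.
rewrite iD cD iM cM; move: ux vx; move: (inner x f) (cross x f) => u v hu hv hu' hv'.
have l0 : l = 0.
  apply/eqP; apply: contraT => /(@norm_intr_ge1 R) l1.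
  have : `|l%:~R * (3 * Y)| <= 2 * Y.
    rewrite (_ : _ * _ = l%:~R * (3 * Y) + v - v); last by ring.
    by apply: le_trans (ler_normB _ _) _; lra.
  rewrite normrM (gtr0_norm (_ : 0 < 3 * Y)); last lra.
  nra.
have k0 : k != 0 by apply: contra_neq kl0 => ->; rewrite l0.
have [] := Ha _ k0; move: hu hu'; move: (k%:~R * a) => c; clear - r0 X0.
have abs (t s : R) : `|t| <= s -> - s <= t <= s by rewrite ler_norml.
have absl (t s : R) : s < `|t| -> s < t \/ s < - t.
  by move=> h; have [t0|t0] := leP 0 t; [left; rewrite -(ger0_norm t0)|right; rewrite -(ltr0_norm t0)].
move=> /abs/andP[h1 h2] /abs/andP[h3 h4] /absl h5 /absl h6 /absl h7.
(* If [u] and [c + u] have the same sign, [c] is within [2 * X] of [0]; otherwise it is within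
   [2 * X] of [2 * rho] or [- 2 * rho], according to the direction in which the rectangles are
   exchanged. *)
have [u0|u0] := leP 0 u; have [w0|w0] := leP 0 (c + u).
- by rewrite (ger0_norm u0) in h1 h2; rewrite (ger0_norm w0) in h3 h4; case: h5 => h; lra.
- by rewrite (ger0_norm u0) in h1 h2; rewrite (ltr0_norm w0) in h3 h4; case: h7 => h; lra.
- by rewrite (ltr0_norm u0) in h1 h2; rewrite (ger0_norm w0) in h3 h4; case: h6 => h; lra.
- by rewrite (ltr0_norm u0) in h1 h2; rewrite (ltr0_norm w0) in h3 h4; case: h5 => h; lra.
Qed.

(** Each [P j] is an affine image of a subset of one fixed square; the summand [1] keeps the
    constant positive. *)
Lemma semi_structured_measure (J : choiceType) (P : J -> set (plane R))
    (S : J -> 'M[R]_2) (c : J -> plane R) :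
  (forall j, open (P j)) -> semi_structured P S c ->
  exists2 C : R, 0 < C & forall j, \det (S j) != 0 /\ (pleb (P j) <= (C * `|\det (S j)|)%:E)%E.
Proof.
move=> oP [_ uS [P' [_ [rho Hrho] PE]] _].
pose r := `|rho|; have r0 : 0 <= r by exact: normr_ge0.
exists ((2 * r) ^+ 2 + 1); first by rewrite ltr_wpDl// sqr_ge0.
move=> j; have d0 : \det (S j) != 0 by have := uS j; rewrite unitmxE unitfE.
split=> //; have cov := change_of_variable_mx (c j) d0.
have mP : measurable (P j : set (mplane R)) by apply: open_plane_measurable.
rewrite -(change_of_variable_measure cov mP) mulrC EFinM; apply: lee_wpmul2l; first by rewrite lee_fin.
apply: (@le_trans _ _ (pleb (box r))); last by rewrite box_measure// lee_fin lerDl.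
apply: le_measure; rewrite ?inE; [|exact: box_measurable|].
  by rewrite -[X in measurable X]setTI; exact: cov.1.
move=> x; rewrite /preimage /mkset => Pjx.
move: Pjx; rewrite PE => -[y P'y] /addIr E.
have {E} <- : y = x by rewrite -(mx_actK y (uS j)) E mx_actK.
have e := le_trans (Hrho _ _ P'y) (ler_norm rho).
have [h1 h2] : `|y.1| <= enorm y /\ `|y.2| <= enorm y.
  by split; apply: ler_sqr_norm (enorm_ge0 _) _; rewrite enorm_sqr /inner -!expr2 ?lerDl ?lerDr ?sqr_ge0.
by split; [apply: le_trans h1 e|apply: le_trans h2 e].
Qed.

End Lattices.

(** * Multiplier bounds uniform in the indices *)

Section UniformMultipliers.
Context {R : realType} {I J : choiceType}.
Implicit Types (Q : I -> set (plane R)) (P : J -> set (plane R)).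
Implicit Types (phi : I -> plane R -> R[i]) (psi : J -> plane R -> R[i]).

Lemma ereal_sup_range_bound (T : Type) (u : T -> \bar R) :
  (ereal_sup (range u) < +oo)%E -> exists2 D : R, 0 < D & forall i, (u i <= D%:E)%E.
Proof.
move=> h.
have ub i : (u i <= ereal_sup (range u))%E by apply: ereal_sup_ubound; exists i.
case E : (ereal_sup _) h => [r||]// _.
  exists (`|r| + 1); first by rewrite ltr_wpDl.
  by move=> i; apply: le_trans (ub i) _; rewrite E lee_fin; have := ler_norm r; lra.
by exists 1 => // i; apply: le_trans (ub i) _; rewrite E leNye.
Qed.

(** A square lattice whose spacing exceeds the sizes of both supports. Its covolume varies with the
    supports, which is harmless when it enters with the exponent [1 - t = 0]. *)
Lemma diagonal_lattice (a b : R) : exists M : 'M[R]_2, \det M != 0 /\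
  forall x (k l : int), box a x -> (k, l) != (0, 0) ->
    ~ box b (mx_act M (k%:~R, l%:~R) + x).
Proof.
pose c := `|a| + `|b| + 1; have c0 : 0 < c by rewrite ltr_wpDl// addr_ge0.
exists c%:M; split; first by rewrite det_scalar expf_neq0// gt_eqF.
have far (k : int) (t : R) : k != 0 -> `|t| <= a -> ~ `|c * k%:~R + t| <= b.
  move=> /(@norm_intr_ge1 R) k1 ta tb.
  have : `|c * k%:~R| <= b + a.
    rewrite (_ : c * _ = (c * k%:~R + t) - t); last by rewrite addrK.
    by apply: le_trans (ler_normB _ _) _; exact: lerD.
  rewrite normrM (gtr0_norm c0) => h.
  have : c <= c * `|k%:~R| by rewrite -[leLHS]mulr1; apply: ler_wpM2l; [exact: ltW|exact: k1].
  have cE : c = `|a| + `|b| + 1 by [].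
  by move=> h1; have := ler_norm a; have := ler_norm b; lra.
move=> x k l [x1 x2] kl; rewrite /mx_act !mxE /= !mulr1n !mulr0n !mul0r addr0 add0r => -[h1 h2].
have [k0|k0] := eqVneq k 0; last exact: (far k x.1 k0 x1 h1).
have l0 : l != 0 by apply: contra_neq kl => ->; rewrite k0.
exact: (far l x.2 l0 x2 h2).
Qed.

Lemma pexp_ge1 (p : \bar R) : (1 <= p)%E -> pexp p = 1.
Proof. by case: p => [r||]//=; rewrite lee_fin => /min_idPr. Qed.

(** The lattice depends on [i] and [j], but for [t = 1] the bound of [Lp_norm_multiplier] is
    [2 * (2 * D)], whatever the lattice. *)
Lemma multiplier_bound_banach (p : \bar R) phi P psi : (1 <= p)%E ->
  (forall i, test_function (phi i)) -> bapu P psi ->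
  exists2 C : R, 0 < C & forall g i j, Zdual g ->
    (Lp_norm p (band g (fun xi => phi i xi * psi j xi)%R) <= C%:E * Lp_norm p (band g (phi i)))%E.
Proof.
move=> p1 tphi [tpsi _ _ /ereal_sup_range_bound[D D0 HD]].
have p0 : (0 < p)%E by exact: lt_le_trans p1.
have HD' j : (\int[pleb]_x (cmod (fourier_inv (psi j) x) `^ pexp p)%:E <= D%:E)%E.
  have := HD j; rewrite /Lp_norm LnormE; last by move=> x; exact: cmod_ge0.
  rewrite invr1 poweRe1; last by apply: integral_ge0 => x _; rewrite lee_fin powR_ge0.
  by rewrite (pexp_ge1 p1).
exists (2 * (2 * D)); first by rewrite !mulr_gt0.
move=> g i j hg.
have /test_functionP[_ [a Ha]] := tphi i; have /test_functionP[_ [b Hb]] := tpsi j.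
have [M [dM avoid]] := diagonal_lattice a b.
have := Lp_norm_multiplier p0 hg dM (@box_closed R a) (@box_closed R b) (@subset_refl _ (box a))
  avoid (tphi i) (tpsi j) Ha Hb D0 (HD' j).
by rewrite (pexp_ge1 p1) subrr powRr0 mul1r invr1 powRr1// mulr_ge0// ltW.
Qed.

(** Solves the normalization of a quasi-BAPU, with [d = |det S_j|], for the integral [N] of
    [|F^-1 psi_j|^p]. *)
Lemma poweR_solve_le (p d D : R) (N : \bar R) : 0 < p -> 0 < d -> (0 <= N)%E ->
  ((d `^ (p^-1 - 1))%:E * N `^ p^-1 <= D%:E)%E -> (N <= (D `^ p * d `^ (p - 1))%:E)%E.
Proof.
move=> p0 d0; case: N => [n||]//.
  rewrite lee_fin => n0; rewrite poweR_EFin -EFinM !lee_fin => h.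
  have l0 : 0 <= d `^ (p^-1 - 1) * n `^ p^-1 by rewrite mulr_ge0 ?powR_ge0.
  have := ge0_ler_powR (ltW p0) (l0 : _ \in Num.nneg) (le_trans l0 h : _ \in Num.nneg) h.
  rewrite powRM ?powR_ge0// -!powRrM mulVf ?gt_eqF// powRr1// mulrBl mulVf ?gt_eqF// mul1r => H.
  have := ler_wpM2r (powR_ge0 d (p - 1)) H; apply: le_trans.
  rewrite mulrAC -powRD; last by apply/implyP => _; rewrite gt_eqF.
  by rewrite (_ : 1 - p + (p - 1) = 0) ?powRr0 ?mul1r//; ring.
move=> _; rewrite poweRyr ?invr_eq0 ?gt_eqF// gt0_muley ?lte_fin ?powR_gt0//.
Qed.

(** The covolume is at most [L * d] with [d = |det S_j|], and the integral of [|F^-1 psi_j|^p] at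
    most [D^p d^(p-1)]; in the multiplier bound the powers [d^(1-p)] and [d^(p-1)] cancel. *)
Lemma multiplier_bound_quasi (p alpha beta : R) Q phi P psi
    (S : J -> 'M[R]_2) (c : J -> plane R) : 0 < p < 1 ->
  0 <= alpha <= 1 -> 0 <= beta <= 1 -> beta <= alpha ->
  alpha_beta_covering alpha beta Q -> alpha_beta_covering alpha beta P ->
  semi_structured P S c ->
  (forall i, test_function (phi i)) -> (forall i x, ~ Q i x -> phi i x = 0) ->
  quasi_bapu p%:E P S psi ->
  exists2 C : R, 0 < C & forall g i j, Zdual g -> P j `&` Q i !=set0 ->
    (Lp_norm p%:E (band g (fun xi => phi i xi * psi j xi)%R) <=
      C%:E * Lp_norm p%:E (band g (phi i)))%E.
Proof.
move=> /andP[p0 p1] ha hb ba hQ hP hS tphi phiQ [[tpsi psiP _ _] /ereal_sup_range_bound[D D0 HD]].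
have [K K0 HK] := covering_pair ha hb hQ hP.
have [oP _ _ _ _] := hP.
have [B B0 HB] := semi_structured_measure (fun j => (oP j).1) hS.
have tE : pexp p%:E = p by rewrite /pexp; apply/min_idPl/ltW.
(* [90 * (2 K u) * (K v)] bounds the covolume, and [u v <= K B d] by comparison with the area of
   [P j]. *)
pose L := 180 * K ^+ 3 * B.
have L0 : 0 < L by rewrite !mulr_gt0// exprn_gt0.
pose E := 2 * (L `^ (1 - p) * D `^ p).
have E0 : 0 < E by rewrite !mulr_gt0// powR_gt0.
exists (2 * E `^ p^-1); first by rewrite mulr_gt0// powR_gt0.
move=> g i j hg PQ; have [x0 [Px0 Qx0]] := PQ.
have [f ff [nQ /(_ j PQ)[nP area]]] := HK i x0 Qx0.
have e0 := enorm_ge0 x0; have r1 : 1 <= 1 + enorm x0 by lra.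
have [dS PS] := HB j; set d := `|\det (S j)| in PS.
have d0 : 0 < d by rewrite normr_gt0.
move: nQ nP area; set u := _ `^ alpha; set v := _ `^ beta => nQ nP area.
have u0 : 0 < u by apply: powR_gt0; lra.
have v0 : 0 < v by apply: powR_gt0; lra.
have vu : v <= u by exact: ler_powR.
have X0 : 0 < 2 * K * u by rewrite !mulr_gt0.
have Y0 : 0 < K * v by rewrite mulr_gt0.
(* The half-length [2 * K * u] is [K * u] for the spread of the norm, plus [K * v <= K * u] for
   replacing the norm by [|inner x f|]; the last inequality is where [beta <= alpha] enters. *)
pose rect := double_rectangle f (enorm x0) (2 * K * u) (K * v).
have rectP x : `|enorm x - enorm x0| <= K * u /\ `|cross x f| <= K * v -> rect x.
  move=> [h1 h2]; split=> //.
  have h3 := inner_near_enorm x ff; have h4 := ler_wpM2l (ltW K0) vu.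
  rewrite (_ : _ - _ = (`|inner x f| - enorm x) + (enorm x - enorm x0)); last by ring.
  by apply: le_trans (ler_normD _ _) _; lra.
have [M [dM Mle avoid]] := double_rectangle_lattice ff e0 X0 Y0.
have ML : `|\det M| <= L * d.
  have : ((u * v)%:E <= (K * (B * d))%:E)%E.
    apply: le_trans area _; rewrite (EFinM K); apply: lee_wpmul2l PS.
    by rewrite lee_fin ltW.
  rewrite lee_fin => uv; apply: le_trans Mle _.
  have K2 : 0 <= 180 * K ^+ 2 by rewrite mulr_ge0 ?sqr_ge0.
  have := ler_wpM2l K2 uv; rewrite /L !exprS expr0; lra.
pose Dj := D `^ p * d `^ (p - 1).
have Dj0 : 0 < Dj by rewrite mulr_gt0// powR_gt0.
have HDj : (\int[pleb]_x (cmod (fourier_inv (psi j) x) `^ pexp p%:E)%:E <= Dj%:E)%E.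
  rewrite tE; have := HD j; rewrite -/d /Lp_norm LnormE; last by move=> x; exact: cmod_ge0.
  have : (0 <= \int[pleb]_x (cmod (fourier_inv (psi j) x) `^ p)%:E)%E.
    by apply: integral_ge0 => x _; rewrite lee_fin powR_ge0.
  by move=> N0 h; exact: poweR_solve_le h.
have := Lp_norm_multiplier (p0 : (0 < p%:E)%E) hg dM (@double_rectangle_closed _ f _ _ _)
  (@double_rectangle_closed _ f _ _ _) (double_rectangle_box ff e0) avoid (tphi i) (tpsi j) _ _ Dj0 HDj.
rewrite tE => H; apply: le_trans (H _ _) _.
- by move=> x nx; apply: phiQ => /nQ/rectP.
- by move=> x nx; apply: psiP => /nP/rectP.
apply: lee_wpmul2r; first exact: Lnorm_ge0.
rewrite lee_fin; apply: ler_wpM2l => //.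
apply: ge0_ler_powR; rewrite ?nnegrE ?invr_ge0 ?(ltW p0) ?(ltW E0)//.
  by rewrite mulr_ge0// mulr_ge0 ?powR_ge0// ltW.
rewrite /E; apply: ler_wpM2l => //.
apply: (@le_trans _ _ ((L * d) `^ (1 - p) * Dj)).
  apply: ler_wpM2r; first exact: ltW.
  by apply: ge0_ler_powR; rewrite ?nnegrE ?subr_ge0 ?(ltW p1)// mulr_ge0 ?ltW.
rewrite powRM ?(ltW L0) ?(ltW d0)// /Dj.
rewrite le_eqVlt; apply/orP; left; apply/eqP.
transitivity (L `^ (1 - p) * D `^ p * (d `^ (1 - p) * d `^ (p - 1))); first by ring.
rewrite -powRD; last by apply/implyP => _; rewrite gt_eqF.
by rewrite (_ : 1 - p + (p - 1) = 0) ?powRr0 ?mulr1//; ring.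
Qed.

End UniformMultipliers.

(** * Comparison of the quasi-norms *)

Section SumsAndSequences.
Context {R : realType}.

Lemma powR_sum_card (K : eqType) (s : seq K) (n : nat) (r : R) (u : K -> R) : 0 < r ->
  (size s <= n)%N -> (forall k, 0 <= u k) ->
  (\sum_(k <- s) u k) `^ r <= n%:R `^ r * \sum_(k <- s) u k `^ r.
Proof.
move=> r0 sn u0; set N := \sum_(k <- s) u k `^ r.
have N0 : 0 <= N by apply: sumr_ge0 => k _; exact: powR_ge0.
have uN k : k \in s -> u k <= N `^ r^-1.
  move=> ks; rewrite -[leLHS](powRr1 (u0 k)) -[X in _ `^ X](mulfV (_ : r != 0)) ?gt_eqF// powRrM.
  apply: ge0_ler_powR; rewrite ?nnegrE ?powR_ge0 ?invr_ge0 ?(ltW r0)//.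
  by rewrite /N (big_rem k ks) /= lerDl; apply: sumr_ge0 => l _; exact: powR_ge0.
have h : \sum_(k <- s) u k <= n%:R * N `^ r^-1.
  rewrite big_seq; apply: le_trans (ler_sum _ uN) _.
  rewrite -big_seq big_const_seq count_predT iter_addr_0 -[leLHS]mulr_natl.
  by apply: ler_wpM2r; [exact: powR_ge0|rewrite ler_nat].
have s0 : 0 <= \sum_(k <- s) u k by apply: sumr_ge0 => k _; exact: u0.
have := ge0_ler_powR (ltW r0) (s0 : _ \in Num.nneg) (le_trans s0 h : _ \in Num.nneg) h.
by rewrite (powRM _ (ler0n _ _) (powR_ge0 _ _)) -powRrM mulVf ?gt_eqF// powRr1.
Qed.

(** The loss for a sum of at most [n] functions of the same norm bound; [n.+1] in place of [n] keeps
    it positive. *)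
Definition sum_constant (p : \bar R) (n : nat) : R :=
  if p is r%:E then n.+1%:R * n.+1%:R `^ r^-1 else n.+1%:R.

Lemma sum_constant_gt0 p n : 0 < sum_constant p n.
Proof. by case: p => [r||] /=; rewrite ?mulr_gt0 ?powR_gt0. Qed.

(** A crude substitute for the triangle inequality, valid for all [p > 0]: pointwise, the power of
    the sum is at most [n.+1 ^ r] times the sum of the powers. *)
Lemma Lp_norm_sum (p : \bar R) (K : eqType) (s : seq K) (n : nat) (f : K -> plane R -> R[i])
    (M : \bar R) : (0 < p)%E -> (size s <= n)%N ->
  (forall k, continuous (Re \o f k) /\ continuous (Im \o f k)) ->
  continuous (Re \o (fun x => \sum_(k <- s) f k x)) ->
  continuous (Im \o (fun x => \sum_(k <- s) f k x)) ->
  (0 <= M)%E -> (forall k, k \in s -> (Lp_norm p (f k) <= M)%E) ->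
  (Lp_norm p (fun x => \sum_(k <- s) f k x)%R <= (sum_constant p n)%:E * M)%E.
Proof.
move=> p0 sn cf cs1 cs2; case: M => [m||]//; last first.
  by move=> _ _; rewrite gt0_muley ?leey// lte_fin sum_constant_gt0.
rewrite lee_fin => m0 fM.
have n0 : 0 <= n.+1%:R :> R by [].
have cu k : continuous (fun x => cmod (f k x)).
  by have [c1 c2] := cf k; exact: cmod_continuous.
have sn1 : (size s)%:R <= n.+1%:R :> R by rewrite ler_nat ltnW.
case: p p0 fM => [r||]// r0 fM; last first.
  rewrite /= /Lp_norm Lnorm_infE; last by move=> x; exact: cmod_ge0.
  apply/ess_supP; apply: nearW => x; rewrite -EFinM lee_fin.
  apply: le_trans (cmod_sum _ _ _) _.
  have fm k : k \in s -> cmod (f k x) <= m.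
    move=> /fM; rewrite /Lp_norm Lnorm_infE; last by move=> y; exact: cmod_ge0.
    by rewrite -lee_fin; apply: le_trans; exact: (ess_sup_continuous x (cu k)).
  rewrite big_seq; apply: le_trans (ler_sum _ fm) _.
  rewrite -big_seq big_const_seq count_predT iter_addr_0 -[leLHS]mulr_natl.
  exact: ler_wpM2r.
rewrite lte_fin in r0; have rn : r != 0 by rewrite gt_eqF.
have fm k : k \in s -> (\int[pleb]_x (cmod (f k x) `^ r)%:E <= (m `^ r)%:E)%E.
  move=> /fM; rewrite /Lp_norm LnormE; last by move=> y; exact: cmod_ge0.
  have : (0 <= \int[pleb]_x (cmod (f k x) `^ r)%:E)%E.
    by apply: integral_ge0 => x _; rewrite lee_fin powR_ge0.
  move: (integral _ _ _) => N N0 h.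
  have := @poweR_solve_le _ r 1 m N r0 ltr01 N0; rewrite !powR1 mul1e mulr1; exact.
rewrite /= /Lp_norm LnormE; last by move=> y; exact: cmod_ge0.
have mu k : measurable_fun [set: mplane R] (fun x => (cmod (f k x) `^ r)%:E).
  by apply/measurable_EFinP; have [c1 c2] := cf k; exact: measurable_cmod_powR.
have I0 k (x : mplane R) : (0 <= (cmod (f k x) `^ r)%:E)%E by rewrite lee_fin powR_ge0.
have ms : measurable_fun [set: mplane R] (fun x => \sum_(k <- s) (cmod (f k x) `^ r)%:E)%E.
  exact: emeasurable_sum.
have s0 (x : mplane R) : (0 <= \sum_(k <- s) (cmod (f k x) `^ r)%:E)%E by apply: sume_ge0.
have Ile : (\int[pleb]_x (cmod (\sum_(k <- s) f k x)%R `^ r)%:E <=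
    (n.+1%:R `^ r * (n.+1%:R * m `^ r))%:E)%E.
  apply: (@le_trans _ _ (\int[pleb]_x ((n.+1%:R `^ r)%:E * \sum_(k <- s) (cmod (f k x) `^ r)%:E))%E).
    apply: ge0_le_integral => //.
    - by move=> x _; rewrite lee_fin powR_ge0.
    - by apply/measurable_EFinP; exact: measurable_cmod_powR.
    - exact: emeasurable_funM.
    - move=> x _; rewrite sumEFin -EFinM lee_fin.
      apply: le_trans (powR_sum_card r0 (leqW sn) (fun k => cmod_ge0 (f k x))).
      apply: ge0_ler_powR; rewrite ?nnegrE ?(ltW r0) ?cmod_ge0//; last exact: cmod_sum.
      by apply: sumr_ge0 => k _; exact: cmod_ge0.
  rewrite (ge0_integralZl_EFin _ measurableT (fun x _ => s0 x) ms (powR_ge0 _ _)).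
  rewrite (EFinM (_ `^ r)); apply: lee_wpmul2l; first by rewrite lee_fin powR_ge0.
  rewrite (ge0_integral_sum _ measurableT mu (fun k x _ => I0 k x)) big_seq.
  apply: (le_trans (lee_sum _ fm)).
  rewrite -big_seq sumEFin lee_fin big_const_seq count_predT iter_addr_0 -[leLHS]mulr_natl.
  by apply: ler_wpM2r => //; exact: powR_ge0.
have -> : ((n.+1%:R * n.+1%:R `^ r^-1)%:E * m%:E)%E =
    ((n.+1%:R `^ r * (n.+1%:R * m `^ r))%:E `^ r^-1)%E.
  rewrite poweR_EFin -EFinM; congr (_%:E).
  rewrite (powRM _ (powR_ge0 _ _) (mulr_ge0 n0 (powR_ge0 _ _))) (powRM _ n0 (powR_ge0 _ _)).
  by rewrite -!powRrM mulfV// !powRr1// mulrA.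
apply: ge0_le_poweR; rewrite ?invr_ge0 ?(ltW r0)//.
by apply: integral_ge0 => x _; rewrite lee_fin powR_ge0.
Qed.

Lemma esum_seq_ge (I : choiceType) (a : I -> \bar R) (s : seq I) : uniq s ->
  (\sum_(i <- s) a i <= \esum_(i in [set: I]) a i)%E.
Proof.
move=> us; apply: esum_ge; exists [set` s]; first by split=> //; exact: finite_seq.
by rewrite -fsbig_seq.
Qed.

Lemma esum_seq_le (I : choiceType) (a : I -> \bar R) (M : \bar R) :
  (forall s, uniq s -> (\sum_(i <- s) a i <= M)%E) -> (\esum_(i in [set: I]) a i <= M)%E.
Proof.
move=> H; apply: ub_ereal_sup => _ [A [fA _] <-].
by rewrite fsbig_finite//; apply: H; exact: finmap.fset_uniq.
Qed.

Lemma esum_scale_le (I : choiceType) (a : I -> \bar R) (c : R) : 0 <= c ->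
  (forall i, 0 <= a i)%E ->
  (\esum_(i in [set: I]) (c%:E * a i) <= c%:E * \esum_(i in [set: I]) a i)%E.
Proof.
move=> c0 a0; apply: esum_seq_le => s us; rewrite -ge0_sume_distrr//.
by apply: lee_wpmul2l; [rewrite lee_fin|exact: esum_seq_ge].
Qed.

(** After an exchange of the finite sums, each [b i] is counted once for every [j] whose list
    contains [i], thus at most [n] times. *)
Lemma esum_bounded_overlap (I J : choiceType) (n : nat) (sI : J -> seq I) (b : I -> \bar R) :
  (forall j, uniq (sI j)) ->
  (forall i (s : seq J), uniq s -> (forall j, j \in s -> i \in sI j) -> (size s <= n)%N) ->
  (forall i, 0 <= b i)%E ->
  (\esum_(j in [set: J]) (\sum_(i <- sI j) b i) <= n%:R%:E * \esum_(i in [set: I]) b i)%E.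
Proof.
move=> us overlap b0; apply: esum_seq_le => s uqs.
pose U := undup (flatten [seq sI j | j <- s]).
have sU j : j \in s -> {subset sI j <= U}.
  by move=> js i ij; rewrite mem_undup; apply/flatten_mapP; exists j.
have E j : j \in s -> (\sum_(i <- sI j) b i = \sum_(i <- U) (if i \in sI j then b i else 0))%E.
  move=> js; rewrite -big_mkcond -big_filter; apply: perm_big.
  apply: uniq_perm; rewrite ?filter_uniq ?undup_uniq// => i.
  by rewrite mem_filter; case ij : (i \in sI j) => //=; rewrite (sU j).
rewrite big_seq (eq_bigr _ E) -big_seq exchange_big /=.
apply: (@le_trans _ _ (\sum_(i <- U) n%:R%:E * b i)%E); last first.
  rewrite -ge0_sume_distrr//; apply: lee_wpmul2l; first by rewrite lee_fin.
  by apply: esum_seq_ge; exact: undup_uniq.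
apply: lee_sum => i _; rewrite -big_mkcond -big_filter big_const_seq count_predT.
have sz : (size [seq j <- s | i \in sI j] <= n)%N.
  by apply: (overlap i); [exact: filter_uniq|move=> j; rewrite mem_filter => /andP[]].
move: sz; move: (size _) => k kn; elim: k n kn {overlap} => [|k IH] [|n']//= kn.
- by rewrite mul0e.
- by rewrite mule_ge0// lee_fin.
- rewrite -natr1 EFinD ge0_muleDl// ?lee_fin// mul1e addeC.
  by apply: leeD => //; exact: IH.
Qed.

End SumsAndSequences.

(** * Domination of one decomposition norm by the other *)

Section Comparison.
Context {R : realType} {I J : choiceType}.
Variables (p q : \bar R) (Q : I -> set (plane R)) (P : J -> set (plane R)).
Variables (w : I -> R) (v : J -> R).
Variables (phi : I -> plane R -> R[i]) (psi : J -> plane R -> R[i]) (n : nat) (C0 C1 : R).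
Hypotheses (p0 : (0 < p)%E) (q0 : (0 < q)%E).
Hypotheses (bphi : bapu Q phi) (bpsi : bapu P psi).
Hypotheses (w0 : forall i, 0 < w i) (v0 : forall j, 0 < v j).
Hypothesis QP_count : forall j, exists s : seq I,
  [/\ uniq s, (size s <= n)%N & forall i, i \in s <-> Q i `&` P j !=set0].
Hypothesis PQ_count : forall i, exists s : seq J,
  [/\ uniq s, (size s <= n)%N & forall j, j \in s <-> P j `&` Q i !=set0].
Hypothesis C0_gt0 : 0 < C0.
Hypothesis vw : forall i j, Q i `&` P j !=set0 -> v j <= C0 * w i.
Hypothesis C1_gt0 : 0 < C1.
Hypothesis multiplier : forall g i j, Zdual g -> P j `&` Q i !=set0 ->
  (Lp_norm p (band g (fun xi => phi i xi * psi j xi)%R) <= C1%:E * Lp_norm p (band g (phi i)))%E.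

Lemma band_partition g j s x : Zdual g -> uniq s ->
  (forall i, i \in s <-> Q i `&` P j !=set0) ->
  band g (psi j) x = \sum_(i <- s) band g (fun xi => phi i xi * psi j xi) x.
Proof.
move=> hg us sQP; have [tphi phiQ phi1 _] := bphi; have [tpsi psiP _ _] := bpsi.
rewrite bandE (_ : (fun xi => _) =
    (fun xi => \sum_(i <- s) phi i xi * psi j xi * wave x xi)); last first.
  apply/funext => xi; rewrite -!mulr_suml.
  have [Pxi|/psiP->] := pselect (P j xi); last by rewrite mulr0 mul0r.
  rewrite fsbig_seq// (@fsbig_widen _ _ _ _ [set` s] setT) ?phi1 ?mul1r// => i [_ /= iNs].
  by apply: phiQ => Qi; apply: iNs; apply/sQP; exists xi.
rewrite (hat_sum hg) => [|i]; last first.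
  by apply: testM; [apply: testM => //; exact: test_csmooth|exact: csmooth_wave].
by apply: eq_bigr => i _; rewrite bandE.
Qed.

Let K := sum_constant p n * (C0 * C1).

Let K_gt0 : 0 < K. Proof. by rewrite !mulr_gt0// sum_constant_gt0. Qed.

(** The free bound [M] serves all [q]: it is the supremum of the weighted norms for [q = +oo], and
    their [l^q] norm over the neighbours of [P j] for finite [q]. *)
Lemma weighted_band_le g j s (M : \bar R) : Zdual g -> uniq s -> (size s <= n)%N ->
  (forall i, i \in s <-> Q i `&` P j !=set0) -> (0 <= M)%E ->
  (forall i, i \in s -> ((w i)%:E * Lp_norm p (band g (phi i)) <= M)%E) ->
  ((v j)%:E * Lp_norm p (band g (psi j)) <= K%:E * M)%E.
Proof.
move=> hg us sn sQP M0 HM; have [tphi phiQ phi1 _] := bphi; have [tpsi psiP _ _] := bpsi.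
have tij i : test_function (fun xi => phi i xi * psi j xi).
  by apply: testM => //; exact: test_csmooth.
have vj0 : (0 <= (v j)%:E)%E by rewrite lee_fin ltW.
have vj : v j != 0 by rewrite gt_eqF.
pose M' := ((C0 * C1 / v j)%:E * M)%E.
have M'0 : (0 <= M')%E.
  by apply: mule_ge0 => //; rewrite lee_fin !mulr_ge0 ?invr_ge0// ltW.
have E : (fun x => band g (psi j) x) =
    (fun x => \sum_(i <- s) band g (fun xi => phi i xi * psi j xi) x).
  by apply/funext => x; exact: band_partition.
have [c1 c2] := band_continuous hg (tpsi j).
have := @Lp_norm_sum R p I s n (fun i => band g (fun xi => phi i xi * psi j xi)) M' p0 sn.
rewrite -E => H.
have {H} := H (fun i => band_continuous hg (tij i)) c1 c2 M'0.
move=> H; apply: (@le_trans _ _ ((v j)%:E * ((sum_constant p n)%:E * M'))%E).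
  apply: lee_wpmul2l => //; apply: H => i si.
  have PQ : P j `&` Q i !=set0 by rewrite setIC; apply/sQP.
  apply: (le_trans (multiplier hg PQ)).
  have vw' : v j <= C0 * w i by apply: vw; apply/sQP.
  have w1 : 0 < w i by [].
  have L0 : (0 <= Lp_norm p (band g (phi i)))%E by exact: Lnorm_ge0.
  apply: (@le_trans _ _ ((C0 * C1 / v j)%:E * ((w i)%:E * Lp_norm p (band g (phi i))))%E).
    rewrite muleA; apply: lee_wpmul2r => //; rewrite -EFinM lee_fin.
    rewrite mulrAC ler_pdivlMr// mulrAC [C1 * _]mulrC.
    by apply: ler_wpM2r => //; exact: ltW.
  apply: lee_wpmul2l; last exact: HM.
  by rewrite lee_fin !mulr_ge0 ?invr_ge0// ltW.
rewrite /M' !muleA -!EFinM le_eqVlt; apply/orP; left; apply/eqP.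
by congr (_%:E * _)%E; rewrite /K; field.
Qed.

(** [QP_count] bounds the number of pieces into which a band is cut, [PQ_count] the number of bands
    in which a given piece reappears; the latter controls the double sum for finite [q]. *)
Lemma decomp_norm_le : exists2 D : R, 0 < D &
  forall g, Zdual g -> (decomp_norm p q psi v g <= D%:E * decomp_norm p q phi w g)%E.
Proof.
pose b g i := ((w i)%:E * Lp_norm p (band g (phi i)))%E.
pose a g j := ((v j)%:E * Lp_norm p (band g (psi j)))%E.
have b0 g i : (0 <= b g i)%E by apply: mule_ge0; [rewrite lee_fin ltW|exact: Lnorm_ge0].
have a0 g j : (0 <= a g j)%E by apply: mule_ge0; [rewrite lee_fin ltW|exact: Lnorm_ge0].
suff [D D0 H] : exists2 D : R, 0 < D & forall g, Zdual g ->
    (lq_norm q (a g) <= D%:E * lq_norm q (b g))%E by exists D.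
have [_ _ phi_sum _] := bphi.
case: q q0 => [r||]// r0; last first.
  exists K => // g hg /=; apply: ub_ereal_sup => _ [j _ <-].
  have [s [us sn sQP]] := QP_count j.
  apply: (weighted_band_le hg us sn sQP).
    (* The supremum is nonnegative because [I] is nonempty, an empty family having sum [0] instead
       of [1]. *)
    have [[i0]|I0] := pselect (exists i : I, True).
      by move=> _; apply: le_trans (b0 g i0) _; apply: ereal_sup_ubound; exists i0.
    have := phi_sum 0; rewrite (_ : [set: I] = set0) ?fsbig_set0.
      by move=> /esym/eqP; rewrite oner_eq0.
    by apply/seteqP; split=> // i; exfalso; apply: I0; exists i.
  by move=> i _; apply: ereal_sup_ubound; exists i.
rewrite lte_fin in r0; have rn : r != 0 by rewrite gt_eqF.
have ri : 0 <= r^-1 by rewrite invr_ge0 ltW.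
(* The summand [1] keeps the constant positive if [n = 0]. *)
exists (K * n%:R `^ r^-1 + 1); first by rewrite ltr_wpDl// mulr_ge0 ?powR_ge0// ltW.
move=> g hg /=.
have [sI HsI] := choice QP_count.
have key j : (a g j `^ r <= (K `^ r)%:E * \sum_(i <- sI j) (b g i `^ r))%E.
  have [us sn sQP] := HsI j.
  set N := (\sum_(i <- _) _)%E; have N0 : (0 <= N)%E by apply: sume_ge0 => i _; exact: poweR_ge0.
  have h : (a g j <= K%:E * N `^ r^-1)%E.
    apply: (weighted_band_le hg us sn sQP); first exact: poweR_ge0.
    move=> i si; rewrite -/(b g i).
    have : ((b g i `^ r) `^ r^-1 <= N `^ r^-1)%E.
      apply: ge0_le_poweR => //; first exact: poweR_ge0.
      rewrite /N (big_rem i si) /=; apply: leeDl; apply: sume_ge0 => k _; exact: poweR_ge0.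
    by rewrite -poweRrM mulfV// poweRe1.
  have := ge0_le_poweR (ltW r0) (a0 g j) h.
  rewrite poweRM ?lee_fin ?(ltW K_gt0) ?poweR_ge0// poweR_EFin.
  by rewrite -poweRrM mulVf// poweRe1.
set B := (\esum_(i in _) (b g i `^ r))%E.
have B0 : (0 <= B)%E by apply: esum_ge0 => i _; exact: poweR_ge0.
have h : (\esum_(j in [set: J]) (a g j `^ r) <= (K `^ r)%:E * (n%:R%:E * B))%E.
  apply: (@le_trans _ _ (\esum_(j in [set: J]) ((K `^ r)%:E * \sum_(i <- sI j) (b g i `^ r)))%E).
    by apply: le_esum => j _; exact: key.
  apply: le_trans (esum_scale_le (powR_ge0 K r) _) _.
    by move=> j; apply: sume_ge0 => i _; exact: poweR_ge0.
  apply: lee_wpmul2l; first by rewrite lee_fin powR_ge0.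
  apply: esum_bounded_overlap.
  - by move=> j; have [] := HsI j.
  - move=> i s us sij; have [t [ut tn tP]] := PQ_count i.
    apply: leq_trans tn; apply: uniq_leq_size => // j js; apply/tP.
    by have [_ _ HQP] := HsI j; rewrite setIC; apply/HQP/sij.
  - by move=> i; exact: poweR_ge0.
apply: le_trans (ge0_le_poweR ri _ h) _.
  by apply: esum_ge0 => i _; exact: poweR_ge0.
rewrite poweRM ?lee_fin ?powR_ge0 ?mule_ge0 ?lee_fin// poweRM ?lee_fin//.
rewrite !poweR_EFin muleA -EFinM -powRrM mulfV// powRr1 ?(ltW K_gt0)//.
by apply: lee_wpmul2r; [exact: poweR_ge0|rewrite lee_fin lerDl].
Qed.

End Comparison.

Lemma equivalent_norms_of_le (R : realType) (X : Type) (Z : set X) (n1 n2 : X -> \bar R) :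
  (exists2 D : R, 0 < D & forall g, Z g -> (n2 g <= D%:E * n1 g)%E) ->
  (exists2 D : R, 0 < D & forall g, Z g -> (n1 g <= D%:E * n2 g)%E) ->
  (forall g, 0 <= n1 g)%E -> (forall g, 0 <= n2 g)%E ->
  equal_with_equivalent_norms [set g | Z g /\ (n1 g < +oo)%E] [set g | Z g /\ (n2 g < +oo)%E] n1 n2.
Proof.
move=> [D1 D10 H1] [D2 D20 H2] n10 n20.
have fin (x y : \bar R) (D : R) : 0 < D -> (x <= D%:E * y)%E -> (0 <= y)%E -> (y < +oo)%E -> (x < +oo)%E.
  move=> D0 xy y0 yoo; apply: (le_lt_trans xy).
  by rewrite lte_mul_pinfty// lee_fin ltW.
split.
  apply/seteqP; split=> g [Zg h]; split=> //.
    exact: fin D10 (H1 g Zg) (n10 g) h.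
  exact: fin D20 (H2 g Zg) (n20 g) h.
exists (D1 + D2); first exact: addr_gt0.
move=> g [Zg _]; split.
  apply: (le_trans (H2 g Zg)); apply: lee_wpmul2r => //.
  by rewrite lee_fin lerDr ltW.
apply: (le_trans (H1 g Zg)); apply: lee_wpmul2r => //.
by rewrite lee_fin lerDl ltW.
Qed.

(** For [q = +oo] the supremum over an empty index set would be [-oo]; the partition of unity
    excludes this. *)
Lemma decomp_norm_ge0 (R : realType) (I : choiceType) (p q : \bar R) (Q : I -> set (plane R))
    (phi : I -> plane R -> R[i]) (w : I -> R) g :
  bapu Q phi -> (forall i, 0 < w i) -> (0 <= decomp_norm p q phi w g)%E.
Proof.
move=> [_ _ phi_sum _] w0; rewrite /decomp_norm /lq_norm; case: q => [r||]//; first exact: poweR_ge0.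
have [[i _]|I0] := pselect (exists i : I, True).
  apply: le_trans (ereal_sup_ubound _); last by exists i.
  by apply: mule_ge0; [rewrite lee_fin ltW|exact: Lnorm_ge0].
have := phi_sum 0; rewrite (_ : [set: I] = set0) ?fsbig_set0.
  by move=> /esym/eqP; rewrite oner_eq0.
by apply/seteqP; split=> // i; exfalso; apply: I0; exists i.
Qed.

Theorem theorem7p7 (R : realType) (p q : \bar R) (alpha beta : R)
    (I J : choiceType) (Q : I -> set (plane R)) (P : J -> set (plane R))
    (w : I -> R) (v : J -> R)
    (hp : (0 < p)%E) (hq : (0 < q)%E)
    (halpha : 0 <= alpha <= 1) (hbeta : 0 <= beta <= 1)
    (hQ : alpha_beta_covering alpha beta Q)
    (hP : alpha_beta_covering alpha beta P)
    (hw : moderate_weight Q w) (hv : moderate_weight P v)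
    (hwv : exists2 C : R, 0 < C & forall i j, Q i `&` P j !=set0 ->
             w i <= C * v j /\ v j <= C * w i) :
  ((1 <= p)%E ->
     forall (phi : I -> plane R -> R[i]) (psi : J -> plane R -> R[i]),
       bapu Q phi -> bapu P psi ->
       equal_with_equivalent_norms
         (decomp_space p q phi w) (decomp_space p q psi v)
         (decomp_norm p q phi w) (decomp_norm p q psi v)) /\
  ((p < 1)%E -> beta <= alpha ->
     forall (T : I -> 'M[R]_2) (b : I -> plane R)
            (S : J -> 'M[R]_2) (c : J -> plane R),
       semi_structured Q T b -> semi_structured P S c ->
     forall (phi : I -> plane R -> R[i]) (psi : J -> plane R -> R[i]),
       quasi_bapu p Q T phi -> quasi_bapu p P S psi ->
       equal_with_equivalent_norms
         (decomp_space p q phi w) (decomp_space p q psi v)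
         (decomp_norm p q phi w) (decomp_norm p q psi v)).
Proof.
have [w0 _] := hw; have [v0 _] := hv; have [C C_gt0 HC] := hwv.
have [n1 H1] := covering_count halpha hbeta hP hQ.
have [n2 H2] := covering_count halpha hbeta hQ hP.
(* The two counting bounds are raised to their sum, so that one number serves both directions of the
   comparison. *)
have count (A B : choiceType) (U : A -> set (plane R)) (V : B -> set (plane R)) m k :
    (forall j, exists s : seq A, [/\ uniq s, (size s <= m)%N & forall i, i \in s <-> U i `&` V j !=set0]) ->
    forall j, exists s : seq A, [/\ uniq s, (size s <= m + k)%N & forall i, i \in s <-> U i `&` V j !=set0].
  by move=> H j; have [s [us sm sP]] := H j; exists s; split=> //; apply: leq_trans sm (leq_addr _ _).
have QP := count _ _ _ _ _ n2 H1; have PQ := count _ _ _ _ _ n1 H2; rewrite addnC in PQ.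
have vw i j : Q i `&` P j !=set0 -> v j <= C * w i by move=> /HC[].
have wv j i : P j `&` Q i !=set0 -> w i <= C * v j by rewrite setIC => /HC[].
split=> [p1|p1 ba] => [phi psi bphi bpsi|T b S c hT hS phi psi qphi qpsi].
  have [tphi _ _ _] := bphi; have [tpsi _ _ _] := bpsi.
  have [D1 D10 M1] := multiplier_bound_banach p1 tphi bpsi.
  have [D2 D20 M2] := multiplier_bound_banach p1 tpsi bphi.
  apply: equivalent_norms_of_le.
  - by apply: (decomp_norm_le hp hq bphi bpsi w0 v0 QP PQ C_gt0 vw D10) => g i j hg _; exact: M1.
  - by apply: (decomp_norm_le hp hq bpsi bphi v0 w0 PQ QP C_gt0 wv D20) => g j i hg _; exact: M2.
  - by move=> g; exact: decomp_norm_ge0 bphi w0.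
  - by move=> g; exact: decomp_norm_ge0 bpsi v0.
case: p hp p1 qphi qpsi => [r||]// r0 r1 qphi qpsi.
have r01 : 0 < r < 1 by rewrite -!lte_fin r0.
have [bphi _] := qphi; have [bpsi _] := qpsi.
have [tphi phiQ _ _] := bphi; have [tpsi psiP _ _] := bpsi.
have [D1 D10 M1] := multiplier_bound_quasi r01 halpha hbeta ba hQ hP hS tphi phiQ qpsi.
have [D2 D20 M2] := multiplier_bound_quasi r01 halpha hbeta ba hP hQ hT tpsi psiP qphi.
apply: equivalent_norms_of_le.
- exact: (decomp_norm_le r0 hq bphi bpsi w0 v0 QP PQ C_gt0 vw D10 M1).
- exact: (decomp_norm_le r0 hq bpsi bphi v0 w0 PQ QP C_gt0 wv D20 M2).
- by move=> g; exact: decomp_norm_ge0 bphi w0.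
- by move=> g; exact: decomp_norm_ge0 bpsi v0.
Qed.
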